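(* Let $(M,\{\phi_h\}_{h=1}^H,\{\mathcal U_h\}_{h=1}^H)$ be an $\mathcal I$-Locally Linearizable MDP (with compact parameter sets $\mathcal B_{h,n}\subset\mathbb R^{d_h}$, $h\in[H]$, $n\in[N_h]$), where $M$ satisfies the normalization assumption stated in the context. Assume that $L_\phi=\mathcal O(1)$ and $\sup_{n\in[N_h]}\mathcal R_{h,n}=\mathcal O(\sqrt{d_h})$ for every $h\in[H]$. Then, for $\delta\in(0,1)$, with probability at least $1-\delta$, the algorithm \textsc{Cinderella} run with $\lambda=1$ has, after $K$ episodes, regret $$R_K=\widetilde{\mathcal O}\left(\sum_{h=1}^H N_hd_h\sqrt K+\sum_{h=1}^H\sqrt{d_h}\,\mathcal I\,K\right).$$
   Context: **MDP.** A finite-horizon MDP is $M=(\mathcal S,\mathcal A,p,r,H)$; $\mathcal Z=\mathcal S\times\mathcal A$, $z=(s,a)$. In each episode $k\in[K]$ the initial state $s_1^k$ is chosen arbitrarily by the environment, the agent chooses a policy $\pi_k=\{\pi_{k,h}\}_{h=1}^H$ (maps from states to distributions over actions), and for $h=1,\dots,H$ plays $a_h^k\sim\pi_{k,h}(\cdot|s_h^k)$, receives a random reward $r_h^k$ of mean $r_h(z_h^k)$, $z_h^k=(s_h^k,a_h^k)$, independent of the past, and moves to $s_{h+1}^k\sim p_h(\cdot|z_h^k)$. $Q_h^\pi(z)=\mathbb E_\pi[\sum_{\ell=h}^H r_\ell(z_\ell)\mid z_h=z]$, $V_h^\pi(s)=\mathbb E_{a\sim\pi_h(\cdot|s)}[Q_h^\pi(s,a)]$,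 $Q_h^\star=\sup_\pi Q_h^\pi$, $V_h^\star=\sup_\pi V_h^\pi$. Bellman optimality operator: $\mathcal T_hf(s,a)=r_h(s,a)+\mathbb E_{s'\sim p_h(\cdot|s,a)}[\sup_{a'}f(s',a')]$. Regret: $R_K=\sum_{k=1}^K(V_1^\star(s_1^k)-V_1^{\pi_k}(s_1^k))$. **Normalization assumption.** The instantaneous reward minus its mean $r_h(s,a)$ is $1$-subgaussian, and $0\le Q_h^\pi(z)\le1$ for all $\pi,z,h$. **Locally Linearizable MDPs.** For each $h\in[H]$, $\phi_h:\mathcal Z\to\mathbb R^{d_h}$ is a known feature map and $\mathcal U_h=\{\mathcal Z_{h,n}\}_{n=1}^{N_h}$ a known partition of $\mathcal Z$; $\rho_h:\mathcal Z\to[N_h]$ maps $z$ to the index of its region. $\mathcal B_{h,n}\subset\mathbb R^{d_h}$ are compact sets, $\mathcal B_h=\prod_n\mathcal B_{h,n}$. For $\boldsymbol\theta_h=\{\theta_{h,n}\}_n\in\mathcal B_h$ let $Q_h[\boldsymbol\theta_h](z)=\phi_h(z)^\top\theta_{h,\rho_h(z)}$; $\mathcal Q_h=\{Q_h[\boldsymbol\theta_h]:\boldsymbol\theta_h\in\mathcal B_h\}$, $\mathcal V_h=\{s\mapsto\sup_aQ(s,a):Q\in\mathcal Q_h\}$, with the convention that at step $H+1$ the only function is $0$. The inherent Bellman error is $$\mathcal I(\phi,\mathcal U)=\max_{h\in[H]}\sup_{\boldsymbol\theta_{h+1}\in\mathcal B_{h+1}}\inf_{\boldsymbol\theta_h\in\mathcal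 B_h}\|Q_h[\boldsymbol\theta_h]-\mathcal T_hQ_{h+1}[\boldsymbol\theta_{h+1}]\|_{L^\infty}.$$ The triple is $\mathcal I$-Locally Linearizable if $\mathcal I(\phi,\mathcal U)\le\mathcal I$. $L_\phi=\sup_{h,z}\|\phi_h(z)\|_2$; $\mathcal R_{h,n}=\mathrm{diam}(\mathcal B_{h,n})$ (Euclidean), also used as a bound on $\|\theta\|_2$ for $\theta\in\mathcal B_{h,n}$. **Algorithm \textsc{Cinderella}** (inputs $\delta$, $\lambda>0$, $\rho_h$, $\phi_h$). Let $\phi_h^k=\phi_h(z_h^k)$, $\Lambda_{h,n}^k=\lambda I+\sum_{\tau=1}^{k-1}\mathbf 1\{\rho_h(z_h^\tau)=n\}\phi_h^\tau(\phi_h^\tau)^\top$, $p_{h,n}^k=\sum_{\tau=1}^{k-1}\mathbf 1\{\rho_h(z_h^\tau)=n\}$, $\|x\|_A=\sqrt{x^\top Ax}$. At episode $k$, after receiving $s_1^k$, solve $$\max_{\widehat\theta_{h,n},\overline\xi_{h,n},\overline\theta_{h,n}}\ \max_{a\in\mathcal A}\phi_1(s_1^k,a)^\top\overline\theta_{1,\rho_1(s_1^k,a)}$$ subject, for all $h,n$, to $\overline\theta_{h,n}\in\mathcal B_{h,n}$, $\overline\theta_{h,n}=\widehat\theta_{h,n}+\overline\xi_{h,n}$, $\|\overline\xi_{h,n}\|_{\Lambda_{h,n}^k}\le\sqrt{\alpha_{h,n}^k}$, and $$\widehat\theta_{h,n}=(\Lambda_{h,n}^k)^{-1}\sum_{\tau=1}^{k-1}\mathbf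 1\{\rho_h(z_h^\tau)=n\}\phi_h^\tau\Big(r_h^\tau+\max_{a}\phi_{h+1}(s_{h+1}^\tau,a)^\top\overline\theta_{h+1,\rho_{h+1}(s_{h+1}^\tau,a)}\Big)$$ (the max term being $0$ for $h=H$). With solution $\overline{\boldsymbol\theta}_h^k$, for $h=1,\dots,H$ play $a_h^k\in\arg\max_aQ_h[\overline{\boldsymbol\theta}_h^k](s_h^k,a)$. The exploration constants are $\sqrt{\alpha_{h,n}^k}=\sqrt{\beta_{h,n}^k}+\sqrt{p_{h,n}^k}\,\mathcal I+\lambda^{-1}\mathcal R_{h,n}$, where $\sqrt{\beta_{h,n}^k}=\widetilde{\mathcal O}\big(\sqrt{d_h+\log\mathcal N(1/\sqrt k,\mathcal V_{h+1})+\log(N_hHK/\delta)}\big)$ are confidence thresholds such that, with probability at least $1-\delta$, for all $h,n,k$ and all $V\in\mathcal V_{h+1}$, $\|\sum_{\tau<k}\mathbf 1\{\rho_h(z_h^\tau)=n\}\phi_h^\tau\eta_h^\tau(V)\|_{(\Lambda_{h,n}^k)^{-1}}\le\sqrt{\beta_{h,n}^k}$, with $\eta_h^\tau(V)=r_h^\tau-r_h(z_h^\tau)+V(s_{h+1}^\tau)-\mathbb E_{s'\sim p_h(\cdot|z_h^\tau)}[V(s')]$; $\mathcal N(\varepsilon,\mathcal V)$ is the $\varepsilon$-covering number in sup norm. $\widetilde{\mathcal O}$ hides absolute constants and factors polylogarithmic in $K,H,1/\delta,L_\phi$, and the other problem parameters.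
   Formalization: The confidence property of the thresholds β is assumed with probability at least 1−δ/2 instead of 1−δ (their growth is still stated with δ), because at level exactly 1−δ the regret bound can fail with probability larger than δ. *)

(* Defs.v *)
From HB Require Import structures.
From mathcomp Require Import all_boot all_order all_algebra.
From mathcomp Require Import all_classical all_reals all_analysis.
From mathcomp Require Import measurable_realfun.
Import Order.TTheory GRing.Theory Num.Theory.
Import numFieldNormedType.Exports.

Set Implicit Arguments.
Unset Strict Implicit.
Unset Printing Implicit Defensive.

Local Open Scope classical_set_scope.
Local Open Scope ring_scope.

(* Indexing.  Steps and episodes are numbered from 0: step h < H stands for the
   mathematical step h + 1, and episode k < K for episode k + 1.  Families are
   indexed by nat; only their values at h < H (resp. k < K) are ever constrained
   or used, except for the state reached at the end of an episode (step H). *)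

Section Norms.
Context {R : realType}.

Definition enorm n (x : 'cV[R]_n) : R := Num.sqrt (\sum_i x i 0 ^+ 2).

Definition wnorm n (A : 'M[R]_n) (x : 'cV[R]_n) : R :=
  Num.sqrt ((x^T *m A *m x) 0 0).

Definition dotp n (x y : 'cV[R]_n) : R := (x^T *m y) 0 0.

(* A real supremum: meaningful on bounded sets, in particular compact ones. *)
Definition diam n (B : set 'cV[R]_n) : R :=
  sup [set enorm (p.1 - p.2) | p in B `*` B].

Definition supnorm T (f : T -> R) : \bar R :=
  ereal_sup (range (fun x => `|f x|%:E)).

(* Smallest cardinality of a cover of V by closed sup-norm balls of radius eps
   centred in V.  It is only used on sets that have a finite cover. *)
Definition covering_number T (eps : R) (V : set (T -> R)) : R :=
  inf [set m%:R | m in [set m : nat | exists c : 'I_m -> T -> R,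
    (forall i, V (c i)) /\
    (forall f, V f ->
       exists i, (supnorm (fun x => f x - c i x)%R <= eps%:E)%E)]].

End Norms.

Section MDP.
Context {R : realType} {dS dA : measure_display}.
Context {S : measurableType dS} {A : measurableType dA}.

Record mdp := Mdp {
  horizon : nat;
  trans : nat -> R.-pker (S * A)%type ~> S;
  (* law of the instantaneous reward *)
  rewlaw : nat -> R.-pker (S * A)%type ~> (R : measurableType _) }.

Definition policy := nat -> R.-pker S ~> A.

Definition rmean (M : mdp) (h : nat) (z : S * A) : R :=
  \int[rewlaw M h z]_x x.

Definition subgaussian1 (mu : {measure set (R : measurableType _) -> \bar R})
    (m : R) :=
  forall t : R,
    (\int[mu]_x (expR (t * (x - m)))%:E <= (expR (t ^+ 2 / 2))%:E)%E.

(* E_pi[G(z_h, ..., z_(h+n)) | z_h = z]: the integral of G against the law of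
   the trajectory, written as the iterated integral that defines this law. *)
Fixpoint traj_expectation (M : mdp) (pi : policy) (h n : nat) (z : S * A)
    (G : seq (S * A) -> R) : R :=
  match n with
  | 0 => G [:: z]
  | n'.+1 => \int[trans M h z]_s' \int[pi h.+1 s']_a'
      traj_expectation M pi h.+1 n' (s', a') (fun t => G (z :: t))
  end.

Definition Qpi (M : mdp) (pi : policy) (h : nat) (z : S * A) : R :=
  traj_expectation M pi h (horizon M - h.+1) z
    (fun t => \sum_(i < size t) rmean M (h + i) (nth z t i)).

Definition Vpi (M : mdp) (pi : policy) (h : nat) (s : S) : R :=
  \int[pi h s]_a Qpi M pi h (s, a).

Definition Vstar (M : mdp) (h : nat) (s : S) : R :=
  sup (range (fun pi : policy => Vpi M pi h s)).

Definition normalized (M : mdp) :=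
  (forall h z, (h < horizon M)%N ->
     subgaussian1 (rewlaw M h z) (rmean M h z)) /\
  (forall (pi : policy) h z, (h < horizon M)%N -> 0 <= Qpi M pi h z <= 1).

Definition supA (f : S * A -> R) (s : S) : R := sup (range (fun a => f (s, a))).

Definition bellman (M : mdp) (h : nat) (f : S * A -> R) (z : S * A) : R :=
  rmean M h z + \int[trans M h z]_s' supA f s'.

End MDP.
Arguments mdp R {dS dA} S A.
Arguments policy R {dS dA} S A.

Section LocallyLinearizable.
Context {R : realType} {dS dA : measure_display}.
Context {S : measurableType dS} {A : measurableType dA}.

(* Feature maps, partitions (through the index maps rho, the n-th region of
   step h being rho h @^-1` [set n]) and parameter sets. *)
Record features := Features {
  fdim : nat -> nat;
  nreg : nat -> nat;
  phi : forall h, S * A -> 'cV[R]_(fdim h);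
  rho : forall h, S * A -> 'I_(nreg h);
  Bset : forall h, 'I_(nreg h) -> set 'cV[R]_(fdim h) }.

Arguments Bset f {h} n _.

Definition param (L : features) := forall h, 'I_(nreg L h) -> 'cV[R]_(fdim L h).

Definition Qfun (L : features) h (th : 'I_(nreg L h) -> 'cV[R]_(fdim L h))
  (z : S * A) : R := dotp (phi L h z) (th (rho L h z)).

Definition Qclass (L : features) (H h : nat) : set (S * A -> R) :=
  if (h < H)%N then
    [set Qfun th | th in [set th : 'I_(nreg L h) -> 'cV[R]_(fdim L h) |
                          forall n, Bset L n (th n)]]
  else [set fun=> 0].

Definition Vclass (L : features) (H h : nat) : set (S -> R) :=
  [set supA f | f in Qclass L H h].

Definition inherent_bellman_error (M : mdp R S A) (L : features) : \bar R :=
  \big[maxe/-oo%E]_(h < horizon M)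
    ereal_sup [set ereal_inf [set supnorm (fun z => g z - bellman M h f z)%R
                             | g in Qclass L (horizon M) h]
              | f in Qclass L (horizon M) h.+1].

(* The measurability clauses make the integrals over s' and the random
   quantities of the learning process meaningful. *)
Definition locally_linearizable (M : mdp R S A) (L : features) (I : R) :=
  let H := horizon M in
  [/\ forall h, (h < H)%N -> (0 < fdim L h)%N,
      forall h, (h < H)%N ->
        [/\ forall i, measurable_fun [set: S * A] (fun z => phi L h z i 0),
            forall n, measurable (rho L h @^-1` [set n]) &
            forall V, Vclass L H h V -> measurable_fun [set: S] V],
      forall h n, (h < H)%N -> compact (Bset L (h := h) n) &
      (inherent_bellman_error M L <= I%:E)%E].

Definition Lphi (L : features) (H : nat) : \bar R :=
  ereal_sup [set x | exists h z, (h < H)%N /\ x = (enorm (phi L h z))%:E].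

Definition Rdiam (L : features) h (n : 'I_(nreg L h)) : R :=
  diam (Bset L n).

(* Reference quantity for soft-O bounds: an expression is soft-O of b when it is
   at most C * logfac ^+ m * b for some constants C and m. *)
Definition logfac (L : features) (H K : nat) (delta : R) : R :=
  1 + ln K%:R + ln H%:R + ln delta^-1 + ln (1 + fine (Lphi L H))
    + ln (\sum_(h < H) (nreg L h * fdim L h)%:R).

End LocallyLinearizable.
Arguments features R {dS dA} S A.
Arguments Bset {R dS dA S A} f {h} n _.

Section Interaction.
Context {R : realType} {dS dA dO : measure_display}.
Context {S : measurableType dS} {A : measurableType dA}.
Context {Omega : measurableType dO}.

(* [filt k h] is the information available right before the action of step h of
   episode k is drawn, [filtA k h] right after it is drawn. *)
Record process := Process {
  filt : nat -> nat -> set (set Omega);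
  filtA : nat -> nat -> set (set Omega);
  st : nat -> nat -> Omega -> S;
  ac : nat -> nat -> Omega -> A;
  rw : nat -> nat -> Omega -> R;
  pol : nat -> Omega -> policy R S A }.

Definition za (X : process) (k h : nat) (w : Omega) : S * A :=
  (st X k h w, ac X k h w).

Definition adapted d (T : measurableType d) (F : set (set Omega))
  (Y : Omega -> T) := forall B, measurable B -> F (Y @^-1` B).

(* kappa is the conditional law of Y given F *)
Definition cond_law (P : probability Omega R) d (T : measurableType d)
    (F : set (set Omega)) (Y : Omega -> T) (kappa : Omega -> set T -> \bar R) :=
  forall E B, F E -> measurable B ->
    P (E `&` Y @^-1` B) = (\int[P]_(w in E) kappa w B)%E.

(* The agent-environment protocol over K episodes.  The initial states are only
   required to be adapted, so the environment may choose them adversarially from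
   the whole past; the policy of an episode is chosen after its initial state is
   revealed. *)
Record mdp_interaction (P : probability Omega R) (M : mdp R S A) (K : nat)
    (X : process) : Prop := MdpInteraction {
  int_sigma : forall k h, (k < K)%N -> (h <= horizon M)%N ->
    [/\ sigma_algebra setT (filt X k h), filt X k h `<=` measurable,
        sigma_algebra setT (filtA X k h) & filtA X k h `<=` measurable];
  int_mono : forall k h, (k < K)%N -> (h < horizon M)%N ->
    filt X k h `<=` filtA X k h /\ filtA X k h `<=` filt X k h.+1;
  int_next : forall k, (k.+1 < K)%N ->
    filt X k (horizon M) `<=` filt X k.+1 0;
  int_state : forall k h, (k < K)%N -> (h <= horizon M)%N ->
    adapted (filt X k h) (st X k h);
  int_policy : forall k h B, (k < K)%N -> (h < horizon M)%N -> measurable B ->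
    measurable_fun setT ((fun x => pol X k x.1 h x.2 B) :
      (g_sigma_algebraType (filt X k 0) * S)%type -> \bar R);
  int_action : forall k h, (k < K)%N -> (h < horizon M)%N ->
    adapted (filtA X k h) (ac X k h) /\
    cond_law P (filt X k h) (ac X k h) (fun w B => pol X k w h (st X k h w) B);
  int_reward : forall k h, (k < K)%N -> (h < horizon M)%N ->
    adapted (filt X k h.+1) (rw X k h : Omega -> (R : measurableType _)) /\
    cond_law P (filtA X k h) (rw X k h : Omega -> (R : measurableType _))
      (fun w B => rewlaw M h (za X k h w) B);
  int_trans : forall k h, (k < K)%N -> (h < horizon M)%N ->
    cond_law P (filtA X k h) (st X k h.+1)
      (fun w B => trans M h (za X k h w) B) }.

Definition regret (M : mdp R S A) (X : process) (K : nat) (w : Omega) : R :=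
  \sum_(k < K) (Vstar M 0 (st X k 0 w) - Vpi M (pol X k w) 0 (st X k 0 w)).

(* Inner probability: the set of good outcomes contains an event of
   probability at least p. *)
Definition with_prob (P : probability Omega R) (p : R) (good : set Omega) :=
  exists E : set Omega,
    [/\ measurable E, (p%:E <= P E)%E & E `<=` good].

End Interaction.
Arguments process R {dS dA dO} S A Omega.

Section Cinderella.
Context {R : realType} {dS dA dO : measure_display}.
Context {S : measurableType dS} {A : measurableType dA}.
Context {Omega : measurableType dO}.
Variables (M : mdp R S A) (L : features R S A) (I lam : R).
Variable X : process R S A Omega.
Let H := horizon M.

(* The sums over past episodes run over tau < k, that is, over the k episodes
   preceding the current one. *)
Definition gram (k h : nat) (n : 'I_(nreg L h)) (w : Omega) : 'M[R]_(fdim L h) :=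
  lam%:M + \sum_(tau < k | rho L h (za X tau h w) == n)
             phi L h (za X tau h w) *m (phi L h (za X tau h w))^T.

Definition visits (k h : nat) (n : 'I_(nreg L h)) (w : Omega) : nat :=
  \sum_(tau < k | rho L h (za X tau h w) == n) 1.

Definition next_value (h : nat) (th : param L) (s : S) : R :=
  if (h.+1 < H)%N then supA (Qfun (th h.+1)) s else 0.

Definition least_squares (k h : nat) (n : 'I_(nreg L h)) (th : param L)
    (w : Omega) : 'cV[R]_(fdim L h) :=
  invmx (gram k n w) *m
    \sum_(tau < k | rho L h (za X tau h w) == n)
      (rw X tau h w + next_value h th (st X tau h.+1 w))
        *: phi L h (za X tau h w).

Variable beta : nat -> forall h, 'I_(nreg L h) -> R.

Definition sqrt_alpha (k h : nat) (n : 'I_(nreg L h)) (w : Omega) : R :=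
  Num.sqrt (beta k n) + Num.sqrt (visits k n w)%:R * I + lam^-1 * Rdiam n.

Definition feasible (k : nat) (w : Omega) (hat xi bar : param L) :=
  forall h (n : 'I_(nreg L h)), (h < H)%N ->
    [/\ Bset L n (bar h n), bar h n = hat h n + xi h n,
        wnorm (gram k n w) (xi h n) <= sqrt_alpha k n w &
        hat h n = least_squares k n bar w].

Definition objective (k : nat) (w : Omega) (bar : param L) : R :=
  supA (Qfun (bar 0)) (st X k 0 w).

Definition is_solution (k : nat) (w : Omega) (bar : param L) :=
  (exists hat xi, feasible k w hat xi bar) /\
  (forall hat' xi' bar', feasible k w hat' xi' bar' ->
     objective k w bar' <= objective k w bar).

Definition greedy (h : nat) (th : param L) (s : S) (a : A) :=
  forall a', Qfun (th h) (s, a') <= Qfun (th h) (s, a).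

(* [thbar k] is the parameter computed at episode k.  When the optimistic
   program has no solution the algorithm is undefined, and nothing is required
   of the agent in that episode beyond the interaction protocol.  The argmax may
   be broken by any, possibly randomized, rule. *)
Definition cinderella_run (K : nat) (thbar : nat -> Omega -> param L) :=
  (forall k h n i, (k < K)%N -> (h < H)%N ->
     adapted (filt X k 0)
       (fun w => thbar k w h n i 0 : (R : measurableType _))) /\
  (forall k w, (k < K)%N -> (exists bar, is_solution k w bar) ->
     [/\ is_solution k w (thbar k w),
         forall h s, (h < H)%N ->
           pol X k w h s [set a | ~ greedy h (thbar k w) s a] = 0%E &
         forall h, (h < H)%N ->
           greedy h (thbar k w) (st X k h w) (ac X k h w)]).

Definition noise (h tau : nat) (V : S -> R) (w : Omega) : R :=
  rw X tau h w - rmean M h (za X tau h w)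
    + V (st X tau h.+1 w) - \int[trans M h (za X tau h w)]_s' V s'.

Definition confidence_event (K : nat) : set Omega :=
  [set w | forall k h (n : 'I_(nreg L h)) V, (k < K)%N -> (h < H)%N ->
    Vclass L H h.+1 V ->
    wnorm (invmx (gram k n w))
      (\sum_(tau < k | rho L h (za X tau h w) == n)
         noise h tau V w *: phi L h (za X tau h w))
      <= Num.sqrt (beta k n)].

Definition beta_growth (K : nat) (delta C : R) (m : nat) :=
  forall k h (n : 'I_(nreg L h)), (k < K)%N -> (h < H)%N ->
    0 <= beta k n /\
    Num.sqrt (beta k n) <= C * logfac L H K delta ^+ m *
      Num.sqrt ((fdim L h)%:R
        + ln (covering_number (Num.sqrt k.+1%:R)^-1 (Vclass L H h.+1))
        + ln ((nreg L h * H * K)%:R / delta)).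

End Cinderella.

(* Main.v *)
Require Import Defs.
From HB Require Import structures.
From mathcomp Require Import all_boot all_order all_algebra.
From mathcomp Require Import all_classical all_reals all_analysis.
From mathcomp Require Import measurable_realfun.
From mathcomp Require Import perm ring lra.
Import Order.TTheory GRing.Theory Num.Theory.
Import numFieldNormedType.Exports.

(** Proof idea.  On the confidence event, ridge regression shows that any feasible
parameter satisfies the Bellman equation up to the bonus
I + 2 sqrt(alpha) |phi|_{Lambda^-1}, and that parameters with Bellman error at
most I are feasible; by compactness such parameters exist and the optimistic
program has a solution, whose value dominates V* up to H I.  Along the greedy
policy, the gap between the optimistic and the actual value is at most the
expected sum of the bonuses.  That expectation is compared with the observed
bonuses by an exponential supermartingale: the gaps are truncated at order
sqrt(d_h), so the martingale contributes sqrt(K sum_h d_h).  The gaps are built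
from the bonuses, which are explicitly measurable functions of the past, so that
the measurability of the maximizers is never needed.  Finally the bonuses are
summed by Cauchy-Schwarz and the elliptical potential lemma, and the covering
number of V_{h+1} is bounded by a grid, ln N <= N_{h+1} d_{h+1} up to
logarithms, which is absorbed by sqrt(x_h x_{h+1}) <= x_h + x_{h+1} for
x_h = N_h d_h. *)

Set Implicit Arguments.
Unset Strict Implicit.
Unset Printing Implicit Defensive.

Local Open Scope classical_set_scope.
Local Open Scope ring_scope.


(** * Quadratic forms and ridge regression *)

Section QuadraticForms.
Context {R : realType}.

(** The optimistic values are not clipped to [0, 1]: they are only known to be at most L_phi R_h in
    absolute value, hence of order sqrt(d_h). This dictates the truncation level of the gaps. The
    squared increments then add up to K sum_h d_h, so the martingale costs no more than the bonuses,
    whereas increments of an untruncated recursion could be as large as the sum of all later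
    bonuses. Conditional laws are given as identities between probabilities of events. They are
    extended to integrands that depend jointly on the past and on the fresh variable. Exponential
    moments are then stated against nonnegative weights measurable in the past: a choice of weight
    plays the role of conditioning, and it is what lets the steps be chained. The inherent Bellman
    error is an infimum, while the radii [sqrt_alpha] tolerate a bias of exactly I. Attainment of
    the infimum is therefore needed for feasibility itself, not only for the existence of a
    maximizer. The failure probability is split evenly between the confidence event and the
    martingale. *)

Lemma le_of_sqr_le_mul (a b : R) : 0 <= b -> a ^+ 2 <= b * a -> a <= b.
Proof.
move=> b0 h; rewrite leNgt; apply/negP => ba.
suff : b * a < a ^+ 2 by rewrite ltNge h.
by rewrite expr2 ltr_pM2r // (le_lt_trans b0 ba).
Qed.

(** Cauchy-Schwarz against the constant 1, by [2 * a i * a j <= a i ^+ 2 + a j ^+ 2] termwise. The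
    cardinality stays a sum of ones so as to match visit counts. *)
Lemma sqr_sum_le (J : finType) (Q : pred J) (a : J -> R) :
  (\sum_(i | Q i) a i) ^+ 2 <= (\sum_(i | Q i) 1) * \sum_(i | Q i) a i ^+ 2.
Proof.
have -> : (\sum_(i | Q i) 1) * \sum_(i | Q i) a i ^+ 2
    = 2^-1 * \sum_(i | Q i) \sum_(j | Q j) (a i ^+ 2 + a j ^+ 2).
  under [X in _ = _ * X]eq_bigr do rewrite big_split /=.
  rewrite big_split /= [X in _ * (X + _)]exchange_big /= big_distrlr /=.
  under [LHS]eq_bigr do under eq_bigr do rewrite mul1r.
  by field.
rewrite expr2 big_distrlr /= mulr_sumr.
apply: ler_sum => i _; rewrite mulr_sumr; apply: ler_sum => j _.
by have := sqr_ge0 (a i - a j); nra.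
Qed.

Variable d : nat.
Implicit Types (A : 'M[R]_d) (x y : 'cV[R]_d).

Definition bform A x y : R := (x^T *m A *m y) 0 0.

Definition posdef A := A^T = A /\ forall x, x != 0 -> 0 < bform A x x.

Lemma bformDl A x1 x2 y : bform A (x1 + x2) y = bform A x1 y + bform A x2 y.
Proof. by rewrite /bform linearD /= !mulmxDl mxE. Qed.

Lemma bformDr A x y1 y2 : bform A x (y1 + y2) = bform A x y1 + bform A x y2.
Proof. by rewrite /bform mulmxDr mxE. Qed.

Lemma bformZl A (c : R) x y : bform A (c *: x) y = c * bform A x y.
Proof. by rewrite /bform linearZ /= -!scalemxAl mxE. Qed.

Lemma bformZr A (c : R) x y : bform A x (c *: y) = c * bform A x y.
Proof. by rewrite /bform -!scalemxAr mxE. Qed.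

Lemma bformC A x y : A^T = A -> bform A x y = bform A y x.
Proof.
move=> At; rewrite /bform -[in RHS]At.
transitivity ((x^T *m A *m y)^T 0 0); first by rewrite [RHS]mxE.
by rewrite trmx_mul trmx_mul trmxK mulmxA.
Qed.

Lemma dotpE x y : dotp x y = bform 1%:M x y.
Proof. by rewrite /dotp /bform mulmx1. Qed.

Lemma dotp_sum x y : dotp x y = \sum_i x i 0 * y i 0.
Proof. by rewrite /dotp mxE; apply: eq_bigr => i _; rewrite mxE. Qed.

Lemma dotpC x y : dotp x y = dotp y x.
Proof. by rewrite !dotpE bformC ?trmx1. Qed.

Lemma posdef1 : posdef (1%:M : 'M[R]_d).
Proof.
split=> [|x x0]; first by rewrite trmx1.
rewrite -dotpE dotp_sum lt_neqAle eq_sym sumr_ge0 => [|i _]; last first.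
  by rewrite -expr2 sqr_ge0.
rewrite andbT; apply: contra x0.
rewrite psumr_eq0 => [/allP h|i _]; last by rewrite -expr2 sqr_ge0.
apply/eqP/colP => i; rewrite mxE; apply/eqP.
by have := h i; rewrite mem_index_enum mulf_eq0 orbb => /(_ isT).
Qed.

Lemma enormE x : enorm x = wnorm 1%:M x.
Proof.
rewrite /enorm /wnorm -/(bform 1%:M x x) -dotpE dotp_sum.
by congr Num.sqrt; apply: eq_bigr => i _; rewrite expr2.
Qed.

Section PosDef.
Variables (A : 'M[R]_d) (pA : posdef A).

Lemma bform_ge0 x : 0 <= bform A x x.
Proof.
have [->|x0] := eqVneq x 0; last exact: ltW (pA.2 x x0).
by rewrite /bform mulmx0 mxE.
Qed.

Lemma posdef_unit : A \in unitmx.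
Proof.
rewrite -row_free_unit -kermx_eq0; apply/rowV0P => v /sub_kermxP vA.
apply/eqP/negPn/negP => v0.
have := pA.2 v^T; rewrite /bform trmxK vA mul0mx mxE ltxx; apply: contraPP.
by move=> _; apply/not_implyP; split => //; rewrite trmx_eq0.
Qed.

Lemma posdef_inv : posdef (invmx A).
Proof.
have uA := posdef_unit.
have sA : (invmx A)^T = invmx A by rewrite trmx_inv pA.1.
split=> // x x0.
have -> : bform (invmx A) x x = bform A (invmx A *m x) (invmx A *m x).
  by rewrite /bform trmx_mul sA mulmxA mulmxKV // .
apply: pA.2; apply: contra x0 => /eqP h.
by rewrite -[x](mulKVmx uA) h mulmx0.
Qed.

Lemma wnorm_ge0 x : 0 <= wnorm A x.
Proof. exact: sqrtr_ge0. Qed.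

Lemma sqr_wnorm x : wnorm A x ^+ 2 = bform A x x.
Proof. by rewrite sqr_sqrtr // bform_ge0. Qed.

Lemma bform_CS x y : `|bform A x y| <= wnorm A x * wnorm A y.
Proof.
rewrite -(@ler_pXn2r _ 2) ?nnegrE ?mulr_ge0 ?wnorm_ge0 // exprMn !sqr_wnorm.
rewrite real_normK ?num_real //.
have [->|y0] := eqVneq y 0; first by rewrite /bform !mulmx0 mxE expr0n /= mulr0.
have p := pA.2 y y0.
(* Up to the factor [bform A y y], the form at this vector is the Cauchy-Schwarz defect. *)
have := bform_ge0 (bform A y y *: x + (- bform A x y) *: y).
rewrite !(bformDl, bformDr, bformZl, bformZr) (bformC y x pA.1) => h.
rewrite -subr_ge0 -(pmulr_rge0 _ p); apply: le_trans h _.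
by rewrite le_eqVlt; apply/orP; left; apply/eqP; ring.
Qed.

Lemma wnormD x y : wnorm A (x + y) <= wnorm A x + wnorm A y.
Proof.
rewrite -(@ler_pXn2r _ 2) ?nnegrE ?addr_ge0 ?wnorm_ge0 //.
rewrite sqr_wnorm sqrrD !sqr_wnorm !(bformDl, bformDr) (bformC y x pA.1).
have := le_trans (ler_norm _) (bform_CS x y); lra.
Qed.

Lemma wnormN x : wnorm A (- x) = wnorm A x.
Proof.
by rewrite /wnorm -!/(bform A _ _) -scaleN1r bformZl bformZr mulN1r mulN1r opprK.
Qed.

Lemma wnorm_invmx x : wnorm A (invmx A *m x) = wnorm (invmx A) x.
Proof.
have [sA _] := posdef_inv.
rewrite /wnorm trmx_mul sA; congr (Num.sqrt (_ 0 0)).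
by rewrite mulmxA mulmxKV // posdef_unit.
Qed.

(** Cauchy-Schwarz applied to [invmx A *m x] and [y]. This duality turns an ellipsoid of parameters
    into a pointwise bound on action values, namely the bonus. *)
Lemma dotp_dual x y : `|dotp x y| <= wnorm (invmx A) x * wnorm A y.
Proof.
rewrite -wnorm_invmx; apply: le_trans (bform_CS _ _).
have [sA _] := posdef_inv.
by rewrite /bform trmx_mul sA mulmxKV // posdef_unit.
Qed.

End PosDef.

Lemma enorm_ge0 x : 0 <= enorm x.
Proof. exact: sqrtr_ge0. Qed.

Lemma coord_le_enorm x i : `|x i 0| <= enorm x.
Proof.
rewrite -(@ler_pXn2r _ 2) ?nnegrE ?sqrtr_ge0 //.
rewrite sqr_sqrtr ?sumr_ge0 // => [|? _]; last exact: sqr_ge0.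
rewrite real_normK ?num_real // (bigD1 i) //= lerDl sumr_ge0 // => ? _.
exact: sqr_ge0.
Qed.

Lemma dotp_CS x y : `|dotp x y| <= enorm x * enorm y.
Proof. by rewrite dotpE !enormE; exact: bform_CS posdef1 _ _. Qed.

End QuadraticForms.

(** * Ridge regression on a selected subsequence, with unit regularization *)

Section Regression.
Context {R : realType} (d : nat).
Variables (Q : pred nat) (f : nat -> 'cV[R]_d).

Definition design (k : nat) : 'M[R]_d :=
  1%:M + \sum_(t < k | Q t) f t *m (f t)^T.

Lemma bform_design k x y :
  bform (design k) x y
  = dotp x y + \sum_(t < k | Q t) dotp (f t) x * dotp (f t) y.
Proof.
rewrite /bform /design mulmxDr mulmxDl mxE mulmx1; congr (_ + _).
rewrite mulmx_sumr mulmx_suml summxE; apply: eq_bigr => t _.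
rewrite mulmxA -mulmxA mxE big_ord1; congr (_ * _).
by rewrite -/(dotp x (f t)) dotpC.
Qed.

Lemma posdef_design k : posdef (design k).
Proof.
split=> [|x x0].
  rewrite /design linearD /= trmx1; congr (_ + _).
  by rewrite linear_sum; apply: eq_bigr => t _ /=; rewrite trmx_mul trmxK.
rewrite bform_design ltr_pwDl //; first by rewrite dotpE; exact: (posdef1 d).2.
by apply: sumr_ge0 => t _; rewrite -expr2 sqr_ge0.
Qed.

(** The design matrix dominates the identity, so its inverse is dominated by it. The argument is by
    duality: with [y] the solution of the normal equation, the squared norm of [y] is [dotp x y],
    and one factor is cancelled. *)
Lemma wnorm_inv_design_le k x : wnorm (invmx (design k)) x <= enorm x.
Proof.
have pG := posdef_design k; set y := invmx (design k) *m x.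

rewrite -(wnorm_invmx pG) -/y; apply: le_of_sqr_le_mul.
  by rewrite enormE wnorm_ge0.
have le1 : enorm y <= wnorm (design k) y.
  rewrite ler_sqrt ?bform_ge0 // -/(bform _ y y) bform_design -[leLHS]addr0 lerD//.
    by rewrite dotp_sum; apply: ler_sum => i _; rewrite expr2.
  by apply: sumr_ge0 => t _; rewrite -expr2 sqr_ge0.
have -> : wnorm (design k) y ^+ 2 = dotp x y.
  rewrite (sqr_wnorm pG) /bform -mulmxA {2}/y mulKVmx ?posdef_unit //.
  by rewrite -/(dotp y x) dotpC.
apply: le_trans (ler_norm _) _; apply: le_trans (dotp_CS _ _) _.
by rewrite ler_wpM2l // enormE wnorm_ge0.
Qed.

(** Source of the term sqrt(p) I in the exploration constant. The squared norm of the solution [y]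
    is the sum of the [e t * dotp (f t) y]; Cauchy-Schwarz yields the square root of the count, and
    the sum of the squared [dotp (f t) y] is part of the design form at [y]. *)
Lemma wnorm_bias_le k (e : nat -> R) (b : R) : 0 <= b ->
  (forall t, Q t -> `|e t| <= b) ->
  wnorm (invmx (design k)) (\sum_(t < k | Q t) e t *: f t)
  <= Num.sqrt (\sum_(t < k | Q t) 1)%:R * b.
Proof.
move=> b0 eb; have pG := posdef_design k.
set v := \sum_(_ | _) _; set y := invmx (design k) *m v.
rewrite -(wnorm_invmx pG) -/y; apply: le_of_sqr_le_mul.
  by rewrite mulr_ge0 ?sqrtr_ge0.
have -> : wnorm (design k) y ^+ 2 = \sum_(t < k | Q t) e t * dotp (f t) y.
  rewrite (sqr_wnorm pG) /bform -mulmxA {2}/y mulKVmx ?posdef_unit //.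
  rewrite /v mulmx_sumr summxE.
  apply: eq_bigr => t _; rewrite -scalemxAr mxE; congr (_ * _).
  by rewrite -/(dotp _ _) dotpC.
apply: (@le_trans _ _ (b * \sum_(t < k | Q t) `|dotp (f t) y|)).
  rewrite mulr_sumr; apply: ler_sum => t Qt.
  by rewrite (le_trans (ler_norm _)) // normrM ler_wpM2r // eb.
rewrite [_ * b]mulrC -mulrA ler_wpM2l //.
rewrite -(@ler_pXn2r _ 2) ?nnegrE ?mulr_ge0 ?sqrtr_ge0 ?sumr_ge0 //.
rewrite exprMn sqr_sqrtr ?ler0n // (sqr_wnorm pG) bform_design.
apply: le_trans (sqr_sum_le _ _) _.
rewrite natr_sum ler_wpM2l ?sumr_ge0 //.
under eq_bigr do rewrite real_normK ?num_real // expr2.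
by rewrite lerDr dotpE (bform_ge0 (posdef1 d)).
Qed.

(** Multiplying by the design matrix splits the error into regularization, bias and noise, which
    become the three summands of [sqrt_alpha]. *)
Lemma ridge_error k (th : 'cV[R]_d) (y e n : nat -> R) (b c : R) : 0 <= b ->
  (forall t, (t < k)%N -> Q t -> y t = dotp (f t) th + e t + n t) ->
  (forall t, Q t -> `|e t| <= b) ->
  wnorm (invmx (design k)) (\sum_(t < k | Q t) n t *: f t) <= c ->
  wnorm (design k) (th - invmx (design k) *m \sum_(t < k | Q t) y t *: f t)
  <= c + Num.sqrt (\sum_(t < k | Q t) 1)%:R * b + enorm th.
Proof.
move=> b0 yE eb nc; have pG := posdef_design k; have uG := posdef_unit pG.
have pV := posdef_inv pG.
set ve := \sum_(t < k | Q t) e t *: f t; set vn := \sum_(t < k | Q t) n t *: f t.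
have -> : th - invmx (design k) *m \sum_(t < k | Q t) y t *: f t
    = invmx (design k) *m (th - ve - vn).
  rewrite -{1}[th](mulKmx uG) -mulmxBr; congr (_ *m _).
  rewrite /design mulmxDl mul1mx -!addrA; congr (_ + _).
  rewrite mulmx_suml -!sumrN -!big_split /=; apply: eq_bigr => t Qt.
  rewrite (yE t) // !scalerDl -mulmxA.
  have -> : f t *m ((f t)^T *m th) = dotp (f t) th *: f t.
    by rewrite [_^T *m _]mx11_scalar mul_mx_scalar.
  by rewrite !opprD !addrA subrr add0r.
rewrite (wnorm_invmx pG); apply: le_trans (wnormD pV _ _) _; rewrite wnormN.
have := wnormD pV th (- ve); rewrite wnormN.
have := wnorm_bias_le k b0 eb; have := wnorm_inv_design_le k th.
rewrite -/ve; lra.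
Qed.

End Regression.


(** * The elliptical potential *)

Section EllipticalPotential.
Context {R : realType}.

(** Matrix determinant lemma: the two Schur complement factorizations of one bordered matrix have
    equal determinants. *)
Lemma det_rank1_update d (A : 'M[R]_d) (u : 'cV[R]_d) : A \in unitmx ->
  \det (A + u *m u^T) = \det A * (1 + bform (invmx A) u u).
Proof.
move=> uA.
pose B : 'M[R]_(1 + d) := block_mx 1%:M (- u^T) u A.
have e1 : B = block_mx 1%:M 0 u 1%:M *m block_mx 1%:M (- u^T) 0 (A + u *m u^T).
  rewrite mulmx_block !mul1mx ?mulmx1 ?mul0mx ?mulmx0 ?addr0 mulmxN.
  by rewrite addrC addrK.
have e2 : B = block_mx 1%:M (- (u^T *m invmx A)) 0 1%:M
              *m block_mx (1%:M + u^T *m invmx A *m u) 0 u A.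
  rewrite mulmx_block !mul1mx ?mul0mx ?mulmx0 ?add0r !mulNmx mulmxKV //.
  by rewrite addrK.
have := congr1 determinant e1.
rewrite e2 !det_mulmx !det_lblock !det_ublock !det1 !mul1r => <-.
by rewrite mulrC det_mx11 /bform !mxE eqxx.
Qed.

(* Hadamard's inequality would save a factor [d ^+ d], but its logarithm only
   costs a term [d * ln d] in the potential. *)
Lemma norm_det_le d (A : 'M[R]_d) (b : R) :
  (forall i j, `|A i j| <= b) -> `|\det A| <= (d%:R * b) ^+ d.
Proof.
move=> Ab; rewrite /determinant; apply: le_trans (ler_norm_sum _ _ _) _.
apply: (@le_trans _ _ (\sum_(s : 'S_d) b ^+ d)).
  apply: ler_sum => s _; rewrite normrM normrX normrN1 expr1n mul1r normr_prod.
  have -> : b ^+ d = \prod_(i < d) b by rewrite prodr_const card_ord.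
  by apply: ler_prod => i _; rewrite normr_ge0 Ab.
rewrite sumr_const card_Sn exprMn -[leLHS]mulr_natl.
case: d A Ab => [|d] A Ab; first by rewrite fact0 !expr0.
rewrite ler_wpM2r ?exprn_ge0 ?(le_trans _ (Ab 0 0)) ?normr_ge0 //.
rewrite -natrX ler_nat -ffactnn.
have h n : (n <= d.+1)%N -> (d.+1 ^_ n <= d.+1 ^ n)%N.
  elim: n => // n IH nd; rewrite ffactnSr expnSr leq_mul ?leq_subr //.
  exact/IH/ltnW.
exact: h.
Qed.

(** This is [ln (1 + y) <= y] at [y = - (x / (1 + x))], where [1 + y] is the inverse of [1 + x]. *)
Lemma ge_ln1Dx (x : R) : 0 <= x -> x / (1 + x) <= ln (1 + x).
Proof.
move=> x0; have p : 0 < 1 + x by lra.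
have h := @le_ln1Dx R (- (x / (1 + x))).
have e : 1 + - (x / (1 + x)) = (1 + x)^-1 by field; lra.
move: h; rewrite e lnV ?posrE // lerN2; apply.
by rewrite ltrN2 ltr_pdivrMr //; lra.
Qed.

Section Design.
Variables (d : nat) (Q : pred nat) (f : nat -> 'cV[R]_d).

Lemma design0 : design Q f 0 = 1%:M.
Proof. by rewrite /design big_ord0 addr0. Qed.

Lemma designS k : design Q f k.+1 =
  design Q f k + (if Q k then f k *m (f k)^T else 0).
Proof. by rewrite /design big_mkcond big_ord_recr /= -big_mkcond addrA. Qed.

(** Each selected step is a rank-one update and multiplies the determinant by one plus the squared
    norm, so the logarithm telescopes from the identity matrix. *)
Lemma ln_det_design k : 0 < \det (design Q f k) /\
  ln (\det (design Q f k))
  = \sum_(t < k | Q t) ln (1 + wnorm (invmx (design Q f t)) (f t) ^+ 2).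
Proof.
elim: k => [|k [p IH]]; first by rewrite design0 det1 big_ord0 ln1.
rewrite big_mkcond big_ord_recr /= -big_mkcond -IH designS.
case: ifP => Qk; last by rewrite !addr0.
have pG := posdef_design Q f k; have pV := posdef_inv pG.
have q : 0 < 1 + wnorm (invmx (design Q f k)) (f k) ^+ 2.
  by rewrite ltr_pwDl // sqr_ge0.
rewrite det_rank1_update ?posdef_unit // -(sqr_wnorm pV).
by rewrite mulr_gt0 // lnM.
Qed.

(** Unit regularization bounds each squared norm [x] by [l ^+ 2], so [x <= (1 + x) * ln (1 + x) <=
    (1 + l ^+ 2) * ln (1 + x)]. The potential is thus summed without truncating its terms at 1, and
    the log-determinant is bounded through the entries of the design. *)
Lemma elliptical_potential k (l : R) :
  (0 < d)%N -> 0 <= l -> (forall t, enorm (f t) <= l) ->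
  \sum_(t < k | Q t) wnorm (invmx (design Q f t)) (f t) ^+ 2
  <= (1 + l ^+ 2) * (d%:R * (ln d%:R + ln (1 + k%:R * l ^+ 2))).
Proof.
move=> d0 l0 fl; have [p E] := ln_det_design k.
have q : 0 < 1 + k%:R * l ^+ 2 by rewrite ltr_pwDl // mulr_ge0 ?sqr_ge0.
apply: (@le_trans _ _ ((1 + l ^+ 2) * ln (\det (design Q f k)))).
  rewrite E mulr_sumr; apply: ler_sum => t _.
  set x := wnorm _ _ ^+ 2.
  have xl : x <= l ^+ 2.
    rewrite ler_pXn2r ?nnegrE ?wnorm_ge0 //.
    exact: le_trans (wnorm_inv_design_le _ _ _ _) (fl t).
  have x0 : 0 <= x by rewrite sqr_ge0.
  have p1 : 0 < 1 + x by lra.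
  have := ge_ln1Dx x0; rewrite ler_pdivrMr // => h.
  apply: le_trans h _; rewrite mulrC ler_wpM2r ?ln_ge0 ?lerD2l //; lra.
rewrite ler_wpM2l ?addr_ge0 ?sqr_ge0 //.
have e i j : `|design Q f k i j| <= 1 + k%:R * l ^+ 2.
  rewrite /design !mxE; apply: le_trans (ler_normD _ _) _.
  apply: lerD; first by case: (i == j); rewrite ?normr1 ?normr0.
  rewrite summxE; apply: le_trans (ler_norm_sum _ _ _) _.
  apply: (@le_trans _ _ (\sum_(t < k) l ^+ 2)); last first.
    by rewrite sumr_const card_ord -[leLHS]mulr_natl.
  rewrite big_mkcond /=; apply: ler_sum => t _; case: ifP => _; last exact: sqr_ge0.
  have ent m : `|f t m 0| <= l := le_trans (coord_le_enorm _ _) (fl t).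
  by rewrite mxE big_ord1 normrM !mxE expr2 ler_pM ?ent.
have := norm_det_le e; rewrite gtr0_norm // => D.
have dp : 0 < d%:R :> R by rewrite ltr0n.
apply: le_trans (_ : _ <= ln ((d%:R * (1 + k%:R * l ^+ 2)) ^+ d)) _.
  by rewrite ler_ln // posrE exprn_gt0 ?mulr_gt0.
by rewrite lnXn ?mulr_gt0 // lnM ?posrE // -[leLHS]mulr_natl.
Qed.

End Design.
End EllipticalPotential.


(** * Suprema over actions and covering numbers *)

Section Suprema.
Context {R : realType} {dS dA : measure_display}.
Context {S : measurableType dS} {A : measurableType dA}.
Implicit Types (f g : S * A -> R) (s : S).

Lemma supA_le_bound f s (b : R) : (forall a, f (s, a) <= b) -> supA f s <= b.
Proof.
move=> fb; apply: ge_sup; first by exists (f (s, point)); exists point.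
by move=> _ [a _ <-]; exact: fb.
Qed.

Lemma supA_ge f s (b : R) a : (forall a, f (s, a) <= b) -> f (s, a) <= supA f s.
Proof.
move=> fb; apply: ub_le_sup; last by exists a.
by exists b => _ [a' _ <-]; exact: fb.
Qed.

Lemma supA_leD f g s (b e : R) : (forall a, g (s, a) <= b) ->
  (forall a, f (s, a) <= g (s, a) + e) -> supA f s <= supA g s + e.
Proof.
move=> gb fg; apply: supA_le_bound => a.
by rewrite (le_trans (fg a)) // lerD2r (supA_ge _ gb).
Qed.

Lemma supA_cst s (c : R) : supA (fun _ : S * A => c) s = c.
Proof.
rewrite /supA; suff -> : range (fun a : A => c) = [set c] by rewrite sup1.
by apply/seteqP; split=> [_ [_ _ <-]//|_ ->]; exists point.
Qed.

Lemma enorm_le_coord d (x : 'cV[R]_d) (w : R) : 0 <= w ->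
  (forall i, `|x i 0| <= w) -> enorm x <= d%:R * w.
Proof.
move=> w0 xw; rewrite -(@ler_pXn2r _ 2) ?nnegrE ?sqrtr_ge0 ?mulr_ge0 //.
rewrite sqr_sqrtr ?sumr_ge0 // => [|i _]; last exact: sqr_ge0.
apply: (@le_trans _ _ (d%:R * w ^+ 2)).
  rewrite mulr_natl -[X in _ *+ X]card_ord -sumr_const; apply: ler_sum => i _.
  by rewrite -[leLHS]real_normK ?num_real // ler_pXn2r ?nnegrE.
rewrite exprMn ler_wpM2r ?sqr_ge0 // -natrX ler_nat.
by case: d {x xw} => // d; rewrite expnS expn1 leq_pmulr.
Qed.

Variable L : features R S A.

Lemma Qfun_le h (th : 'I_(nreg L h) -> 'cV[R]_(fdim L h)) z (l r : R) :
  0 <= l -> enorm (phi L h z) <= l -> enorm (th (rho L h z)) <= r ->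
  `|Qfun th z| <= l * r.
Proof.
move=> l0 hl hr; apply: le_trans (dotp_CS _ _) _.
by rewrite ler_pM // enorm_ge0.
Qed.

Lemma QfunB h (th th' : 'I_(nreg L h) -> 'cV[R]_(fdim L h)) z :
  Qfun th z - Qfun th' z = Qfun (fun n => th n - th' n) z.
Proof. by rewrite /Qfun /dotp mulmxBr !mxE. Qed.

Lemma Lphi_le H (l : R) : (Lphi L H <= l%:E)%E ->
  forall h z, (h < H)%N -> enorm (phi L h z) <= l.
Proof.
move=> Ll h z hH; rewrite -lee_fin; apply: le_trans Ll.
by apply: ereal_sup_ubound; exists h, z.
Qed.

End Suprema.

(** * Covering numbers of the value classes *)

Section Covering.
Context {R : realType}.

(** A finite quantization of the parameters whose cells have image of diameter at most [eps] gives a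
    cover with one ball per code. *)
Lemma covering_number_le_card T Th (J : finType) (F : Th -> T -> R)
  (B : set Th) (code : Th -> J) (eps : R) (th0 : Th) : B th0 ->
  (forall th th', B th -> B th' -> code th = code th' ->
     forall x, `|F th x - F th' x| <= eps) ->
  covering_number eps [set F th | th in B] <= #|J|%:R.
Proof.
move=> B0 cl; apply: ge_inf; first by exists 0 => _ [m _ <-].
exists #|J| => //=.
(* Centres must lie in the class, so each code is represented by an admissible parameter of its
   cell; [th0] fills the empty cells. *)
have rep j : exists th, B th /\
    ((exists2 th', B th' & code th' = j) -> code th = j).
  have [[th' B' e]|ne] := pselect (exists2 th', B th' & code th' = j).
    by exists th'.
  by exists th0.
exists (fun i => F (projT1 (cid (rep (enum_val i))))); split=> [i|_ [th Bth <-]].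
  by case: cid => th [Bth _] /=; exists th.
exists (enum_rank (code th)); apply: ge_ereal_sup => _ [x _ <-]; rewrite lee_fin.
case: cid => th' [B' e'] /=; apply: cl => //; rewrite e' ?enum_rankK //.
by exists th.
Qed.

Lemma ln_covering_le T (V : set (T -> R)) (eps b : R) : 1 <= b ->
  covering_number eps V <= b -> ln (covering_number eps V) <= ln b.
Proof.
move=> b1 h; have [c0|c0] := leP (covering_number eps V) 0.
  by rewrite ln0 // ln_ge0.
by rewrite ler_ln // posrE (lt_le_trans c0).
Qed.

Context {dS dA : measure_display}.
Context {S : measurableType dS} {A : measurableType dA}.

(** A grid on the coordinates of all regions: the exponent [nreg L h * fdim L h] is the number of
    coordinates. The supremum over actions is 1-Lipschitz in sup norm, so covering the action values
    suffices. *)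
Lemma ln_covering_Vclass (L : features R S A) (H h : nat) (l r eps : R)
    (th0 : 'I_(nreg L h) -> 'cV[R]_(fdim L h)) :
  (h < H)%N -> (0 < fdim L h)%N -> 0 < l -> 0 <= r -> 0 < eps ->
  (forall z, enorm (phi L h z) <= l) ->
  (forall (n : 'I_(nreg L h)) th, Bset L n th -> enorm th <= r) ->
  (forall n, Bset L n (th0 n)) ->
  ln (covering_number eps (Vclass L H h)) <=
  (nreg L h * fdim L h)%:R * ln (1 + 2 * r * (fdim L h)%:R * l / eps).
Proof.
move=> hH d0 l0 r0 e0 phil Br B0.
have dp : 0 < (fdim L h)%:R :> R by rewrite ltr0n.
(* Mesh of the grid: parameters within [w] in each coordinate are at Euclidean distance at most
   [fdim L h * w], hence have values within [eps]. *)
pose w := eps / ((fdim L h)%:R * l).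
have w0 : 0 < w by rewrite divr_gt0 // mulr_gt0.
pose J := Num.truncn (2 * r / w).
pose code (th : 'I_(nreg L h) -> 'cV[R]_(fdim L h)) :=
  [ffun p : 'I_(nreg L h) * 'I_(fdim L h) =>
     inord (Num.truncn ((th p.1 p.2 0 + r) / w)) : 'I_J.+1].
pose B := [set th : 'I_(nreg L h) -> 'cV[R]_(fdim L h) |
             forall n, Bset L n (th n)].
have -> : Vclass L H h = [set (fun th => supA (Qfun th)) th | th in B].
  rewrite /Vclass /Qclass hH; apply/seteqP; split=> [_ [_ [th Bth <-] <-]|_ [th Bth <-]].
    by exists th.
  by exists (Qfun th) => //; exists th.
have cov : covering_number eps [set (fun th => supA (Qfun th)) th | th in B]
    <= (#|{ffun 'I_(nreg L h) * 'I_(fdim L h) -> 'I_J.+1}|)%:R.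
  apply: (covering_number_le_card (code := code) (th0 := th0)) => //.
  move=> th th' Bth Bth' ec s.
  have coord n i : `|th n i 0 - th' n i 0| <= w.
    have pos t : B t -> 0 <= (t n i 0 + r) / w <= 2 * r / w.
      move=> Bt; have := coord_le_enorm (t n) i; have := Br n _ (Bt n).
      move=> h1 /le_trans /(_ h1); rewrite ler_norml => /andP[h2 h3].
      apply/andP; split; first by rewrite divr_ge0 ?(ltW w0) //; lra.
      by rewrite ler_pM2r ?invr_gt0 //; lra.
    (* The cell index is in range, so [inord] does not fall back on its default. *)
    have lt t : B t -> (Num.truncn ((t n i 0 + r) / w)%R < J.+1)%N.
      by move=> /pos/andP[_ h2]; rewrite ltnS le_truncn.
    have := congr1 (fun c : {ffun _ -> _} => nat_of_ord (c (n, i))) ec.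
    rewrite /= !ffunE /= !inordK ?lt // => et.
    have /andP[p _] := pos _ Bth; have /andP[p' _] := pos _ Bth'.
    have := truncn_itv p; have := truncn_itv p'; rewrite et => /andP[a1 a2] /andP[b1 b2].
    have : `|(th n i 0 + r) / w - (th' n i 0 + r) / w| <= 1.
      by rewrite ler_norml; apply/andP; split; lra.
    rewrite -mulrBl normrM (gtr0_norm (_ : 0 < w^-1)) ?invr_gt0 //.
    by rewrite ler_pdivrMr // mul1r opprD addrACA subrr addr0.
  have Qd z : `|Qfun th z - Qfun th' z| <= eps.
    rewrite QfunB; apply: le_trans (_ : _ <= l * ((fdim L h)%:R * w)) _.
      apply: Qfun_le => //; first exact: ltW.
      by apply: enorm_le_coord => [|i]; rewrite ?(ltW w0) // !mxE coord.
    by rewrite /w le_eqVlt; apply/orP; left; apply/eqP; field; rewrite !gt_eqF.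
  have Qb t : B t -> forall a, Qfun t (s, a) <= l * r.
    move=> Bt a; apply: le_trans (ler_norm _) _.
    by apply: Qfun_le; [exact: ltW|exact: phil|apply: Br].
  rewrite ler_distlC; apply/andP; split.
    rewrite lerBlDr; apply: (supA_leD (b := l * r)); first exact: Qb.
    by move=> a; have := Qd (s, a); rewrite ler_norml => /andP[]; lra.
  apply: (supA_leD (b := l * r)); first exact: Qb.
  by move=> a; have := Qd (s, a); rewrite ler_norml => /andP[]; lra.
apply: le_trans (ln_covering_le _ cov) _.
  by rewrite ler1n card_ffun !card_ord expn_gt0.
rewrite card_ffun card_prod !card_ord natrX lnXn ?ltr0n // -[leLHS]mulr_natl.
rewrite ler_wpM2l // ler_ln ?posrE ?ltr0n //; last first.
  by rewrite ltr_pwDl // !mulr_ge0 ?invr_ge0 ?ler0n // ltW.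
rewrite -natr1 addrC lerD2l.
have : (J%:R : R) <= 2 * r / w.
  by rewrite Num.Theory.truncn_le divr_ge0 ?(ltW w0) // mulr_ge0.
move=> /le_trans; apply; rewrite /w le_eqVlt; apply/orP; left; apply/eqP.
by field; rewrite !gt_eqF.
Qed.

Lemma ln_covering_Vclass_last (L : features R S A) (H h : nat) (eps : R) :
  (H <= h)%N -> 0 <= eps -> ln (covering_number eps (Vclass L H h)) <= 0.
Proof.
move=> Hh e0; rewrite -(ln1 R); apply: ln_covering_le => //.
have -> : Vclass L H h = [set (fun _ : unit => fun=> 0) t | t in setT].
  rewrite /Vclass /Qclass ltnNge Hh /=; apply/seteqP; split=> [_ [_ -> <-]|_ [_ _ <-]].
    by exists tt => //; apply/funext => s; rewrite supA_cst.
  by exists (fun=> 0) => //; apply/funext => s; rewrite supA_cst.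
rewrite -[leRHS](congr1 (GRing.natmul 1) card_unit).
by apply: (covering_number_le_card (code := id) (th0 := tt)) => // *; rewrite subrr normr0.
Qed.

End Covering.


(** * Bounded integrands, kernels and conditional laws *)

Section BoundedMean.
Context {R : realType} {d : measure_display} {T : measurableType d}.
Implicit Types f g : T -> R.

(** Bounded measurable functions are integrable for every probability, which makes the real-valued
    integrals of iterated expectations linear and monotone. *)
Definition bmeasurable f :=
  measurable_fun setT f /\ exists b, forall x, `|f x| <= b.

Lemma bmeasurable_cst (c : R) : bmeasurable (fun=> c).
Proof. by split; [exact: measurable_cst|exists `|c|]. Qed.

Lemma bmeasurableD f g : bmeasurable f -> bmeasurable g ->
  bmeasurable (fun x => f x + g x).
Proof.
move=> [mf [b fb]] [mg [c gc]]; split; first exact: measurable_funD.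
by exists (b + c) => x; rewrite (le_trans (ler_normD _ _)) ?lerD.
Qed.

Lemma bmeasurableB f g : bmeasurable f -> bmeasurable g ->
  bmeasurable (fun x => f x - g x).
Proof.
move=> [mf [b fb]] [mg [c gc]]; split; first exact: measurable_funB.
by exists (b + c) => x; rewrite (le_trans (ler_normB _ _)) ?lerD.
Qed.

Variables (mu : {measure set T -> \bar R}) (mu1 : mu setT = 1%E).

Lemma bmeasurable_integrable f : bmeasurable f ->
  mu.-integrable setT (EFin \o f).
Proof.
move=> [mf [b fb]]; apply: measurable_bounded_integrable => //.
  by rewrite mu1 ltry.
exists b; split; first exact: num_real.
by move=> c bc x _; apply: le_trans (fb x) _; exact: ltW.
Qed.

Lemma EFin_mean f : bmeasurable f ->
  (\int[mu]_x f x)%:E = (\int[mu]_x (f x)%:E)%E.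
Proof.
move=> bf; rewrite /Rintegral fineK //.
exact: integrable_fin_num (bmeasurable_integrable bf).
Qed.

Lemma mean_le f g : bmeasurable f -> bmeasurable g ->
  (forall x, f x <= g x) -> \int[mu]_x f x <= \int[mu]_x g x.
Proof. by move=> bf bg fg; apply: le_Rintegral => //; exact: bmeasurable_integrable. Qed.

Lemma mean_cst (c : R) : \int[mu]_x c = c.
Proof. by rewrite Rintegral_cst // mu1 mulr1. Qed.

Lemma meanD f g : bmeasurable f -> bmeasurable g ->
  \int[mu]_x (f x + g x) = \int[mu]_x f x + \int[mu]_x g x.
Proof. by move=> bf bg; rewrite RintegralD //; exact: bmeasurable_integrable. Qed.

Lemma meanB f g : bmeasurable f -> bmeasurable g ->
  \int[mu]_x (f x - g x) = \int[mu]_x f x - \int[mu]_x g x.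
Proof. by move=> bf bg; rewrite RintegralB //; exact: bmeasurable_integrable. Qed.

Lemma mean_itv f (a b : R) : measurable_fun setT f ->
  (forall x, a <= f x <= b) -> a <= \int[mu]_x f x <= b.
Proof.
move=> mf fab.
have bf : bmeasurable f.
  split=> //; exists (`|a| + `|b|) => x.
  have /andP[ax xb] := fab x; rewrite ler_norml; apply/andP; split.
    have := ler_norm (- a); have := normr_ge0 b; rewrite normrN; lra.
  have := ler_norm b; have := normr_ge0 a; lra.
apply/andP; split.
  rewrite -[leLHS]mean_cst; apply: mean_le => //; first exact: bmeasurable_cst.
  by move=> x; case/andP: (fab x).
rewrite -[leRHS]mean_cst; apply: mean_le => //; first exact: bmeasurable_cst.
by move=> x; case/andP: (fab x).
Qed.

Lemma mean_ae_cst f (c : R) (N : set T) : bmeasurable f -> measurable N ->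
  mu N = 0%E -> (forall x, ~ N x -> f x = c) -> \int[mu]_x f x = c.
Proof.
move=> bf mN N0 fc; apply: EFin_inj; rewrite EFin_mean //.
rewrite -[in RHS](mean_cst c) EFin_mean; last exact: bmeasurable_cst.
apply: ae_eq_integral => //.
- exact/measurable_EFinP/bf.1.
- exists N; split=> // x /= h; apply: contrapT => nN; apply: h => _.
  by rewrite fc.
Qed.

End BoundedMean.

(** * Means under a measurable family of probabilities *)

Section Kernels.
Context {R : realType} {dX dY : measure_display}.
Context {X : measurableType dX} {Y : measurableType dY}.
Variable l : X -> {measure set Y -> \bar R}.
Hypothesis ml : forall U, measurable U -> measurable_fun setT (l ^~ U).
Hypothesis l1 : forall x, l x setT = 1%E.

(** A copy of [l] indexed by its measurability and mass proofs, to which the kernel structures can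
    be attached. *)
Definition family_kernel (_ : forall U, measurable U -> measurable_fun setT (l ^~ U))
  (_ : forall x, l x setT = 1%E) := l.

HB.instance Definition _ := isKernel.Build _ _ X Y R (family_kernel ml l1) ml.
HB.instance Definition _ :=
  Kernel_isProbability.Build _ _ X Y R (family_kernel ml l1) l1.

Lemma measurable_mean (f : X * Y -> R) : bmeasurable f ->
  measurable_fun setT (fun x => \int[l x]_y f (x, y)).
Proof.
move=> [mf [b fb]].
have bf x : bmeasurable (fun y => f (x, y)).
  by split; [exact: measurableT_comp mf (pair1_measurable x)|exists b].
(* Adding [b] makes the integrand nonnegative, as the measurability of kernel integrals requires. *)
have -> : (fun x => \int[l x]_y f (x, y))
    = (fun x => fine (\int[l x]_y (b + f (x, y))%:E)%E - b).
  apply/funext => x; rewrite -EFin_mean ?l1 //=; last first.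
    by apply: bmeasurableD => //; exact: bmeasurable_cst.
  by rewrite meanD ?mean_cst ?l1 //; [ring|exact: bmeasurable_cst].
apply: measurable_funB => //; apply: measurableT_comp; first exact: fine_measurable.
apply: (measurable_fun_integral_finite_kernel
  (fun z => (b + f z)%:E) (family_kernel ml l1 : R.-fker X ~> Y)).
  by move=> z; rewrite lee_fin; have := fb z; rewrite ler_norml => /andP[]; lra.
by apply/measurable_EFinP; exact: measurable_funD.
Qed.

End Kernels.

(** * Conditional laws as disintegrations of joint laws *)

Section ConditionalLaw.
Context {R : realType} {dO dT : measure_display}.
Context {Omega : measurableType dO} {T : measurableType dT}.
Variables (P : probability Omega R) (F : set (set Omega)).
Hypotheses (sF : sigma_algebra setT F) (Fm : F `<=` measurable).
Local Notation FT := (g_sigma_algebraType F).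

Lemma g_sigma_algebra_id (E : set Omega) : <<s F >> E = F E.
Proof. by rewrite sigma_algebra_id. Qed.

Lemma measurable_to_sub : measurable_fun setT (id : Omega -> FT).
Proof. by move=> _ B; rewrite /measurable /= g_sigma_algebra_id setTI => /Fm. Qed.

(** [g_sigma_algebraType F] is [Omega] carrying only the events of [F]. Adaptedness becomes ordinary
    measurability on that space, where products and compositions apply. *)
Lemma measurable_sub_fun d' (U : measurableType d') (g : Omega -> U) :
  (forall B, measurable B -> F (g @^-1` B)) <->
  measurable_fun setT (g : FT -> U).
Proof.
split=> [h _ B mB|h B mB].
  by rewrite setTI /measurable /= g_sigma_algebra_id; exact: h.
by have := h measurableT B mB; rewrite setTI /measurable /= g_sigma_algebra_id.
Qed.

Variables (Y : Omega -> T) (mY : measurable_fun setT Y).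
Variable kap : Omega -> {measure set T -> \bar R}.
Hypothesis mk : forall B, measurable B ->
  measurable_fun setT ((kap ^~ B) : FT -> \bar R).
Hypothesis kap1 : forall w, kap w setT = 1%E.
Hypothesis ck : cond_law P F Y (fun w => kap w).

Let PF : {measure set FT -> \bar R} :=
  measure_function_pushforward__canonical__measure_function_Measure
    P measurable_to_sub.

(** A kernel from the one-point space, so that the joint law can be written as a composition of
    kernels. *)
Let base (_ : unit) : {measure set FT -> \bar R} := PF.

Let base1 u : base u setT = 1%E.
Proof. by rewrite /base /PF /= /pushforward preimage_setT probability_setT. Qed.

Let mbase U : measurable U -> measurable_fun setT (base ^~ U).
Proof. by move=> mU; exact: measurable_cst. Qed.

(** The law of [(w, y)] with [w] frozen and [y] drawn from [kap w]. *)
Let graph (u : unit * FT) : {measure set (FT * T)%type -> \bar R} :=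
  measure_function_pushforward__canonical__measure_function_Measure
    (kap u.2) (@pair1_measurable _ _ FT T u.2).

Let graph1 u : graph u setT = 1%E.
Proof. by rewrite /graph /= /pushforward preimage_setT kap1. Qed.

Let mgraph U : measurable U -> measurable_fun setT (graph ^~ U).
Proof.
move=> mU.
have := @measurable_fun_xsection_finite_kernel _ _ _ _ _
  (family_kernel (X := FT) mk kap1 : R.-fker FT ~> T) U (mem_set mU).
move=> /(measurableT_comp)/(_ (@measurable_snd _ _ unit FT)).
congr (measurable_fun _ _); apply/funext => -[u w] /=.
by rewrite /graph /= /pushforward xsectionE.
Qed.

(** Freezing lemma: under the conditional law, integrating a function of the past and of [Y] amounts
    to drawing [Y] afresh with the past frozen. It holds because the law of [(w, Y w)] and its
    disintegration agree as measures. *)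
Lemma cond_law_integral (f : FT * T -> \bar R) :
  (forall z, (0 <= f z)%E) -> measurable_fun setT f ->
  (\int[P]_w f (w, Y w) = \int[P]_w \int[kap w]_y f (w, y))%E.
Proof.
move=> f0 mf.
have mgY : measurable_fun setT (fun w => (w, Y w) : FT * T).
  by apply/measurable_fun_pairP; split => //=; exact: measurable_to_sub.
pose m1 : {measure set (FT * T)%type -> \bar R} :=
  measure_function_pushforward__canonical__measure_function_Measure P mgY.
pose kb : R.-sfker unit ~> FT := family_kernel mbase base1.
pose kg : R.-sfker (unit * FT)%type ~> (FT * T)%type := family_kernel mgraph graph1.
pose m2 : {measure set (FT * T)%type -> \bar R} := mkcomp kb kg tt.
(* Rectangles based on events of [F] are stable under intersection and generate the product; on them
   the identity is exactly [cond_law]. *)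
have m12 A : measurable A -> m1 A = m2 A.
  move=> mA; apply: (measure_unique
    [set U `*` V | U in @measurable _ FT & V in @measurable _ T] (fun=> setT)) => //.
  - exact: measurable_prod_measurableType.
  - move=> _ _ [U1 mU1 [V1 mV1 <-]] [U2 mU2 [V2 mV2 <-]].
    exists (U1 `&` U2); first exact: measurableI.
    by exists (V1 `&` V2); [exact: measurableI|rewrite setXI].
  - by move=> _; exists setT => //; exists setT => //; rewrite setXTT.
  - by rewrite bigcup_const.
  - move=> _ [U mU [V mV <-]].
    have FU : F U by rewrite -g_sigma_algebra_id.
    rewrite /m1 /= /pushforward /m2 /= /kcomp.
    transitivity (P (U `&` Y @^-1` V)); first by congr (P _).
    rewrite ck // [RHS](ge0_integral_pushforward measurable_to_sub) //=; last 2 first.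
      + have := measurableT_comp (mgraph (measurableX mU mV))
                  (@pair1_measurable _ _ unit FT tt).
        by [].
      + by move=> w _; rewrite /pushforward; exact: measure_ge0.
    rewrite integral_mkcond preimage_setT; apply: eq_integral => w _ /=.
    rewrite /patch /kg /= /family_kernel /graph /= /pushforward.
    case: ifPn => [wU|wU].
      congr (kap w _); apply/seteqP; split=> [y Vy|y [_ //]].
      by split => //; exact: set_mem.
    rewrite -[LHS](measure0 (kap w)); congr (kap w _).
    by apply/seteqP; split=> // y [/= Uw _]; move: wU; rewrite notin_setE.
  - by move=> _; rewrite /m1 /= /pushforward preimage_setT probability_setT ltry.
have -> : (\int[P]_w f (w, Y w) = \int[m1]_z f z)%E.
  by rewrite (ge0_integral_pushforward mgY).
rewrite (eq_measure_integral m2) => [|A mA _]; last exact: m12.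
rewrite /m2 /mkcomp integral_kcomp //.
rewrite [LHS](ge0_integral_pushforward measurable_to_sub) //=; last 2 first.
- have := measurable_fun_integral_kernel (l := kg) (measurable_kernel kg) f0 mf.
  by move=> h; have := measurableT_comp h (@pair1_measurable _ _ unit FT tt).
- by move=> w _; exact: integral_ge0.
rewrite preimage_setT; apply: eq_integral => w _.
by rewrite [LHS](ge0_integral_pushforward (@pair1_measurable _ _ FT T w)).
Qed.

End ConditionalLaw.


(** * Exponential moments *)

Section ExponentialMoments.
Context {R : realType}.

(** The linear term vanishes in the mean of a centred variable. The factor 2 makes the proof
    elementary: for [x >= 1/2] one has [x <= 2 * x ^+ 2], and below 1/2 one has [expR x <= (1 -
    x)^-1 <= 1 + x + 2 * x ^+ 2]. *)
Lemma expR_le_addr_expR_sqr (x : R) : expR x <= x + expR (2 * x ^+ 2).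
Proof.
have := @expR_ge1Dx R (2 * x ^+ 2) => h.
have [x12|x12] := leP (1/2) x.
  have : expR x <= expR (2 * x ^+ 2) by rewrite ler_expR; nra.
  lra.
suff : expR x <= 1 + x + 2 * x ^+ 2 by lra.
have p : 0 < 1 - x by lra.
have : expR x <= (1 - x)^-1.
  rewrite -[expR x]invrK -expRN lef_pV2 ?posrE ?expR_gt0 //.
  by have := @expR_ge1Dx R (- x); lra.
move=> /le_trans; apply; rewrite -div1r ler_pdivrMr //; nra.
Qed.

(** A Hoeffding bound with a non-optimal constant, valid for every [lam] because the pointwise
    inequality holds on the whole line. *)
Lemma mean_expR_centered d (T : measurableType d) (mu : {measure set T -> \bar R})
    (g : T -> R) (lam b : R) : mu setT = 1%E -> measurable_fun setT g ->
  (forall y, 0 <= g y <= b) ->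
  \int[mu]_y expR (lam * (\int[mu]_y g y - g y)) <= expR (2 * lam ^+ 2 * b ^+ 2).
Proof.
move=> mu1 mg gb; have := mean_itv mu1 mg gb; set m := \int[mu]_y g y => mb.
have bg : bmeasurable g.
  by split=> //; exists b => y; have /andP[? ?] := gb y; rewrite ger0_norm.
have dev y : `|m - g y| <= b.
  by have := gb y; rewrite ler_norml; lra.
have bd : bmeasurable (fun y => m - g y).
  by apply: bmeasurableB => //; exact: bmeasurable_cst.
have bld : bmeasurable (fun y => lam * (m - g y)).
  split; first by apply: measurable_funM => //; exact: bd.1.
  by exists (`|lam| * b) => y; rewrite normrM ler_wpM2l.
have cb := bmeasurable_cst (T := T) (expR (2 * lam ^+ 2 * b ^+ 2)).
have be : bmeasurable (fun y => expR (lam * (m - g y))).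
  split; first exact: measurableT_comp bld.1.
  exists (expR (`|lam| * b)) => y; rewrite ger0_norm ?expR_ge0 // ler_expR.
  by apply: le_trans (ler_norm _) _; rewrite normrM ler_wpM2l.
apply: (@le_trans _ _ (\int[mu]_y (lam * (m - g y) + expR (2 * lam ^+ 2 * b ^+ 2)))).
  apply: mean_le => //; first exact: bmeasurableD.
  move=> y; apply: le_trans (expR_le_addr_expR_sqr _) _.
  rewrite lerD2l ler_expR -mulrA ler_pM2l // exprMn ler_wpM2l ?sqr_ge0 //.
  have b0 : 0 <= b by apply: le_trans (dev y).
  by rewrite -[leLHS]real_normK ?num_real // ler_pXn2r ?nnegrE.
rewrite meanD // mean_cst // RintegralZl ?meanB ?mean_cst //; last 2 first.
- exact: bmeasurable_cst.
- exact: bmeasurable_integrable.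
by rewrite subrr mulr0 add0r.
Qed.

Context {dO : measure_display} {Omega : measurableType dO}.
Variables (P : probability Omega R) (lam : R).

(* [zeta] is revealed between [F] and [F'], and its conditional exponential
   moment at [lam] given [F] is at most [expR c]. *)
Record mgf_step (F : set (set Omega)) (zeta : Omega -> R) (c : R)
    (F' : set (set Omega)) : Prop := MgfStep {
  mgf_sub : F `<=` F';
  mgf_measurable : measurable_fun setT (zeta : g_sigma_algebraType F' -> R);
  mgf_bound : forall U : Omega -> R,
    measurable_fun setT (U : g_sigma_algebraType F -> R) -> (forall w, 0 <= U w) ->
    (\int[P]_w (U w * expR (lam * zeta w))%:E
     <= (expR c)%:E * \int[P]_w (U w)%:E)%E }.

Lemma measurable_sub_trans d (T : measurableType d) (F F' : set (set Omega))
    (g : Omega -> T) : sigma_algebra setT F -> sigma_algebra setT F' ->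
  F `<=` F' -> measurable_fun setT (g : g_sigma_algebraType F -> T) ->
  measurable_fun setT (g : g_sigma_algebraType F' -> T).
Proof.
move=> sF sF' FF' mg; apply/(measurable_sub_fun sF') => B mB; apply: FF'.
exact: (iffRL (measurable_sub_fun sF g)) mB.
Qed.

Lemma mgf_step0 F : sigma_algebra setT F -> mgf_step F (fun=> 0) 0 F.
Proof.
move=> sF; split=> // U mU U0.
rewrite expR0 mul1e le_eqVlt; apply/orP; left; apply/eqP/eq_integral => w _.
by rewrite mulr0 expR0 mulr1.
Qed.

(** The second bound is used with weight [U w * expR (lam * z w)], which is known at [F']; the first
    one then applies with weight [U]. *)
Lemma mgf_step_trans F F' F'' z z' c c' :
  sigma_algebra setT F -> sigma_algebra setT F' -> sigma_algebra setT F'' ->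
  mgf_step F z c F' -> mgf_step F' z' c' F'' ->
  mgf_step F (fun w => z w + z' w) (c + c') F''.
Proof.
move=> sF sF' sF'' [FF' mz zc] [FF'' mz' zc']; split.
- exact: subset_trans FF' FF''.
- by apply: measurable_funD => //; exact: measurable_sub_trans FF'' mz.
move=> U mU U0.
under eq_integral do rewrite mulrDr expRD mulrA.
rewrite addrC expRD EFinM -muleA.
apply: le_trans (zc' (fun w => U w * expR (lam * z w)) _ _) _.
- apply: measurable_funM; first exact: measurable_sub_trans FF' mU.
  by apply: measurableT_comp => //; exact: measurable_funM.
- by move=> w; rewrite mulr_ge0 ?expR_ge0.
by rewrite lee_pmul2l ?lte_fin ?expR_gt0 // zc.
Qed.

Lemma mgf_step_weaken F F' F'' z c : sigma_algebra setT F' ->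
  sigma_algebra setT F'' -> F' `<=` F'' -> mgf_step F z c F' -> mgf_step F z c F''.
Proof.
move=> sF' sF'' FF [Fs mz zc]; split=> //; first exact: subset_trans FF.
exact: measurable_sub_trans FF mz.
Qed.

(** One martingale increment: the freezing lemma replaces the fresh variable by an inner integral,
    the weight comes out of it, and the centred exponential bound holds pointwise in the past. *)
Lemma mgf_step_cond_law (F F' : set (set Omega)) d (T : measurableType d)
    (Y : Omega -> T) (kap : Omega -> {measure set T -> \bar R})
    (g : g_sigma_algebraType F * T -> R) (b : R) :
  sigma_algebra setT F -> F `<=` measurable -> F `<=` F' ->
  sigma_algebra setT F' -> F' `<=` measurable ->
  measurable_fun setT (Y : g_sigma_algebraType F' -> T) ->
  (forall B, measurable B ->
    measurable_fun setT ((kap ^~ B) : g_sigma_algebraType F -> \bar R)) ->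
  (forall w, kap w setT = 1%E) ->
  cond_law P F Y (fun w => kap w) ->
  measurable_fun setT g -> (forall z, 0 <= g z <= b) ->
  mgf_step F (fun w => \int[kap w]_y g (w, y) - g (w, Y w))
    (2 * lam ^+ 2 * b ^+ 2) F'.
Proof.
move=> sF Fm FF' sF' Fm' mY mk kap1 ck mg gb.
have bg : bmeasurable g.
  by split=> //; exists b => y; have /andP[? ?] := gb y; rewrite ger0_norm.
have mY0 : measurable_fun setT Y.
  move=> _ B mB; rewrite setTI; apply: Fm'.
  exact: (iffRL (measurable_sub_fun sF' Y)) mB.
have mmean : measurable_fun setT
    ((fun w => \int[kap w]_y g (w, y)) : g_sigma_algebraType F -> R).
  exact: (measurable_mean (X := g_sigma_algebraType F) mk kap1 bg).
have mid : measurable_fun setT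
    (id : g_sigma_algebraType F' -> g_sigma_algebraType F).
  apply/(measurable_sub_fun sF') => B mB; apply: FF'.
  by rewrite -(g_sigma_algebra_id sF).
split=> //.
  apply: measurable_funB; first exact: measurable_sub_trans FF' mmean.
  apply: measurableT_comp mg _.
  exact/measurable_fun_pairP.
move=> U mU U0.
pose e (z : g_sigma_algebraType F * T) :=
  expR (lam * (\int[kap z.1]_y g (z.1, y) - g z)).
have me : measurable_fun setT e.
  apply: measurableT_comp => //; apply: measurable_funM => //.
  apply: measurable_funB => //.
  exact: (measurableT_comp mmean (@measurable_fst _ _ (g_sigma_algebraType F) T)).
have be : bmeasurable e.
  split=> //; exists (expR (`|lam| * b)) => -[w y].
  rewrite ger0_norm ?expR_ge0 // ler_expR.
  apply: le_trans (ler_norm _) _; rewrite normrM ler_wpM2l //.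
  have mgw : measurable_fun setT (fun y => g (w, y)).
    exact: (measurableT_comp mg (@pair1_measurable _ _ (g_sigma_algebraType F) T w)).
  have := mean_itv (kap1 w) mgw (fun y => gb (w, y)).
  by have := gb (w, y); rewrite ler_norml /=; lra.
pose f (z : g_sigma_algebraType F * T) := (U z.1 * e z)%:E.
have f0 z : (0 <= f z)%E by rewrite lee_fin mulr_ge0 ?expR_ge0.
have mf : measurable_fun setT f.
  apply/measurable_EFinP; apply: measurable_funM => //.
  exact: (measurableT_comp mU (@measurable_fst _ _ (g_sigma_algebraType F) T)).
have := cond_law_integral sF Fm mY0 mk kap1 ck f0 mf.
rewrite /f /e /= => ->.
pose me' w := \int[kap w]_y e (w, y).
have bew w : bmeasurable (fun y => e (w, y)).
  split; first exact: (measurableT_comp me (@pair1_measurable _ _ (g_sigma_algebraType F) T w)).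
  by have [_ [c ec]] := be; exists c.
have mme : measurable_fun setT (me' : g_sigma_algebraType F -> R).
  exact: (measurable_mean (X := g_sigma_algebraType F) mk kap1 be).
have toO (h : Omega -> R) : measurable_fun setT (h : g_sigma_algebraType F -> R) ->
    measurable_fun setT h.
  move=> mh _ B mB; rewrite setTI; apply: Fm.
  exact: (iffRL (measurable_sub_fun sF h)) mB.
have inner w : (\int[kap w]_y (U w * e (w, y))%:E)%E = (U w * me' w)%:E.
  under eq_integral do rewrite EFinM.
  rewrite ge0_integralZl //=; last 3 first.
  - exact/measurable_EFinP/((bew w).1).
  - by move=> y _; rewrite lee_fin expR_ge0.
  - by rewrite lee_fin.
  by rewrite -(EFin_mean (kap1 w) (bew w)).
under eq_integral do rewrite inner.
rewrite -ge0_integralZl //=; last 2 first.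
- exact/measurable_EFinP/toO.
- by move=> w _; rewrite lee_fin.
have me'0 w : 0 <= me' w.
  by apply: Rintegral_ge0 => y _; exact: expR_ge0.
apply: ge0_le_integral => //.
- by move=> w _; rewrite lee_fin mulr_ge0.
- by apply/measurable_EFinP/toO; exact: measurable_funM.
- by apply/measurable_EFinP/toO; exact: measurable_funM.
move=> w _; rewrite -EFinM lee_fin mulrC ler_wpM2r //.
apply: mean_expR_centered (kap1 w) _ (fun y => gb (w, y)).
exact: (measurableT_comp mg (@pair1_measurable _ _ (g_sigma_algebraType F) T w)).
Qed.

(** Chernoff's bound: unit weight, then Markov's inequality at level [expR (lam * t)]. Measurability
    is returned too, since this event becomes part of the good event. *)
Lemma mgf_step_tail F F' z c (t : R) : 0 < lam ->
  sigma_algebra setT F -> sigma_algebra setT F' -> F' `<=` measurable ->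
  mgf_step F z c F' ->
  measurable [set w | z w <= t] /\
  ((1 - expR (c - lam * t))%:E <= P [set w | (z w <= t)%R])%E.
Proof.
move=> lam0 sF sF' Fm' [_ mz zc].
have mz0 : measurable_fun setT z.
  move=> _ B mB; rewrite setTI; apply: Fm'.
  exact: (iffRL (measurable_sub_fun sF' z)) mB.
pose E := [set w | t < z w].
have mE : measurable E.
  have := mz0 measurableT `]t, +oo[%classic (measurable_itv _).
  congr (measurable _); apply/seteqP; split=> w /=; rewrite in_itv /= andbT.
    by case.
  by move=> ?; split.
have -> : [set w | z w <= t] = ~` E.
  by apply/seteqP; split=> w; rewrite /E /= leNgt => /negP.
split; first exact: measurableC.
rewrite probability_setC // EFinB leeB //.
have PE : P E \is a fin_num by exact: fin_num_measure.
suff : ((expR (lam * t))%:E * P E <= (expR c)%:E)%E.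
  rewrite -(fineK PE) -EFinM !lee_fin expRD expRN => h.
  by rewrite ler_pdivlMr ?expR_gt0 // mulrC.
have := zc (fun=> 1) (measurable_cst _) (fun=> ler01).
have -> : (\int[P]_w (1 : R)%:E = 1)%E.
  by rewrite integral_cst //= mul1e; exact: probability_setT.
rewrite mule1; apply: le_trans.
have -> : ((expR (lam * t))%:E * P E = \int[P]_(w in E) (expR (lam * t))%:E)%E.
  by rewrite integral_cst.
have me : measurable_fun setT (fun w => (1 * expR (lam * z w))%:E).
  apply/measurable_EFinP; apply: measurable_funM => //.
  by apply: measurableT_comp => //; exact: measurable_funM.
apply: (@le_trans _ _ (\int[P]_(w in E) (1 * expR (lam * z w))%:E)%E).
  apply: ge0_le_integral => //.
  - exact: measurable_funS me.
  - by move=> w /ltW ?; rewrite mul1r lee_fin ler_expR ler_pM2l.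
apply: ge0_subset_integral => // w _; rewrite lee_fin mul1r expR_ge0 //.
Qed.

End ExponentialMoments.


(** * Values of policies *)

Section BoundedKernelMean.
Context {R : realType} {dX dY : measure_display}.
Context {X : measurableType dX} {Y : measurableType dY}.

Lemma mean_norm_le (mu : {measure set Y -> \bar R}) (f : Y -> R) (b : R) :
  mu setT = 1%E -> measurable_fun setT f -> (forall y, `|f y| <= b) ->
  `|\int[mu]_y f y| <= b.
Proof.
by move=> mu1 mf fb; rewrite ler_norml; apply: mean_itv => // y; rewrite -ler_norml.
Qed.

Lemma bmeasurable_pair (f : X * Y -> R) x :
  bmeasurable f -> bmeasurable (fun y => f (x, y)).
Proof.
move=> [mf [b fb]]; split; last by exists b.
exact: measurableT_comp mf (pair1_measurable x).
Qed.

Lemma bmeasurable_mean (l : X -> {measure set Y -> \bar R}) (f : X * Y -> R) :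
  (forall U, measurable U -> measurable_fun setT (l ^~ U)) ->
  (forall x, l x setT = 1%E) -> bmeasurable f ->
  bmeasurable (fun x => \int[l x]_y f (x, y)).
Proof.
move=> ml l1 bf; split; first exact: measurable_mean.
have [_ [b fb]] := bf; exists b => x; apply: mean_norm_le => //.
exact: (bmeasurable_pair x bf).1.
Qed.

Lemma bmeasurable_comp (f : X -> Y) (g : Y -> R) :
  measurable_fun setT f -> bmeasurable g -> bmeasurable (g \o f).
Proof.
by move=> mf [mg [b gb]]; split; [exact: measurableT_comp|exists b => x; exact: gb].
Qed.

Lemma pker_mean_cst (k : R.-pker X ~> Y) x (c : R) : \int[k x]_y c = c.
Proof. exact: mean_cst (prob_kernel x) c. Qed.

End BoundedKernelMean.

Section Values.
Context {R : realType} {dS dA : measure_display}.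
Context {S : measurableType dS} {A : measurableType dA}.
Variable M : mdp R S A.
Let H := horizon M.
Hypothesis normM : normalized M.

Definition next_mean (pi : policy R S A) h (f : S * A -> R) (z : S * A) : R :=
  \int[trans M h z]_s' \int[pi h.+1 s']_a' f (s', a').

Lemma bmeasurable_policy_mean (pi : policy R S A) h (f : S * A -> R) :
  bmeasurable f -> bmeasurable (fun s => \int[pi h s]_a f (s, a)).
Proof.
move=> bf; apply: bmeasurable_mean => // [U mU|s]; last exact: prob_kernel.
exact: measurable_kernel.
Qed.

Lemma bmeasurable_trans_mean h (g : S -> R) :
  bmeasurable g -> bmeasurable (fun z => \int[trans M h z]_s' g s').
Proof.
move=> bg.
apply: (bmeasurable_mean (l := trans M h) (f := g \o snd)) => [U mU|s|].
- exact: measurable_kernel.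
- exact: prob_kernel.
- exact: bmeasurable_comp.
Qed.

Lemma bmeasurable_next_mean pi h f :
  bmeasurable f -> bmeasurable (next_mean pi h f).
Proof. by move=> bf; exact/bmeasurable_trans_mean/bmeasurable_policy_mean. Qed.

Lemma measurable_rmean h : measurable_fun setT (rmean M h).
Proof.
apply: measurableT_comp; first exact: fine_measurable.
under eq_fun do rewrite integralE.
apply: emeasurable_funB; apply: measurable_fun_integral_kernel => //.
- by move=> U mU; exact: measurable_kernel.
- by apply: measurable_funepos; exact/measurable_EFinP.
- by move=> U mU; exact: measurable_kernel.
- by apply: measurable_funeneg; exact/measurable_EFinP.
Qed.

Let G h (z0 : S * A) (t : seq (S * A)) : R :=
  \sum_(i < size t) rmean M (h + i) (nth z0 t i).

(** Generalized over an accumulated reward [c] and over the default [z0] of [nth]: unrolling one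
    step moves the head reward into the constant. Measurability is proved in the same induction,
    because splitting the integral at one step needs it at the next; boundedness comes from the
    normalization. *)
Lemma traj_expectation_shift (pi : policy R S A) n h : (h + n.+1)%N = H ->
  (forall z0 z c, traj_expectation M pi h n z (fun t => c + G h z0 t)
    = c + (rmean M h z
           + (if n is _.+1 then next_mean pi h (Qpi M pi h.+1) z else 0))) /\
  measurable_fun setT (Qpi M pi h).
Proof.
have Qb h' : (h' < H)%N -> forall z, `|Qpi M pi h' z| <= 1.
  move=> hH z; have /andP[q0 q1] := normM.2 pi h' z hH.
  by rewrite ger0_norm.
elim: n h => [|n IH] h hn.
  have E z0 z c : traj_expectation M pi h 0 z (fun t => c + G h z0 t)
      = c + (rmean M h z + 0).
    by rewrite /= /G /= big_ord1 /= addn0 addr0.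
  split=> //.
  have -> : Qpi M pi h = rmean M h.
    apply/funext => z; rewrite /Qpi -/H -hn addn1 subnn.
    have := E z z 0; rewrite add0r addr0 => <-.
    by congr (traj_expectation _ _ _ _ _ _); apply/funext => t; rewrite add0r.
  exact: measurable_rmean.
have [|IHs IHm] := IH h.+1; first by rewrite addSnnS.
have hS : (h.+1 < H)%N by rewrite -hn addnS ltnS addnS ltnS leq_addr.
have bQ : bmeasurable (Qpi M pi h.+1) by split=> //; exists 1; exact: Qb.
have QE z : Qpi M pi h.+1 z = rmean M h.+1 z
    + (if n is _.+1 then next_mean pi h.+1 (Qpi M pi h.+2) z else 0).
  rewrite -[RHS]add0r -(IHs z z 0) /Qpi -/H.
  have -> : (H - h.+2)%N = n by rewrite -hn -!addSnnS addKn.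
  by congr (traj_expectation _ _ _ _ _ _); apply/funext => t; rewrite add0r.
have E z0 z c : traj_expectation M pi h n.+1 z (fun t => c + G h z0 t)
    = c + (rmean M h z + next_mean pi h (Qpi M pi h.+1) z).
  rewrite addrA /=.
  transitivity (\int[trans M h z]_s' \int[pi h.+1 s']_a'
      (c + rmean M h z + Qpi M pi h.+1 (s', a'))).
    apply: eq_Rintegral => s' _; apply: eq_Rintegral => a' _.
    rewrite QE -(IHs z0); congr (traj_expectation _ _ _ _ _ _).
    apply/funext => t; rewrite /G /= big_ord_recl /= addn0 addrA.
    by congr (_ + _); apply: eq_bigr => i _; rewrite /= /bump /= add1n addSnnS.
  rewrite -[RHS](congr1 (fun x => x + next_mean pi h (Qpi M pi h.+1) z)
    (pker_mean_cst (trans M h) z (c + rmean M h z))).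
  have bS := bmeasurable_policy_mean pi h.+1 bQ.
  rewrite -meanD ?prob_kernel //; last exact: bmeasurable_cst.
  apply: eq_Rintegral => s' _.
  rewrite meanD ?prob_kernel ?pker_mean_cst //; first exact: bmeasurable_cst.
  exact: (bmeasurable_pair s' bQ).
split=> //.
have -> : Qpi M pi h = (fun z => rmean M h z + next_mean pi h (Qpi M pi h.+1) z).
  apply/funext => z; rewrite -[RHS]add0r -(E z z 0) /Qpi -/H.
  have -> : (H - h.+1)%N = n.+1 by rewrite -hn -addSnnS addKn.
  by congr (traj_expectation _ _ _ _ _ _); apply/funext => t; rewrite add0r.
apply: measurable_funD; first exact: measurable_rmean.
exact: (bmeasurable_next_mean pi h bQ).1.
Qed.

Lemma bmeasurable_Qpi pi h : (h < H)%N -> bmeasurable (Qpi M pi h).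
Proof.
move=> hH; split.
  by apply: (traj_expectation_shift pi (n := H - h.+1) _).2; rewrite -addSnnS subnKC.
exists 1 => z; have /andP[q0 q1] := normM.2 pi h z hH.
by rewrite ger0_norm.
Qed.

Lemma Qpi_rec pi h z : (h < H)%N -> Qpi M pi h z = rmean M h z
  + (if (h.+1 < H)%N then next_mean pi h (Qpi M pi h.+1) z else 0).
Proof.
move=> hH; have e : (h + (H - h.+1).+1)%N = H by rewrite -addSnnS subnKC.
have [E _] := traj_expectation_shift pi e.
have := E z z 0; rewrite !add0r.
have -> : (if (H - h.+1)%N is _.+1 then next_mean pi h (Qpi M pi h.+1) z else 0)
  = (if (h.+1 < H)%N then next_mean pi h (Qpi M pi h.+1) z else 0).
  by rewrite -subn_gt0; case: (H - h.+1)%N.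
move=> <-; rewrite /Qpi.
by congr (traj_expectation _ _ _ _ _ _); apply/funext => t; rewrite add0r.
Qed.

(** * Approximate Bellman inequalities against the values of policies *)

Section BellmanBounds.
Variable f : nat -> S * A -> R.
Hypothesis bf : forall h, exists b, forall z, `|f h z| <= b.
Hypothesis mV : forall h, (h <= H)%N -> measurable_fun setT (supA (f h)).
Hypothesis fH : forall z, f H z = 0.

Lemma f_le_supA h s a : f h (s, a) <= supA (f h) s.
Proof.
have [b fb] := bf h; apply: (supA_ge (b := b)) => a'.
exact: le_trans (ler_norm _) (fb _).
Qed.

Lemma bmeasurable_supA h : (h <= H)%N -> bmeasurable (supA (f h)).
Proof.
move=> hH; split; first exact: mV.
have [b fb] := bf h; exists b => s; rewrite ler_norml; apply/andP; split.
  by apply: le_trans (f_le_supA h s point); have := fb (s, point); rewrite ler_norml => /andP[].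
by apply: supA_le_bound => a; exact: le_trans (ler_norm _) (fb _).
Qed.

Lemma supA_fH s : supA (f H) s = 0.
Proof.
by rewrite (_ : f H = fun=> 0) ?supA_cst //; apply/funext.
Qed.

(** Backward induction in which each remaining step adds one error [e]; averaging over the actions
    of [pi] is bounded by the supremum. *)
Lemma Qpi_le_of_bellman (pi : policy R S A) (e : R) : 0 <= e ->
  (forall h z, (h < H)%N -> bellman M h (f h.+1) z <= f h z + e) ->
  forall n h, (h + n.+1)%N = H -> forall z, Qpi M pi h z <= f h z + n.+1%:R * e.
Proof.
move=> e0 Be; elim=> [|n IH] h hn z.
  have eS : h.+1 = H by rewrite -hn addn1.
  have hH : (h < H)%N by rewrite -eS.
  rewrite Qpi_rec // eS ltnn addr0 mul1r.
  apply: le_trans (Be h z hH); rewrite /bellman lerDl eS.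
  rewrite (_ : supA (f H) = fun=> 0) ?pker_mean_cst //.
  by apply/funext => s; rewrite supA_fH.
have hH : (h < H)%N by rewrite -hn addnS ltnS leq_addr.
have hS : (h.+1 < H)%N by rewrite -hn addnS ltnS addnS ltnS leq_addr.
have bQ := bmeasurable_Qpi pi hS.
have bS := bmeasurable_supA (ltnW hS).
suff : next_mean pi h (Qpi M pi h.+1) z
    <= \int[trans M h z]_s' supA (f h.+1) s' + n.+1%:R * e.
  have := Be h z hH; rewrite Qpi_rec // hS /bellman -(natr1 n.+1) mulrDl mul1r.
  lra.
rewrite -[X in _ <= _ + X](pker_mean_cst (trans M h) z) -meanD ?prob_kernel //;
  last exact: bmeasurable_cst.
apply: mean_le; first exact: prob_kernel.
- exact: bmeasurable_policy_mean.
- by apply: bmeasurableD => //; exact: bmeasurable_cst.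
move=> s; rewrite -[leRHS](pker_mean_cst (pi h.+1) s).
apply: mean_le; first exact: prob_kernel.
- exact: (bmeasurable_pair s bQ).
- exact: bmeasurable_cst.
move=> a; apply: le_trans (IH h.+1 _ (s, a)) _; first by rewrite addSnnS.
by rewrite lerD2r f_le_supA.
Qed.

(** [pi0] witnesses that the set of values is nonempty, as the real supremum requires. *)
Lemma Vstar_le_of_bellman (pi0 : policy R S A) (e : R) s : (0 < H)%N -> 0 <= e ->
  (forall h z, (h < H)%N -> bellman M h (f h.+1) z <= f h z + e) ->
  Vstar M 0 s <= supA (f 0) s + H%:R * e.
Proof.
move=> H0 e0 Be; apply: ge_sup; first by exists (Vpi M pi0 0 s); exists pi0.
move=> _ [pi _ <-].
rewrite -[leRHS](pker_mean_cst (pi 0) s).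
apply: mean_le; first exact: prob_kernel.
- exact: (bmeasurable_pair s (bmeasurable_Qpi pi H0)).
- exact: bmeasurable_cst.
move=> a; have := Qpi_le_of_bellman pi e0 Be (n := H.-1) (h := 0).
rewrite add0n prednK // => /(_ erefl (s, a)) /le_trans; apply.
by rewrite lerD2r f_le_supA.
Qed.

(** * Value gap of a greedy policy *)

Section Greedy.
Variables (pi : policy R S A) (b cap : nat -> S * A -> R) (D : nat -> S * A -> R).
Hypothesis mf : forall h, (h < H)%N -> measurable_fun setT (f h).
Hypothesis greedy_pi : forall h s, (h < H)%N ->
  pi h s [set a | ~ forall a', f h (s, a') <= f h (s, a)] = 0%E.
Hypothesis bD : forall h, (h < H)%N -> bmeasurable (D h).
Hypothesis DE : forall h z, (h < H)%N -> D h z = Num.min (cap h z)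
  (b h z + (if (h.+1 < H)%N then next_mean pi h (D h.+1) z else 0)).
Hypothesis f_bellman : forall h z, (h < H)%N ->
  f h z <= bellman M h (f h.+1) z + b h z.
Hypothesis f_cap : forall h z, (h < H)%N -> f h z - Qpi M pi h z <= cap h z.

Lemma bmeasurable_f h : (h < H)%N -> bmeasurable (f h).
Proof. by move=> hH; split; [exact: mf|exact: bf]. Qed.

Lemma greedy_mean h s : (h < H)%N -> \int[pi h s]_a f h (s, a) = supA (f h) s.
Proof.
move=> hH; have bs := bmeasurable_pair s (bmeasurable_f hH).
pose N := [set a | f h (s, a) < supA (f h) s].
(* The non-greedy actions form a strict sublevel set, hence a measurable one, although they are
   defined by a quantifier over all actions. *)
have NE : N = [set a | ~ forall a', f h (s, a') <= f h (s, a)].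
  apply/seteqP; split=> a /=.
    move=> lt le; move: lt; rewrite /N /= ltNge => /negP; apply.
    exact: supA_le_bound.
  move=> nle; rewrite /N /= ltNge; apply/negP => le; apply: nle => a'.
  exact: le_trans (f_le_supA h s a') le.
have mN : measurable N.
  have := bs.1 measurableT `]-oo, (supA (f h) s)[%classic (measurable_itv _).
  by congr (measurable _); apply/seteqP; split=> a /=; rewrite in_itv /=; [case|].
apply: (mean_ae_cst (prob_kernel s) bs mN); first by rewrite NE greedy_pi.
by move=> a /negP; rewrite -leNgt => le; apply/eqP; rewrite eq_le f_le_supA.
Qed.

(** One bound per branch of the minimum: [f_cap] for the truncation, and for the recursion the
    Bellman inequality, where greediness turns the supremum at the next state into a mean under
    [pi]. *)
Lemma gap_le_D n h : (h + n.+1)%N = H -> forall z, f h z - Qpi M pi h z <= D h z.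
Proof.
elim: n h => [|n IH] h hn z.
  have eS : h.+1 = H by rewrite -hn addn1.
  have hH : (h < H)%N by rewrite -eS.
  rewrite DE // le_min f_cap //= Qpi_rec // eS ltnn !addr0 lerBlDr.
  apply: le_trans (f_bellman z hH) _; rewrite addrC lerD2l /bellman eS.
  rewrite (_ : supA (f H) = fun=> 0) ?pker_mean_cst ?addr0 //.
  by apply/funext => s; rewrite supA_fH.
have hH : (h < H)%N by rewrite -hn addnS ltnS leq_addr.
have hS : (h.+1 < H)%N by rewrite -hn addnS ltnS addnS ltnS leq_addr.
have bQ := bmeasurable_Qpi pi hS; have bf' := bmeasurable_f hS.
rewrite DE // le_min f_cap //= Qpi_rec // hS.
suff : \int[trans M h z]_s' supA (f h.+1) s' - next_mean pi h (Qpi M pi h.+1) z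
    <= next_mean pi h (D h.+1) z.
  by have := f_bellman z hH; rewrite /bellman; lra.
have bS := bmeasurable_supA (ltnW hS).
rewrite -meanB ?prob_kernel //; last exact: bmeasurable_policy_mean.
apply: mean_le; first exact: prob_kernel.
- by apply: bmeasurableB => //; exact: bmeasurable_policy_mean.
- exact/bmeasurable_policy_mean/bD.
move=> s; rewrite -greedy_mean // -meanB ?prob_kernel //; last 2 first.
- exact: (bmeasurable_pair s bf').
- exact: (bmeasurable_pair s bQ).
apply: mean_le; first exact: prob_kernel.
- by apply: bmeasurableB; [exact: (bmeasurable_pair s bf')|exact: (bmeasurable_pair s bQ)].
- exact: (bmeasurable_pair s (bD hS)).
by move=> a; apply: IH; rewrite addSnnS.
Qed.

Lemma value_gap_le_mean_D s : (0 < H)%N ->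
  supA (f 0) s - Vpi M pi 0 s <= \int[pi 0 s]_a D 0 (s, a).
Proof.
move=> H0; have bQ := bmeasurable_Qpi pi H0; have bf' := bmeasurable_f H0.
rewrite -greedy_mean // -meanB ?prob_kernel //; last 2 first.
- exact: (bmeasurable_pair s bf').
- exact: (bmeasurable_pair s bQ).
apply: mean_le; first exact: prob_kernel.
- by apply: bmeasurableB; [exact: (bmeasurable_pair s bf')|exact: (bmeasurable_pair s bQ)].
- exact: (bmeasurable_pair s (bD H0)).
by move=> a; apply: (gap_le_D (n := H.-1)); rewrite add0n prednK.
Qed.

End Greedy.
End BellmanBounds.
End Values.


(** * Concentration of the value gaps *)

Section Concentration.
Context {R : realType} {dS dA dO : measure_display}.
Context {S : measurableType dS} {A : measurableType dA} {Omega : measurableType dO}.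
Variables (P : probability Omega R) (M : mdp R S A) (K : nat).
Variable X : process R S A Omega.
Let H := horizon M.
Hypothesis intX : mdp_interaction P M K X.

Local Notation FT k := (g_sigma_algebraType (filt X k 0)).

Lemma filt_mono_step k h j : (k < K)%N -> (h + j <= H)%N ->
  filt X k h `<=` filt X k (h + j).
Proof.
move=> kK; elim: j => [|j IH] hj; first by rewrite addn0 => B.
rewrite addnS in hj *; have [m1 m2] := int_mono intX kK hj.
apply: subset_trans (IH (ltnW hj)) _; exact: subset_trans m1 m2.
Qed.

Lemma filt_mono_episode k j : (k + j < K)%N -> filt X k 0 `<=` filt X (k + j) 0.
Proof.
elim: j => [|j IH]; first by rewrite addn0 => _ B.
rewrite addnS => kj; apply: subset_trans (IH (ltnW kj)) _.
apply: subset_trans (int_next intX kj).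
by have := @filt_mono_step (k + j) 0 H (ltnW kj) (leqnn _).
Qed.

Lemma filt_sigma k h : (k < K)%N -> (h <= H)%N ->
  sigma_algebra setT (filt X k h) /\ filt X k h `<=` measurable.
Proof. by move=> kK hH; have [] := int_sigma intX kK hH. Qed.

Lemma filtA_sigma k h : (k < K)%N -> (h <= H)%N ->
  sigma_algebra setT (filtA X k h) /\ filtA X k h `<=` measurable.
Proof. by move=> kK hH; have [] := int_sigma intX kK hH. Qed.

Lemma measurable_id_sub (F F' : set (set Omega)) :
  sigma_algebra setT F -> sigma_algebra setT F' -> F `<=` F' ->
  measurable_fun setT (id : g_sigma_algebraType F' -> g_sigma_algebraType F).
Proof.
move=> sF sF' FF'; apply/(measurable_sub_fun sF') => B mB; apply: FF'.
by rewrite -(g_sigma_algebra_id sF).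
Qed.

Variables (b : nat -> nat -> Omega -> S * A -> R) (cap : nat -> R).
Hypothesis b_ge0 : forall k h w z, (k < K)%N -> (h < H)%N -> 0 <= b k h w z.
Hypothesis cap_ge0 : forall h, 0 <= cap h.
Hypothesis mb : forall k h, (k < K)%N -> (h < H)%N ->
  measurable_fun setT ((fun x => b k h x.1 x.2) : FT k * (S * A) -> R).

(* An upper bound on the gap between the optimistic and the actual value with
   [n] steps to go.  Truncating at [cap] keeps the increments of the resulting
   martingale of order [cap], instead of the sum of the remaining bonuses. *)
Fixpoint capped_gap (k n : nat) (w : Omega) (z : S * A) : R :=
  match n with
  | 0 => 0
  | n'.+1 => Num.min (cap (H - n'.+1)) (b k (H - n'.+1) w z
      + next_mean M (pol X k w) (H - n'.+1) (capped_gap k n' w) z)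
  end.

Definition gap k h := capped_gap k (H - h).

Lemma next_mean0 pi h z : next_mean M pi h (fun=> 0) z = 0 :> R.
Proof.
rewrite /next_mean (_ : (fun s' => _) = fun=> 0) ?pker_mean_cst //.
by apply/funext => s; rewrite pker_mean_cst.
Qed.

Lemma gapE k h w z : (h < H)%N -> gap k h w z = Num.min (cap h) (b k h w z
  + (if (h.+1 < H)%N then next_mean M (pol X k w) h (gap k h.+1 w) z else 0)).
Proof.
move=> hH; rewrite /gap.
have -> : (H - h)%N = (H - h.+1).+1 by rewrite subnSK.
rewrite /= -[(H - (H - h.+1).+1)%N]/(H - (H - h.+1).+1)%N.
have -> : (H - (H - h.+1).+1)%N = h by rewrite subnSK // subKn // ltnW.
congr (Num.min _ (_ + _)); case: ltnP => // Hh.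
have -> : (H - h.+1)%N = 0%N by apply/eqP; rewrite subn_eq0.
exact: next_mean0.
Qed.

Lemma gap_itv k h w z : (k < K)%N -> 0 <= gap k h w z <= cap h.
Proof.
move=> kK; case: (ltnP h H) => [|Hh]; last first.
  rewrite /gap; have -> : (H - h)%N = 0%N by apply/eqP; rewrite subn_eq0.
  by rewrite lexx cap_ge0.
have [n] := ubnP (H - h)%N; elim: n h z => // n IH h z hn hH.
rewrite gapE // ge_min lexx andbT le_min cap_ge0 addr_ge0 ?b_ge0 //=.
case: ifP => // hS.
apply: Rintegral_ge0 => s _; apply: Rintegral_ge0 => a _.
by case/andP: (IH h.+1 (s, a) (leq_trans (ltn_sub2l hH (leqnn _)) hn) hS).
Qed.

(** Measurability is joint in the past and the state-action pair. The policy depends on the past,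
    and [int_policy] makes it a kernel out of pairs of a past and a state, so each recursion step is
    a parametrized kernel mean. *)
Lemma measurable_capped_gap k n : (k < K)%N -> (n <= H)%N ->
  measurable_fun setT ((fun x => capped_gap k n x.1 x.2) : FT k * (S * A) -> R).
Proof.
move=> kK; elim: n => [|n IH] nH; first exact: measurable_cst.
have hH : (H - n.+1 < H)%N by rewrite ltn_subrL (leq_trans _ nH).
rewrite /=; apply: measurable_minr; first exact: measurable_cst.
apply: measurable_funD; first exact: mb.
(* At the last step the recursion averages over actions of step [H], about which [int_policy] says
   nothing; there the integrand is zero. *)
case: n nH IH hH => [|n] nH IH hH.
  under eq_fun do rewrite next_mean0.
  exact: measurable_cst.
have hS : ((H - n.+2).+1 < H)%N by rewrite -subSn // subSS ltn_subrL (leq_trans _ nH).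
have bg : bmeasurable ((fun x => capped_gap k n.+1 x.1 x.2) : FT k * (S * A) -> R).
  split; first by apply: IH; exact: ltnW.
  exists (cap (H - n.+1)) => -[w z]; have := gap_itv (H - n.+1) w z kK.
  rewrite /gap subKn ?(ltnW nH) // => /andP[g0 g1].
  by rewrite ger0_norm.
pose inner (x : FT k * S) : R :=
  \int[pol X k x.1 (H - n.+2).+1 x.2]_a capped_gap k n.+1 x.1 (x.2, a).
have bi : bmeasurable inner.
  apply: (bmeasurable_mean (l := fun x : FT k * S => pol X k x.1 (H - n.+2).+1 x.2)
    (f := fun u => capped_gap k n.+1 u.1.1 (u.1.2, u.2))).
  - by move=> U mU; exact: (int_policy intX kK hS mU).
  - by move=> x; exact: prob_kernel.
  - apply: (bmeasurable_comp (f := fun u : (FT k * S) * A => (u.1.1, (u.1.2, u.2)))) bg.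
    apply/measurable_fun_pairP; split.
      exact: (measurableT_comp (@measurable_fst _ _ (FT k) S) (@measurable_fst _ _ _ A)).
    apply/measurable_fun_pairP; split; last exact: measurable_snd.
    exact: (measurableT_comp (@measurable_snd _ _ (FT k) S) (@measurable_fst _ _ _ A)).
apply: (bmeasurable_mean (l := fun x : FT k * (S * A) => trans M (H - n.+2) x.2)
    (f := fun u => inner (u.1.1, u.2)) _ _ _).1.
- move=> U mU.
  exact: (measurableT_comp (measurable_kernel (trans M (H - n.+2)) U mU)
    (@measurable_snd _ _ (FT k) (S * A)%type)).
- by move=> x; exact: prob_kernel.
- apply: (bmeasurable_comp (f := fun u : (FT k * (S * A)) * S => (u.1.1, u.2))) bi.
  apply/measurable_fun_pairP; split; last exact: measurable_snd.
  exact: (measurableT_comp (@measurable_fst _ _ (FT k) (S * A)%type) (@measurable_fst _ _ _ S)).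
Qed.

Lemma measurable_gap k h : (k < K)%N ->
  measurable_fun setT ((fun x => gap k h x.1 x.2) : FT k * (S * A) -> R).
Proof. by move=> kK; apply: measurable_capped_gap => //; exact: leq_subr. Qed.

Definition state_gap k h w s : R :=
  if (h < H)%N then \int[pol X k w h s]_a gap k h w (s, a) else 0.

(** Zero from the horizon on, so that shifting the step index in a sum of squares does not increase
    it. *)
Definition state_cap h : R := if (h < H)%N then cap h else 0.

Lemma bmeasurable_gap k h : (k < K)%N ->
  bmeasurable ((fun x => gap k h x.1 x.2) : FT k * (S * A) -> R).
Proof.
move=> kK; split; first exact: measurable_gap.
exists (cap h) => -[w z]; have /andP[g0 g1] := gap_itv h w z kK.
by rewrite ger0_norm.
Qed.

Lemma bmeasurable_state_gap k h : (k < K)%N ->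
  bmeasurable ((fun x => state_gap k h x.1 x.2) : FT k * S -> R).
Proof.
move=> kK; rewrite /state_gap; case hH : (h < H)%N; last exact: bmeasurable_cst.
apply: (bmeasurable_mean (l := fun x : FT k * S => pol X k x.1 h x.2)
    (f := fun u => gap k h u.1.1 (u.1.2, u.2))).
- by move=> U mU; exact: (int_policy intX kK hH mU).
- by move=> x; exact: prob_kernel.
- apply: (bmeasurable_comp (f := fun u : (FT k * S) * A => (u.1.1, (u.1.2, u.2))))
    (bmeasurable_gap h kK).
  apply/measurable_fun_pairP; split.
    exact: (measurableT_comp (@measurable_fst _ _ (FT k) S) (@measurable_fst _ _ _ A)).
  apply/measurable_fun_pairP; split; last exact: measurable_snd.
  exact: (measurableT_comp (@measurable_snd _ _ (FT k) S) (@measurable_fst _ _ _ A)).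
Qed.

Lemma bmeasurable_gap_section k h w : (k < K)%N -> bmeasurable (gap k h w).
Proof.
move=> kK; exact: (bmeasurable_pair (X := FT k) w (bmeasurable_gap h kK)).
Qed.

Lemma state_gap_itv k h w s : (k < K)%N -> 0 <= state_gap k h w s <= state_cap h.
Proof.
move=> kK; rewrite /state_gap /state_cap; case: ifP => hH; last by rewrite lexx.
apply: mean_itv => [|| a]; first exact: prob_kernel.
  exact: (bmeasurable_pair s (bmeasurable_gap_section h w kK)).1.
exact: gap_itv.
Qed.

(** Two increments per step, one for the action and one for the next state, following the
    alternation of [filt] and [filtA]. *)
Definition action_noise k h w : R :=
  state_gap k h w (st X k h w) - gap k h w (za X k h w).

Definition state_noise k h w : R :=
  \int[trans M h (za X k h w)]_s state_gap k h.+1 w s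
  - state_gap k h.+1 w (st X k h.+1 w).

Variable lam : R.

Lemma measurable_st k h : (k < K)%N -> (h <= H)%N ->
  measurable_fun setT (st X k h : g_sigma_algebraType (filt X k h) -> S).
Proof.
move=> kK hH; apply/(measurable_sub_fun (filt_sigma kK hH).1).
exact (int_state intX kK hH).
Qed.

Lemma measurable_id_filt k h : (k < K)%N -> (h <= H)%N ->
  measurable_fun setT (id : g_sigma_algebraType (filt X k h) -> FT k).
Proof.
move=> kK hH; apply: measurable_id_sub.
- exact: (filt_sigma kK (leq0n _)).1.
- exact: (filt_sigma kK hH).1.
- by have := @filt_mono_step k 0 h kK hH.
Qed.

Lemma measurable_id_filtA k h : (k < K)%N -> (h < H)%N ->
  measurable_fun setT (id : g_sigma_algebraType (filtA X k h) ->
                            g_sigma_algebraType (filt X k h)).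
Proof.
move=> kK hH; apply: measurable_id_sub.
- exact: (filt_sigma kK (ltnW hH)).1.
- exact: (filtA_sigma kK (ltnW hH)).1.
- exact: (int_mono intX kK hH).1.
Qed.

Lemma measurable_za k h : (k < K)%N -> (h < H)%N ->
  measurable_fun setT (za X k h : g_sigma_algebraType (filtA X k h) -> S * A).
Proof.
move=> kK hH; apply/measurable_fun_pairP; split.
  exact: (measurableT_comp (measurable_st kK (ltnW hH)) (measurable_id_filtA kK hH)).
apply/(measurable_sub_fun (filtA_sigma kK (ltnW hH)).1).
exact: (int_action intX kK hH).1.
Qed.

Lemma mgf_step_action k h : (k < K)%N -> (h < H)%N ->
  mgf_step P lam (filt X k h) (action_noise k h) (2 * lam ^+ 2 * state_cap h ^+ 2)
    (filtA X k h).
Proof.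
move=> kK hH.
have [sF Fm] := filt_sigma kK (ltnW hH); have [sA Am] := filtA_sigma kK (ltnW hH).
pose g (u : g_sigma_algebraType (filt X k h) * A) : R :=
  gap k h u.1 (st X k h u.1, u.2).
have mg : measurable_fun setT g.
  suff hu : measurable_fun setT (fun u : g_sigma_algebraType (filt X k h) * A =>
      (u.1, (st X k h u.1, u.2)) : FT k * (S * A)).
    exact: (measurableT_comp (measurable_gap h kK) hu).
  apply/measurable_fun_pairP; split.
    exact: (measurableT_comp (measurable_id_filt kK (ltnW hH)) (@measurable_fst _ _ _ A)).
  apply/measurable_fun_pairP; split; last exact: measurable_snd.
  exact: (measurableT_comp (measurable_st kK (ltnW hH)) (@measurable_fst _ _ _ A)).
have := mgf_step_cond_law (P := P) lam (F := filt X k h) (F' := filtA X k h)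
  (Y := ac X k h) (kap := fun w => pol X k w h (st X k h w)) (g := g) (b := state_cap h)
  sF Fm (int_mono intX kK hH).1 sA Am.
rewrite /action_noise /state_gap hH; apply.
- exact: (measurableT_comp (@measurable_snd _ _ S A) (measurable_za kK hH)).
- move=> B mB.
  suff hu : measurable_fun setT
      (fun w : g_sigma_algebraType (filt X k h) => (w, st X k h w) : FT k * S).
    exact: (measurableT_comp (int_policy intX kK hH mB) hu).
  apply/measurable_fun_pairP; split; last exact: (measurable_st kK (ltnW hH)).
  exact: (measurable_id_filt kK (ltnW hH)).
- by move=> w; exact: prob_kernel.
- exact: (int_action intX kK hH).2.
- exact: mg.
- by move=> [w a]; rewrite /state_cap hH; exact: gap_itv.
Qed.

Lemma mgf_step_state k h : (k < K)%N -> (h < H)%N ->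
  mgf_step P lam (filtA X k h) (state_noise k h) (2 * lam ^+ 2 * state_cap h.+1 ^+ 2)
    (filt X k h.+1).
Proof.
move=> kK hH.
have [sF Fm] := filt_sigma kK hH; have [sA Am] := filtA_sigma kK (ltnW hH).
pose g (u : g_sigma_algebraType (filtA X k h) * S) : R := state_gap k h.+1 u.1 u.2.
have mid : measurable_fun setT (id : g_sigma_algebraType (filtA X k h) -> FT k).
  exact: (measurableT_comp (measurable_id_filt kK (ltnW hH)) (measurable_id_filtA kK hH)).
have mg : measurable_fun setT g.
  suff hu : measurable_fun setT
      (fun u : g_sigma_algebraType (filtA X k h) * S => (u.1, u.2) : FT k * S).
    exact: (measurableT_comp (bmeasurable_state_gap h.+1 kK).1 hu).
  apply/measurable_fun_pairP; split; last exact: measurable_snd.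
  exact: (measurableT_comp mid (@measurable_fst _ _ _ S)).
have := mgf_step_cond_law (P := P) lam (F := filtA X k h) (F' := filt X k h.+1)
  (Y := st X k h.+1) (kap := fun w => trans M h (za X k h w)) (g := g)
  (b := state_cap h.+1) sA Am (int_mono intX kK hH).2 sF Fm.
apply.
- exact: measurable_st.
- move=> B mB.
  exact: (measurableT_comp (measurable_kernel (trans M h) B mB) (measurable_za kK hH)).
- by move=> w; exact: prob_kernel.
- exact (int_trans intX kK hH).
- exact: mg.
- by move=> [w s]; exact: state_gap_itv.
Qed.

Lemma mgf_step_episode k j : (k < K)%N -> (j <= H)%N ->
  mgf_step P lam (filt X k 0)
    (fun w => \sum_(h < j) (action_noise k h w + state_noise k h w))
    (\sum_(h < j) (2 * lam ^+ 2 * state_cap h ^+ 2 + 2 * lam ^+ 2 * state_cap h.+1 ^+ 2))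
    (filt X k j).
Proof.
move=> kK; elim: j => [|j IH] jH.
  under eq_fun do rewrite big_ord0.
  by rewrite big_ord0; apply: mgf_step0; exact: (filt_sigma kK _).1.
under eq_fun do rewrite big_ord_recr /=.
rewrite big_ord_recr /=.
have s0 := (filt_sigma kK (leq0n _)).1; have sj := (filt_sigma kK (ltnW jH)).1.
have sA := (filtA_sigma kK (ltnW jH)).1; have sS := (filt_sigma kK jH).1.
apply: (mgf_step_trans s0 sj sS (IH (ltnW jH))).
exact: mgf_step_trans sj sA sS (mgf_step_action kK jH) (mgf_step_state kK jH).
Qed.

(** Between episodes the information only grows and no increment is charged, so the environment is
    free to choose the next initial state from the whole past. *)
Lemma mgf_step_episodes j : (j < K)%N ->
  mgf_step P lam (filt X 0 0)
    (fun w => \sum_(k < j.+1) \sum_(h < H) (action_noise k h w + state_noise k h w))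
    (\sum_(k < j.+1)
       \sum_(h < H) (2 * lam ^+ 2 * state_cap h ^+ 2 + 2 * lam ^+ 2 * state_cap h.+1 ^+ 2))
    (filt X j H).
Proof.
elim: j => [|j IH] jK.
  under eq_fun do rewrite big_ord1.
  by rewrite big_ord1; exact: mgf_step_episode.
under eq_fun do rewrite big_ord_recr /=.
rewrite big_ord_recr /=.
have K0 := leq_ltn_trans (leq0n _) jK.
have s0 := (filt_sigma K0 (leq0n _)).1.
have sj := (filt_sigma (ltnW jK) (leqnn _)).1.
have sS := (filt_sigma jK (leq0n _)).1; have sE := (filt_sigma jK (leqnn _)).1.
apply: (mgf_step_trans s0 sS sE _ (mgf_step_episode jK (leqnn _))).
exact: mgf_step_weaken sj sS (int_next intX jK) (IH (ltnW jK)).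
Qed.

(** The constant 4 collects two increments per step, each contributing [2 * lam ^+ 2] times a
    squared cap. *)
Lemma noise_tail (t : R) : 0 < lam -> (0 < K)%N ->
  let Z w := \sum_(k < K) \sum_(h < H) (action_noise k h w + state_noise k h w) in
  measurable [set w | Z w <= t] /\
  ((1 - expR (lam ^+ 2 * (4 * (\sum_(h < H) cap h ^+ 2) * K%:R) - lam * t))%:E
    <= P [set w | (Z w <= t)%R])%E.
Proof.
move=> lam0 K0 Z.
have KK : (K.-1 < K)%N by rewrite prednK.
have st := mgf_step_episodes KK.
have [mE PE] := mgf_step_tail t lam0 (filt_sigma K0 (leq0n _)).1
  (filt_sigma KK (leqnn _)).1 (filt_sigma KK (leqnn _)).2 st.
rewrite prednK // in mE PE.
split=> //; apply: le_trans PE.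
rewrite lee_fin lerD2l lerN2 ler_expR lerD2r.
rewrite sumr_const card_ord -[leLHS]mulr_natr mulrA ler_wpM2r //.
have sq h : 0 <= state_cap h ^+ 2 by exact: sqr_ge0.
have e1 : \sum_(h < H) state_cap h ^+ 2 = \sum_(h < H) cap h ^+ 2.
  by apply: eq_bigr => h _; rewrite /state_cap ltn_ord.
have e2 : \sum_(h < H) state_cap h.+1 ^+ 2 <= \sum_(h < H) cap h ^+ 2.
  have : \sum_(h < H.+1) state_cap h ^+ 2 = state_cap 0 ^+ 2 + \sum_(h < H) state_cap h.+1 ^+ 2.
    by rewrite big_ord_recl.
  rewrite big_ord_recr /= e1 {1}/state_cap ltnn expr0n addr0 /= => ->.
  by rewrite lerDr.
rewrite big_split -!mulr_sumr /= e1.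
have := sqr_ge0 lam; nra.
Qed.

(** Along the observed trajectory the minimum is bounded by its untruncated branch, leaving observed
    bonuses plus noise; the final state gap is zero. *)
Lemma state_gap_telescope k w : (k < K)%N ->
  state_gap k 0 w (st X k 0 w) <= \sum_(h < H) b k h w (za X k h w)
    + \sum_(h < H) (action_noise k h w + state_noise k h w).
Proof.
move=> kK.
suff: forall j, (j <= H)%N -> state_gap k 0 w (st X k 0 w) <=
    \sum_(h < j) b k h w (za X k h w)
    + \sum_(h < j) (action_noise k h w + state_noise k h w)
    + state_gap k j w (st X k j w).
  by move=> /(_ H (leqnn _)); rewrite [X in _ + X]/state_gap ltnn addr0.
elim=> [|j IH] jH; first by rewrite !big_ord0 !add0r.
rewrite !big_ord_recr /=; apply: le_trans (IH (ltnW jH)) _.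
suff : gap k j w (za X k j w) <= b k j w (za X k j w)
    + \int[trans M j (za X k j w)]_s state_gap k j.+1 w s.
  by rewrite /action_noise /state_noise; lra.
rewrite gapE // ge_min; apply/orP; right; rewrite lerD2l /state_gap /next_mean.
by case: ifP => // _; rewrite pker_mean_cst.
Qed.

End Concentration.


(** * Existence of optimistic parameters *)

Section Continuity.
Context {R : realType} {T : topologicalType}.
Implicit Types f g : T -> R.

(** Continuity of vector-valued maps is treated coordinatewise, so that only real limits occur. *)
Definition coord_cont d (v : T -> 'cV[R]_d) := forall i, continuous (fun t => v t i 0).

Lemma cont_sum (J : Type) (r : seq J) (Q : pred J) (F : J -> T -> R) :
  (forall j, continuous (F j)) -> continuous (fun t => \sum_(j <- r | Q j) F j t).
Proof.
move=> cF t; elim: r => [|j r IH].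
  by under eq_fun do rewrite big_nil; exact: cvg_cst.
under eq_fun do rewrite big_cons.
case: (Q j) => //.
by apply: cvgD => //; exact: cF.
Qed.

Lemma cont_dotp d (c : 'cV[R]_d) v : coord_cont v -> continuous (fun t => dotp c (v t)).
Proof.
move=> cv; under eq_fun do rewrite dotp_sum.
by apply: cont_sum => i t; apply: cvgM; [exact: cvg_cst|exact: cv].
Qed.

Lemma cont_dist f (c : R) : continuous f -> continuous (fun t => `|f t - c|).
Proof.
by move=> cf t; apply: cvg_norm; apply: cvgB; [exact: cf|exact: cvg_cst].
Qed.

Lemma cont_addl f (c : R) : continuous f -> continuous (fun t => c + f t).
Proof. by move=> cf t; apply: cvgD; [exact: cvg_cst|exact: cf]. Qed.

Lemma cont_sqrt f : continuous f -> continuous (fun t => Num.sqrt (f t)).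
Proof. by move=> cf t; apply: continuous_comp; [exact: cf|exact: sqrt_continuous]. Qed.

Lemma cont_enorm d v : @coord_cont d v -> continuous (fun t => enorm (v t)).
Proof.
move=> cv; apply: cont_sqrt; apply: cont_sum => i t.
by under eq_fun do rewrite expr2; apply: cvgM; exact: cv.
Qed.

Lemma coord_contB d v u : @coord_cont d v -> coord_cont u ->
  coord_cont (fun t => v t - u t).
Proof.
move=> cv cu i t; under eq_fun do rewrite !mxE.
by apply: cvgB; [exact: cv|exact: cu].
Qed.

Lemma coord_cont_cst d (c : 'cV[R]_d) : coord_cont (fun=> c).
Proof. by move=> i t; exact: cvg_cst. Qed.

Lemma coord_cont_mulmx d (B : 'M[R]_d) v : coord_cont v ->
  coord_cont (fun t => B *m v t).
Proof.
move=> cv i; under eq_fun do rewrite mxE.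
by apply: cont_sum => j t; apply: cvgM; [exact: cvg_cst|exact: cv].
Qed.

Lemma coord_cont_sum d (J : Type) (r : seq J) (Q : pred J) (a : J -> T -> R)
    (u : J -> 'cV[R]_d) : (forall j, continuous (a j)) ->
  coord_cont (fun t => \sum_(j <- r | Q j) a j t *: u j).
Proof.
move=> ca i; under eq_fun do rewrite summxE.
apply: cont_sum => j t; under eq_fun do rewrite mxE.
by apply: cvgM; [exact: ca|exact: cvg_cst].
Qed.

Lemma cont_wnorm d (B : 'M[R]_d) v : coord_cont v -> continuous (fun t => wnorm B (v t)).
Proof.
move=> cv; apply: cont_sqrt; under eq_fun do rewrite mxE.
apply: cont_sum => j t; apply: cvgM; last exact: cv.
suff : continuous (fun x => ((v x)^T *m B) 0 j) by apply.
under eq_fun do rewrite mxE.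
apply: cont_sum => i u; apply: cvgM; last exact: cvg_cst.
suff : continuous (fun x => (v x)^T 0 i) by apply.
by under eq_fun do rewrite mxE; exact: cv.
Qed.

Lemma closed_sublevel f (c : R) : continuous f -> closed [set t | f t <= c].
Proof.
move=> cf; have -> : [set t | f t <= c] = f @^-1` [set x | x <= c] by [].
by apply: closed_comp => //; exact: closed_le.
Qed.

Context {dS dA : measure_display}.
Context {S : measurableType dS} {A : measurableType dA}.

(** The action values are Lipschitz in the parameter uniformly over actions, and this modulus passes
    to the supremum over a possibly infinite action set. *)
Lemma cont_supA_Qfun (L : features R S A) h (l : R) s
    (th : T -> 'I_(nreg L h) -> 'cV[R]_(fdim L h)) :
  0 <= l -> (forall z, enorm (phi L h z) <= l) ->
  (forall n, coord_cont (fun t => th t n)) ->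
  continuous (fun t => supA (Qfun (th t)) s).
Proof.
move=> l0 phil cth t0.
pose g t := \sum_n l * enorm (th t n - th t0 n).
have cg : continuous g.
  apply: cont_sum => n t; apply: cvgM; first exact: cvg_cst.
  by apply: cont_enorm; apply: coord_contB => //; exact: coord_cont_cst.
have g0 : g t0 = 0.
  rewrite /g big1 // => n _; rewrite subrr /enorm big1 ?sqrtr0 ?mulr0 // => i _.
  by rewrite mxE expr0n.
have bnd t : exists b, forall a, Qfun (th t) (s, a) <= b.
  exists (\sum_n l * enorm (th t n)) => a.
  apply: le_trans (ler_norm _) _; apply: le_trans (Qfun_le l0 (phil _) (lexx _)) _.
  by rewrite (bigD1 (rho L h (s, a))) //= lerDl sumr_ge0 // => *; rewrite mulr_ge0 ?enorm_ge0.
have close t z : `|Qfun (th t) z - Qfun (th t0) z| <= g t.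
  rewrite QfunB; apply: le_trans (Qfun_le l0 (phil _) (lexx _)) _.
  by rewrite /g (bigD1 (rho L h z)) //= lerDl sumr_ge0 // => *; rewrite mulr_ge0 ?enorm_ge0.
have lip t : `|supA (Qfun (th t0)) s - supA (Qfun (th t)) s| <= g t.
  have [b0 B0] := bnd t0; have [b1 B1] := bnd t.
  rewrite ler_distl; apply/andP; split.
    rewrite lerBlDr; apply: (supA_leD (b := b0) B0) => a.
    by have := close t (s, a); rewrite ler_norml => /andP[]; lra.
  apply: (supA_leD (b := b1) B1) => a.
  by have := close t (s, a); rewrite ler_norml => /andP[]; lra.
apply/cvgrPdist_le => e e0.
have /cvgrPdist_le/(_ e e0) := cg t0; rewrite g0.
apply: filterS => t; rewrite sub0r normrN => ge.
exact: le_trans (lip t) (le_trans (ler_norm _) ge).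
Qed.

End Continuity.

(** * Attainment of the inherent Bellman error *)

Section Feasibility.
Context {R : realType} {dS dA : measure_display}.
Context {S : measurableType dS} {A : measurableType dA}.
Variables (M : mdp R S A) (L : features R S A) (I l : R).
Let H := horizon M.
Hypothesis LL : locally_linearizable M L I.
Hypothesis l0 : 0 <= l.
Hypothesis phil : forall h z, (h < H)%N -> enorm (phi L h z) <= l.

Definition Qnext (th : param L) h : S * A -> R :=
  if (h < H)%N then Qfun (th h) else fun=> 0.

Lemma next_valueE (th : param L) h s : next_value M h th s = supA (Qnext th h.+1) s.
Proof. by rewrite /next_value /Qnext -/H; case: ifP => // _; rewrite supA_cst. Qed.

Lemma bellman_approx_eps h f (e : R) : (h < H)%N -> Qclass L H h.+1 f -> 0 < e ->
  exists2 g, Qclass L H h g & forall z, `|g z - bellman M h f z| <= I + e.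
Proof.
move=> hH Qf e0; have [_ _ _ IBE] := LL.
have : (ereal_inf [set supnorm (fun z => g z - bellman M h f z)%R
          | g in Qclass L H h] <= I%:E)%E.
  apply: le_trans IBE; rewrite /inherent_bellman_error.
  apply: le_trans (le_bigmax _ _ (Ordinal hH)) => /=.
  by apply: ereal_sup_ubound; exists f.
move=> /le_lt_trans /(_ (_ : (I%:E < (I + e)%:E)%E)).
rewrite lte_fin ltrDl => /(_ e0) /ereal_inf_lt [_ [g Qg <-] /ltW gle].
exists g => // z; rewrite -lee_fin; apply: le_trans gle.
by apply: ereal_sup_ubound; exists z.
Qed.

(** The parameters of error at most [I + e] are nonempty closed subsets of a compact product,
    decreasing with [e]. A cluster point of the filter they generate lies in all of them, hence has
    error at most [I]. *)
Lemma bellman_approx h f : (h < H)%N -> Qclass L H h.+1 f ->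
  exists th : 'I_(nreg L h) -> 'cV[R]_(fdim L h),
    (forall n, Bset L n (th n)) /\
    forall z, `|Qfun th z - bellman M h f z| <= I.
Proof.
move=> hH Qf; have [_ _ cB _] := LL.
pose T := prod_topology (fun _ : 'I_(nreg L h) => 'cV[R]_(fdim L h)).
pose C : set T := [set th | forall n, Bset L n (th n)].
have cC : compact C := tychonoff (fun n => cB h n hH).
pose D (e : R) : set T := [set th | forall z, `|Qfun th z - bellman M h f z| <= I + e].
have cQ z : continuous (fun th : T => Qfun th z).
  apply: cont_dotp => i u.
  apply: (@continuous_comp _ _ _ (fun th : T => th (rho L h z))
    (fun v : 'cV[R]_(fdim L h) => v i 0)); last exact: coord_continuous.
  exact: proj_continuous.
have cont z : continuous (fun th : T => `|Qfun th z - bellman M h f z|).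
  exact: cont_dist.
pose F := filter_from [set e : R | 0 < e] (fun e => C `&` D e).
have PF : ProperFilter F.
  apply: filter_from_proper.
    apply: filter_from_filter; first by exists 1; exact: ltr01.
    move=> e1 e2 p1 p2; exists (Num.min e1 e2); first by rewrite /= lt_min p1.
    move=> th [Cth Dth]; split; split=> // z; apply: le_trans (Dth z) _.
      by rewrite lerD2l ge_min lexx.
    by rewrite lerD2l ge_min lexx orbT.
  move=> e e0; have [g + gle] := bellman_approx_eps hH Qf e0.
  by rewrite /Qclass hH => -[th Bth gE]; exists th; split=> // z; rewrite gE.
have FC : F C by exists 1; [exact: ltr01|move=> ? []].
have [th [Cth clth]] := cC F PF FC.
exists th; split=> // z; rewrite -[leRHS]addr0; apply/ler_addgt0Pr => e e0.
have clD : closed (D e).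
  have -> : D e = \bigcap_z' [set th : T | `|Qfun th z' - bellman M h f z'| <= I + e].
    by apply/seteqP; split=> u h' z' => [_|]; [exact: h'|exact: (h' z' Logic.I)].
  by apply: closed_bigI => z' _; apply: closed_sublevel; exact: cont.
have : closure (D e) th.
  move: clth; rewrite clusterE; apply.
  by exists e => // ? [].
by move=> /clD /(_ z); rewrite addr0.
Qed.

Lemma I_ge0 : (0 < H)%N -> 0 <= I.
Proof.
move=> H0; have hH : (H.-1 < H)%N by rewrite prednK.
have Q0 : Qclass L H H.-1.+1 (fun=> 0) by rewrite prednK // /Qclass ltnn.
have [th [_ /(_ point)]] := bellman_approx hH Q0.
exact: le_trans.
Qed.

Definition bellman_consistent (th : param L) h :=
  (forall n, Bset L n (th h n)) /\
  forall z, `|Qfun (th h) z - bellman M h (Qnext th h.+1) z| <= I.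

Lemma Qnext_class (th : param L) h :
  ((h < H)%N -> forall n, Bset L n (th h n)) -> Qclass L H h (Qnext th h).
Proof. by rewrite /Qclass /Qnext; case: ifP => // hH B; exists (th h) => //; exact: B. Qed.

(** Constructed backwards: the parameter of step [h0] approximates the Bellman image of the one
    already chosen at [h0.+1], and [dfwith] leaves the later steps untouched. *)
Lemma bellman_consistent_exists : exists th : param L,
  forall h, (h < H)%N -> bellman_consistent th h.
Proof.
suff: forall n, exists th : param L,
    forall h, (h < H)%N -> (H <= h + n)%N -> bellman_consistent th h.
  move=> /(_ H)[th hth]; exists th => h hH; apply: hth => //.
  exact: leq_addl.
elim=> [|n [th IH]].
  by exists (fun h n => 0) => h hH; rewrite addn0 leqNgt hH.
have [Hn|nH] := leqP H n.
  by exists th => h hH _; apply: IH => //; exact: leq_trans (leq_addl _ _).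
pose h0 := (H - n.+1)%N.
have h0H : (h0 < H)%N by rewrite /h0 ltn_subrL (leq_ltn_trans _ nH).
have Q0 : Qclass L H h0.+1 (Qnext th h0.+1).
  apply: Qnext_class => hS; apply: (IH _ hS _).1.
  by rewrite addSnnS /h0 subnK.
have [t0 [Bt0 t0E]] := bellman_approx h0H Q0.
exists (dfwith th h0 t0) => h hH.
have Qn h' : (h0 < h')%N -> Qnext (dfwith th h0 t0) h' = Qnext th h'.
  by move=> lt; rewrite /Qnext dfwithout // ltn_eqF.
rewrite addnS leq_eqVlt => /orP[/eqP e|].
  have -> : h = h0 by rewrite /h0 e subSS addnK.
  by split=> [m|z]; rewrite ?dfwithin // Qn // dfwithin.
rewrite ltnS => hn; have lt : (h0 < h)%N by rewrite /h0 ltn_subLR // addSn ltnS addnC.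
have [Bh Eh] := IH h hH hn.
by split=> [m|z]; rewrite ?Qn ?dfwithout ?ltn_eqF // ltnW.
Qed.

End Feasibility.


(** * Feasible parameters and solutions on the confidence event *)

Section Solutions.
Context {R : realType} {dS dA dO : measure_display}.
Context {S : measurableType dS} {A : measurableType dA} {Omega : measurableType dO}.
Variables (M : mdp R S A) (L : features R S A) (I l : R).
Variable X : process R S A Omega.
Variable beta : nat -> forall h, 'I_(nreg L h) -> R.
Let H := horizon M.
Hypothesis LL : locally_linearizable M L I.
Hypothesis l0 : 0 <= l.
Hypothesis phil : forall h z, (h < H)%N -> enorm (phi L h z) <= l.
Hypothesis Bnorm : forall h (n : 'I_(nreg L h)) th, (h < H)%N -> Bset L n th ->
  enorm th <= Rdiam n.
Hypothesis H0 : (0 < H)%N.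
Variables (K : nat) (w : Omega).
Hypothesis conf : confidence_event M 1 X beta K w.

Definition rho_is h (n : 'I_(nreg L h)) : pred nat :=
  fun tau => rho L h (za X tau h w) == n.

Lemma gram_design k h (n : 'I_(nreg L h)) :
  gram 1 X k n w = design (rho_is n) (fun tau => phi L h (za X tau h w)) k.
Proof. by []. Qed.

Lemma posdef_gram k h (n : 'I_(nreg L h)) : posdef (gram 1 X k n w).
Proof. by rewrite gram_design; exact: posdef_design. Qed.

(** Ridge regression with the Bellman residual of [th'] as bias. The next value function depends on
    the data through [th], which is why the confidence event is uniform over the value class. *)
Lemma least_squares_error k h (n : 'I_(nreg L h)) (th : param L)
    (th' : 'I_(nreg L h) -> 'cV[R]_(fdim L h)) :
  (k < K)%N -> (h < H)%N ->
  ((h.+1 < H)%N -> forall m, Bset L m (th h.+1 m)) ->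
  (forall m, Bset L m (th' m)) ->
  (forall z, `|Qfun th' z - bellman M h (Qnext M th h.+1) z| <= I) ->
  wnorm (gram 1 X k n w) (th' n - least_squares M 1 X k n th w)
  <= sqrt_alpha I 1 X beta k n w.
Proof.
move=> kK hH Bth Bth' E.
have I0 := I_ge0 LL H0.
pose V := supA (Qnext M th h.+1).
have VV : Vclass L H h.+1 V by exists (Qnext M th h.+1) => //; exact: Qnext_class.
have := @ridge_error _ _ (rho_is n) (fun tau => phi L h (za X tau h w)) k (th' n)
  (fun tau => rw X tau h w + next_value M h th (st X tau h.+1 w))
  (fun tau => bellman M h (Qnext M th h.+1) (za X tau h w) - Qfun th' (za X tau h w))
  (fun tau => noise M X h tau V w) I (Num.sqrt (beta k n)) I0.
move=> /(_ _ _ _) err; apply: le_trans (err _ _ _) _ => {err}.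
- move=> t tk /eqP rn; rewrite /noise /bellman next_valueE -/V /Qfun rn; ring.
- by move=> t _; rewrite distrC.
- exact: conf.
rewrite /sqrt_alpha invr1 mul1r.
by rewrite lerD // Bnorm.
Qed.

(** Feasibility with [hat] and [xi] eliminated, both being determined by [bar]. *)
Definition well_estimated k (th : param L) :=
  forall h (n : 'I_(nreg L h)), (h < H)%N -> Bset L n (th h n) /\
    wnorm (gram 1 X k n w) (th h n - least_squares M 1 X k n th w)
      <= sqrt_alpha I 1 X beta k n w.

Lemma feasibleP k bar :
  (exists hat xi, feasible M I 1 X beta k w hat xi bar) <-> well_estimated k bar.
Proof.
split=> [[hat [xi F]] h n hH|W].
  have [B e1 e2 e3] := F h n hH; split=> //.
  by rewrite -e3 e1 addrC addKr.
exists (fun h n => least_squares M 1 X k n bar w).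
exists (fun h n => bar h n - least_squares M 1 X k n bar w) => h n hH.
by have [B le] := W h n hH; split=> //; rewrite addrCA subrr addr0.
Qed.

Lemma bellman_consistent_well_estimated k (th : param L) : (k < K)%N ->
  (forall h, (h < H)%N -> bellman_consistent M I th h) -> well_estimated k th.
Proof.
move=> kK C h n hH; have [Bh Eh] := C h hH; split=> //.
apply: least_squares_error => // hS; exact: (C _ hS).1.
Qed.

Lemma eq_least_squares k h (n : 'I_(nreg L h)) (th th' : param L) :
  (forall h', (h' < H)%N -> th h' = th' h') ->
  least_squares M 1 X k n th w = least_squares M 1 X k n th' w.
Proof.
move=> e; rewrite /least_squares; congr (_ *m _); apply: eq_bigr => t _.
rewrite /next_value; congr ((_ + _) *: _); rewrite -/H.
by case: ifP => // hS; rewrite e.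
Qed.

(** Extreme value theorem: the constraints are closed in a compact product, the objective is
    continuous, and a Bellman-consistent parameter shows that the set is nonempty. *)
Lemma solution_exists k : (k < K)%N ->
  exists bar, is_solution M I 1 X beta k w bar.
Proof.
move=> kK; have [_ _ cB _] := LL.
pose J := {h : nat & 'I_(nreg L h)}.
pose T : topologicalType := prod_topology (fun p : J => 'cV[R]_(fdim L (tag p))).
pose th (f : T) : param L := fun h n => f (Tagged (fun h => 'I_(nreg L h)) n).
(* Beyond the horizon nothing is assumed about [Bset]; those coordinates are frozen at 0 to keep the
   product compact. *)
pose Bs (p : J) : set 'cV[R]_(fdim L (tag p)) :=
  if (tag p < H)%N then Bset L (tagged p) else [set 0].
pose C : set T := [set f | forall p, Bs p (f p)].
have cC : compact C.
  apply: (tychonoff (A := Bs)) => p; rewrite /Bs; case: ifP => hH; last exact: compact_set1.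
  exact: cB.
pose D (p : J) : set T := if (tag p < H)%N then
  [set f | wnorm (gram 1 X k (tagged p) w)
    (th f (tag p) (tagged p) - least_squares M 1 X k (tagged p) (th f) w)
      <= sqrt_alpha I 1 X beta k (tagged p) w] else setT.
have cth h (n : 'I_(nreg L h)) : coord_cont (fun f : T => th f h n).
  move=> i f.
  apply: (@continuous_comp _ _ _ (fun f : T => f (Tagged (fun h => 'I_(nreg L h)) n))
    (fun v : 'cV[R]_(fdim L h) => v i 0)); last exact: coord_continuous.
  exact: proj_continuous.
have cV h s : (h < H)%N -> continuous (fun f : T => supA (Qfun (th f h)) s).
  by move=> hH; apply: (cont_supA_Qfun (l := l)) => // z; exact: phil.
have clD p : closed (D p).
  rewrite /D; case: ifP => hH; last exact: closedT.
  apply: closed_sublevel; apply: cont_wnorm; apply: coord_contB; first exact: cth.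
  apply: coord_cont_mulmx; apply: coord_cont_sum => tau.
  apply: cont_addl; rewrite /next_value.
  case hS : ((tag p).+1 < horizon M)%N; last exact: cst_continuous.
  exact: cV.
have cCD : compact (C `&` \bigcap_p D p).
  by apply: compact_closedI => //; apply: closed_bigI => p _; exact: clD.
(* Only the first [H] steps matter, so every feasible parameter has a representative in the compact
   set, and a maximum there is global. *)
have restr (bar : param L) : well_estimated k bar -> exists2 f : T,
    (C `&` \bigcap_p D p) f & forall h, (h < H)%N -> th f h = bar h.
  move=> W.
  pose f : T := fun p => if (tag p < H)%N then bar (tag p) (tagged p) else 0.
  have e h : (h < H)%N -> th f h = bar h.
    by move=> hH; apply/funext => n; rewrite /th /f /= hH.
  exists f => //; split.
    move=> [h n]; rewrite /Bs /f /=; case: ifP => // hH; exact: (W h n hH).1.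
  move=> [h n] _; rewrite /D /=; case: ifP => // hH.
  by rewrite /= e // (eq_least_squares k n e); exact: (W h n hH).2.
have estim f : (C `&` \bigcap_p D p) f -> well_estimated k (th f).
  move=> [Cf Df] h n hH.
  have := Cf (Tagged (fun h => 'I_(nreg L h)) n); rewrite /Bs /= hH => Bf.
  by have := Df (Tagged (fun h => 'I_(nreg L h)) n) Logic.I; rewrite /D /= hH.
have [th0 /(bellman_consistent_well_estimated kK) W0] := bellman_consistent_exists LL.
have ne : (C `&` \bigcap_p D p) !=set0 by have [f ? _] := restr _ W0; exists f.
have [c cin cmax] := compact_EVT_max ne cCD
  (continuous_subspaceT (cV 0%N (st X k 0 w) H0)).
exists (th c); split; first by apply/feasibleP/estim/set_mem.
move=> hat xi bar F; have Wb : well_estimated k bar by apply/feasibleP; exists hat, xi.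
have [f CDf ef] := restr _ Wb.
by have := cmax f (mem_set CDf); rewrite /objective ef.
Qed.

(** The parameter [th h] is compared with the best approximation [th'] of the Bellman image of
    [th h.+1]. Both lie within [sqrt_alpha] of the same least-squares estimate, whence the factor 2;
    the extra [I] is the error of [th']. *)
Lemma well_estimated_bellman k (th : param L) h z : (k < K)%N -> (h < H)%N ->
  well_estimated k th ->
  Qfun (th h) z <= bellman M h (Qnext M th h.+1) z
    + (I + 2 * sqrt_alpha I 1 X beta k (rho L h z) w
           * wnorm (invmx (gram 1 X k (rho L h z) w)) (phi L h z)).
Proof.
move=> kK hH W; set n := rho L h z.
have Bth h' m : (h' < H)%N -> Bset L m (th h' m) by move=> hH'; exact: (W h' m hH').1.
have Q0 : Qclass L H h.+1 (Qnext M th h.+1).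
  by apply: Qnext_class => hS m; exact: Bth.
have [th' [Bth' E]] := bellman_approx LL hH Q0.
have pG := posdef_gram k n.
have d1 : wnorm (gram 1 X k n w) (th h n - th' n) <= 2 * sqrt_alpha I 1 X beta k n w.
  rewrite -(subrK (least_squares M 1 X k n th w) (th h n)) -addrA.
  apply: le_trans (wnormD pG _ _) _.
  rewrite mulr_natl mulr2n; apply: lerD; first exact: (W h n hH).2.
  rewrite -opprB wnormN; apply: least_squares_error => // hS m; exact: Bth.
have d2 : Qfun (th h) z - Qfun th' z <= 2 * sqrt_alpha I 1 X beta k n w
    * wnorm (invmx (gram 1 X k n w)) (phi L h z).
  rewrite QfunB; apply: le_trans (ler_norm _) _.
  rewrite mulrC; apply: le_trans (dotp_dual pG _ _) _.
  by rewrite ler_wpM2l // wnorm_ge0.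
by have := E z; rewrite ler_norml => /andP[]; lra.
Qed.

End Solutions.


(** * Bonuses *)

Section MeasurableMatrices.
Context {R : realType} {d : measure_display} {T : measurableType d}.

Lemma measurable_sqrt_comp (f : T -> R) : measurable_fun setT f ->
  measurable_fun setT (fun t => Num.sqrt (f t)).
Proof.
move=> mf; apply: measurableT_comp mf.
by apply: continuous_measurable_fun; exact: sqrt_continuous.
Qed.

Lemma measurable_invr_pos (f : T -> R) : (forall t, 0 < f t) ->
  measurable_fun setT f -> measurable_fun setT (fun t => (f t)^-1).
Proof.
move=> f0 mf; rewrite (_ : (fun t => _) = (fun t => expR (- ln (f t)))).
  apply: measurableT_comp => //; apply: measurable_funN.
  exact: measurableT_comp (@measurable_ln R) mf.
by apply/funext => t; rewrite expRN lnK // posrE.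
Qed.

Lemma measurable_det m (F : T -> 'M[R]_m) :
  (forall i j, measurable_fun setT (fun t => F t i j)) ->
  measurable_fun setT (fun t => \det (F t)).
Proof.
move=> mF; rewrite /determinant; apply: measurable_sum => s.
apply: measurable_funM; first exact: measurable_cst.
by apply: measurable_prod => i _; exact: mF.
Qed.

(** Cramer's formula: the entries are quotients of determinants, themselves polynomial in the matrix
    entries. *)
Lemma measurable_invmx m (F : T -> 'M[R]_m) : (forall t, posdef (F t)) ->
  (forall t, 0 < \det (F t)) ->
  (forall i j, measurable_fun setT (fun t => F t i j)) ->
  forall i j, measurable_fun setT (fun t => invmx (F t) i j).
Proof.
move=> pF dF mF i j.
rewrite (_ : (fun t => _) =
    (fun t => (\det (F t))^-1 * ((-1) ^+ (j + i) * \det (row' j (col' i (F t)))))).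
  apply: measurable_funM; first exact/measurable_invr_pos/measurable_det.
  apply: measurable_funM; first exact: measurable_cst.
  apply: measurable_det => i' j'.
  under eq_fun do rewrite !mxE.
  exact: mF.
apply/funext => t; rewrite /invmx posdef_unit // !mxE /cofactor.
by [].
Qed.

Lemma measurable_wnorm m (F : T -> 'M[R]_m) (v : T -> 'cV[R]_m) :
  (forall i j, measurable_fun setT (fun t => F t i j)) ->
  (forall i, measurable_fun setT (fun t => v t i 0)) ->
  measurable_fun setT (fun t => wnorm (F t) (v t)).
Proof.
move=> mF mv; apply: measurable_sqrt_comp.
under eq_fun do rewrite mxE.
apply: measurable_sum => j; apply: measurable_funM; last exact: mv.
under eq_fun do rewrite mxE.
apply: measurable_sum => i; apply: measurable_funM; last exact: mF.
under eq_fun do rewrite mxE.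
exact: mv.
Qed.

Lemma measurable_index_if N (r : T -> 'I_N) (n : 'I_N) (f g : T -> R) :
  measurable (r @^-1` [set n]) -> measurable_fun setT f -> measurable_fun setT g ->
  measurable_fun setT (fun t => if r t == n then f t else g t).
Proof.
move=> mr mf mg; apply: measurable_fun_ifT => //.
apply: (measurable_fun_bool true); rewrite setTI.
by congr (measurable _): mr; apply/seteqP; split=> t /= /eqP.
Qed.

Lemma measurable_index N (r : T -> 'I_N) (g : 'I_N -> T -> R) :
  (forall n, measurable (r @^-1` [set n])) -> (forall n, measurable_fun setT (g n)) ->
  measurable_fun setT (fun t => g (r t) t).
Proof.
move=> mr mg.
rewrite (_ : (fun t => _) = (fun t => \sum_n (if r t == n then g n t else 0))).
  apply: measurable_sum => n; apply: measurable_index_if => //.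
apply/funext => t; rewrite -big_mkcond /= (big_pred1 (r t)) //.
Qed.

End MeasurableMatrices.

(** * Measurability of the bonuses with respect to the past *)

Section BonusMeasurable.
Context {R : realType} {dS dA dO : measure_display}.
Context {S : measurableType dS} {A : measurableType dA} {Omega : measurableType dO}.
Variables (P : probability Omega R) (M : mdp R S A) (L : features R S A) (I : R).
Variables (K : nat) (X : process R S A Omega).
Variable beta : nat -> forall h, 'I_(nreg L h) -> R.
Let H := horizon M.
Hypothesis intX : mdp_interaction P M K X.
Hypothesis LL : locally_linearizable M L I.

Local Notation FT k := (g_sigma_algebraType (filt X k 0)).

Lemma measurable_Qfun h (th : 'I_(nreg L h) -> 'cV[R]_(fdim L h)) : (h < H)%N ->
  measurable_fun setT (Qfun th : S * A -> R).
Proof.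
move=> hH; have [_ /(_ h hH)[mphi mrho _] _ _] := LL.
apply: (measurable_index (g := fun n z => dotp (phi L h z) (th n))) => // n.
under eq_fun do rewrite dotp_sum.
by apply: measurable_sum => i; apply: measurable_funM.
Qed.

Lemma measurable_past_za k tau h : (k < K)%N -> (tau < k)%N -> (h < H)%N ->
  measurable_fun setT (za X tau h : FT k -> S * A).
Proof.
move=> kK tk hH; have tK := ltn_trans tk kK.
apply: (measurableT_comp (measurable_za intX tK hH)).
apply: measurable_id_sub.
- exact: (filtA_sigma intX tK (ltnW hH)).1.
- exact: (filt_sigma intX kK (leq0n _)).1.
apply: subset_trans (int_mono intX tK hH).2 _.
have := @filt_mono_step _ _ _ _ _ _ _ _ _ _ _ intX tau h.+1 (H - h.+1) tK.
rewrite subnKC // => /(_ (leqnn _))/subset_trans; apply.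
apply: subset_trans (int_next intX (leq_ltn_trans tk kK)) _.
have := @filt_mono_episode _ _ _ _ _ _ _ _ _ _ _ intX tau.+1 (k - tau.+1).
by rewrite subnKC //; apply.
Qed.

(** The excess over the Bellman image allowed to feasible parameters. It depends on the past through
    the visited state-action pairs alone, not through the computed parameter. *)
Definition bonus k h (w : Omega) (z : S * A) : R :=
  I + 2 * sqrt_alpha I 1 X beta k (rho L h z) w
      * wnorm (invmx (gram 1 X k (rho L h z) w)) (phi L h z).

Lemma measurable_past_sum k h (n : 'I_(nreg L h)) (f : S * A -> R) :
  (k < K)%N -> (h < H)%N -> measurable_fun setT f ->
  measurable_fun setT ((fun w => \sum_(tau < k | rho L h (za X tau h w) == n)
    f (za X tau h w)) : FT k -> R).
Proof.
move=> kK hH mf; have [_ /(_ h hH)[_ mrho _] _ _] := LL.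
under eq_fun do rewrite big_mkcond /=.
apply: measurable_sum => tau.
have mg : measurable_fun setT (fun z => if rho L h z == n then f z else 0).
  by apply: measurable_index_if.
exact: (measurableT_comp mg (measurable_past_za kK (ltn_ord tau) hH)).
Qed.

Lemma measurable_gram k h (n : 'I_(nreg L h)) i j : (k < K)%N -> (h < H)%N ->
  measurable_fun setT ((fun w => gram 1 X k n w i j) : FT k -> R).
Proof.
move=> kK hH; have [_ /(_ h hH)[mphi _ _] _ _] := LL.
under eq_fun do rewrite mxE summxE.
apply: measurable_funD; first exact: measurable_cst.
under eq_fun do under eq_bigr do rewrite mxE big_ord1 mxE.
exact: (measurable_past_sum n kK hH (measurable_funM (mphi i) (mphi j))).
Qed.

Lemma measurable_visits k h (n : 'I_(nreg L h)) : (k < K)%N -> (h < H)%N ->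
  measurable_fun setT ((fun w => (visits X k n w)%:R) : FT k -> R).
Proof.
move=> kK hH; rewrite /visits; under eq_fun do rewrite natr_sum.
exact: (measurable_past_sum n kK hH (measurable_cst (1%:R : R))).
Qed.

Lemma measurable_bonus k h : (k < K)%N -> (h < H)%N ->
  measurable_fun setT ((fun x => bonus k h x.1 x.2) : FT k * (S * A) -> R).
Proof.
move=> kK hH; have [_ /(_ h hH)[mphi mrho _] _ _] := LL.
have msnd := @measurable_snd _ _ (FT k) (S * A)%type.
have mfst := @measurable_fst _ _ (FT k) (S * A)%type.
apply: (measurable_index (r := fun x : FT k * (S * A) => rho L h x.2)
  (g := fun n (x : FT k * (S * A)) => I + 2 * sqrt_alpha I 1 X beta k n x.1
      * wnorm (invmx (gram 1 X k n x.1)) (phi L h x.2))) => n.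
  by have := msnd measurableT _ (mrho n); rewrite setTI.
apply: measurable_funD; first exact: measurable_cst.
apply: measurable_funM.
  apply: measurable_funM; first exact: measurable_cst.
  suff ms : measurable_fun setT (sqrt_alpha I 1 X beta k n : FT k -> R).
    exact: (measurableT_comp ms mfst).
  apply: measurable_funD; last exact: measurable_cst.
  apply: measurable_funD; first exact: measurable_cst.
  apply: measurable_funM; last exact: measurable_cst.
  by apply: measurable_sqrt_comp; exact: measurable_visits.
apply: measurable_wnorm => [i j|i]; last exact: (measurableT_comp (mphi i) msnd).
suff mi : measurable_fun setT ((fun w => invmx (gram 1 X k n w) i j) : FT k -> R).
  exact: (measurableT_comp mi mfst).
apply: measurable_invmx => [w|w|i' j'].
- exact: posdef_gram.
- by rewrite gram_design; exact: (ln_det_design _ _ _).1.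
- exact: measurable_gram.
Qed.

End BonusMeasurable.


(** * Summing the bonuses along the observed trajectories *)

Section BonusSum.
Context {R : realType} {dS dA dO : measure_display}.
Context {S : measurableType dS} {A : measurableType dA} {Omega : measurableType dO}.
Variables (L : features R S A) (I l : R).
Variables (K : nat) (X : process R S A Omega).
Variable beta : nat -> forall h, 'I_(nreg L h) -> R.
Hypotheses (I0 : 0 <= I) (l0 : 0 <= l).

Lemma visits_mono k j h (n : 'I_(nreg L h)) w : (k <= j)%N ->
  (visits X k n w <= visits X j n w)%N.
Proof.
move=> /subnKC <-; elim: (j - k)%N => [|i IH]; first by rewrite addn0.
apply: leq_trans IH _; rewrite addnS /visits [X in (_ <= X)%N]big_mkcond big_ord_recr.
by rewrite -big_mkcond leq_addr.
Qed.

Lemma sum_visits h w : (\sum_n visits X K (h := h) (L := L) n w)%N = K.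
Proof.
rewrite /visits -[RHS]card_ord -sum1_card.
by rewrite (partition_big (fun tau : 'I_K => rho L h (za X tau h w)) predT).
Qed.

Definition potential_bound h : R :=
  (1 + l ^+ 2) * ((fdim L h)%:R * (ln (fdim L h)%:R + ln (1 + K%:R * l ^+ 2))).

Lemma potential_bound_ge0 h : (0 < fdim L h)%N -> 0 <= potential_bound h.
Proof.
move=> d0; rewrite /potential_bound mulr_ge0 ?addr_ge0 ?sqr_ge0 // mulr_ge0 //.
by rewrite addr_ge0 ?ln_ge0 ?ler1n // lerDl mulr_ge0 ?sqr_ge0.
Qed.

Lemma sum_sqrt_le (J : finType) (p : J -> R) : (forall j, 0 <= p j) ->
  \sum_j Num.sqrt (p j) <= Num.sqrt (#|J|%:R * \sum_j p j).
Proof.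
move=> p0; rewrite -(@ler_pXn2r _ 2) ?nnegrE ?sqrtr_ge0 ?sumr_ge0 //.
apply: le_trans (sqr_sum_le _ _) _.
rewrite sqr_sqrtr ?mulr_ge0 ?sumr_ge0 // sumr_const -[_ *+ _]/(_%:R).
by under eq_bigr do rewrite sqr_sqrtr //.
Qed.

(** Cauchy-Schwarz and the potential are applied region by region. The statistical part then sums
    sqrt(p_n) over regions, which costs sqrt(N K); the misspecification part sums p_n itself, that
    is [K], and so carries no factor from the number of regions. *)
Lemma sum_bonus_le h w (sb r : R) : (0 < fdim L h)%N ->
  (forall z, enorm (phi L h z) <= l) ->
  (forall k (n : 'I_(nreg L h)), (k < K)%N -> Num.sqrt (beta k n) <= sb) ->
  (forall n : 'I_(nreg L h), Rdiam n <= r) -> 0 <= sb -> 0 <= r ->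
  \sum_(k < K) bonus I X beta k h w (za X k h w) <= K%:R * I
    + 2 * ((sb + r) * Num.sqrt (potential_bound h * ((nreg L h)%:R * K%:R))
           + I * K%:R * Num.sqrt (potential_bound h)).
Proof.
move=> d0 phil bsb Rr sb0 r0.
have G0 := potential_bound_ge0 d0; set G := potential_bound h in G0 *.
pose a (n : 'I_(nreg L h)) (k : nat) :=
  wnorm (invmx (gram 1 X k n w)) (phi L h (za X k h w)).
pose p n : R := (visits X K (h := h) (L := L) n w)%:R.
have suma n : \sum_(k < K | rho L h (za X k h w) == n) a n k
    <= Num.sqrt (p n) * Num.sqrt G.
  rewrite -(@ler_pXn2r _ 2) ?nnegrE ?mulr_ge0 ?sqrtr_ge0 ?sumr_ge0 // => [|*]; last exact: wnorm_ge0.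
  rewrite exprMn !sqr_sqrtr // /p.
  apply: le_trans (sqr_sum_le _ _) _.
  rewrite /visits natr_sum ler_wpM2l ?sumr_ge0 //.
  exact: (elliptical_potential (rho_is X w n) K d0 l0 (fun t => phil (za X t h w))).
rewrite big_split /= sumr_const card_ord -[X in X + _ <= _]mulr_natl lerD2l.
under eq_bigr do rewrite -mulrA.
rewrite -mulr_sumr ler_pM2l //.
rewrite (partition_big (fun k : 'I_K => rho L h (za X k h w)) predT) //=.
apply: (@le_trans _ _ (\sum_n (sb + r + Num.sqrt (p n) * I)
    * (Num.sqrt (p n) * Num.sqrt G))).
  apply: ler_sum => n _; apply: le_trans (ler_wpM2l _ (suma n)); last first.
    by rewrite !addr_ge0 // mulr_ge0 ?sqrtr_ge0.
  rewrite mulr_sumr; apply: ler_sum => k /eqP kn; rewrite kn.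
  rewrite ler_wpM2r ?wnorm_ge0 // /sqrt_alpha invr1 mul1r.
  have := bsb k n (ltn_ord k); have := Rr n.
  have : Num.sqrt (visits X k n w)%:R * I <= Num.sqrt (p n) * I.
    by rewrite ler_wpM2r // ler_sqrt // ler_nat visits_mono // ltnW.
  lra.
have -> : \sum_n (sb + r + Num.sqrt (p n) * I) * (Num.sqrt (p n) * Num.sqrt G)
    = (sb + r) * (Num.sqrt G * \sum_n Num.sqrt (p n)) + I * (\sum_n p n) * Num.sqrt G.
  rewrite !mulr_sumr mulr_suml -big_split /=; apply: eq_bigr => n _.
  have pq : p n = Num.sqrt (p n) ^+ 2 by rewrite sqr_sqrtr.
  rewrite [X in I * X]pq; ring.
have pK : \sum_n p n = K%:R by rewrite -natr_sum sum_visits.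
rewrite pK lerD2r; apply: ler_wpM2l; first exact: addr_ge0.
rewrite (sqrtrM _ G0) ler_wpM2l ?sqrtr_ge0 //.
have := sum_sqrt_le (p := p) (fun n => ler0n _ _).
by rewrite pK card_ord.
Qed.

End BonusSum.


(** * Regret *)

Section PathwiseRegret.
Context {R : realType} {dS dA dO : measure_display}.
Context {S : measurableType dS} {A : measurableType dA} {Omega : measurableType dO}.
Variables (P : probability Omega R) (M : mdp R S A) (L : features R S A) (I l : R).
Variables (K : nat) (X : process R S A Omega).
Variable beta : nat -> forall h, 'I_(nreg L h) -> R.
Variable thbar : nat -> Omega -> param L.
Let H := horizon M.
Hypothesis H0 : (0 < H)%N.
Hypothesis normM : normalized M.
Hypothesis LL : locally_linearizable M L I.
Hypothesis l0 : 0 <= l.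
Hypothesis phil : forall h z, (h < H)%N -> enorm (phi L h z) <= l.
Hypothesis Bnorm : forall h (n : 'I_(nreg L h)) th, (h < H)%N -> Bset L n th ->
  enorm th <= Rdiam n.
Variable r : nat -> R.
Hypothesis Rr : forall h (n : 'I_(nreg L h)), (h < H)%N -> Rdiam n <= r h.
Hypothesis intX : mdp_interaction P M K X.
Hypothesis run : cinderella_run M I 1 X beta K thbar.
Variable cap : nat -> R.
Hypothesis capE : forall h, (h < H)%N -> l * r h <= cap h.
Hypothesis cap0 : forall h, 0 <= cap h.

Lemma Rdiam_ge0 h (n : 'I_(nreg L h)) : (h < H)%N -> 0 <= Rdiam n.
Proof.
move=> hH; have [th /(_ h hH)[B _]] := bellman_consistent_exists LL.
exact: le_trans (enorm_ge0 _) (Bnorm hH (B n)).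
Qed.

Lemma bonus_ge0 k h w z : (h < H)%N -> 0 <= bonus I X beta k h w z.
Proof.
move=> hH; have I0 := I_ge0 LL H0.
rewrite /bonus addr_ge0 // mulr_ge0 ?wnorm_ge0 // mulr_ge0 //.
by rewrite /sqrt_alpha !addr_ge0 ?mulr_ge0 ?sqrtr_ge0 ?invr_ge0 ?ler01 ?Rdiam_ge0.
Qed.

Lemma Qnext_norm_le (th : param L) h z :
  (forall h, (h < H)%N -> forall n, Bset L n (th h n)) ->
  (h < H)%N -> `|Qnext M th h z| <= l * r h.
Proof.
move=> B hH; rewrite /Qnext -/H hH; apply: Qfun_le => //; first exact: phil.
exact: le_trans (Bnorm hH (B h hH _)) (Rr _ hH).
Qed.

Lemma Qnext_bounded (th : param L) h :
  (forall h, (h < H)%N -> forall n, Bset L n (th h n)) ->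
  exists b, forall z, `|Qnext M th h z| <= b.
Proof.
move=> B; have [hH|Hh] := ltnP h H; first by exists (l * r h) => z; exact: Qnext_norm_le.
by exists 0 => z; rewrite /Qnext -/H ltnNge Hh normr0.
Qed.

Lemma measurable_supA_Qnext (th : param L) h :
  (forall h, (h < H)%N -> forall n, Bset L n (th h n)) ->
  measurable_fun setT (supA (Qnext M th h)).
Proof.
move=> B; have [hH|Hh] := ltnP h H.
  have [_ /(_ h hH)[_ _ mV] _ _] := LL; apply: mV.
  by exists (Qnext M th h) => //; apply: Qnext_class => // _; exact: B.
rewrite /Qnext -/H ltnNge Hh /=.
by rewrite (_ : supA _ = fun=> 0) //; apply/funext => s; rewrite supA_cst.
Qed.

Lemma QnextH (th : param L) z : Qnext M th H z = 0.
Proof. by rewrite /Qnext -/H ltnn. Qed.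

(** Optimism compares the optimal value with a Bellman-consistent parameter, up to [H * I], and that
    parameter, being feasible, with the computed one. The greedy gap bound is then used with [D]
    equal to the capped gap. *)
Lemma episode_regret_le k w : (k < K)%N -> confidence_event M 1 X beta K w ->
  Vstar M 0 (st X k 0 w) - Vpi M (pol X k w) 0 (st X k 0 w)
  <= H%:R * I + state_gap M X (bonus I X beta) cap k 0 w (st X k 0 w).
Proof.
move=> kK conf; have I0 := I_ge0 LL H0.
have [[F opt] gr _] := run.2 k w kK (solution_exists LL l0 phil Bnorm H0 conf kK).
have W := (feasibleP _ _ _ _ _ _ _).1 F.
have [th C] := bellman_consistent_exists LL.
have Bth h : (h < H)%N -> forall n, Bset L n (th h n) by move=> hH; exact: (C h hH).1.
have Bbar h : (h < H)%N -> forall n, Bset L n (@thbar k w h n).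
  by move=> hH n; exact: (W h n hH).1.
set s := st X k 0 w.
have V1 : Vstar M 0 s <= supA (Qnext M th 0) s + H%:R * I.
  apply: (Vstar_le_of_bellman normM) => //.
  - by move=> h; exact: Qnext_bounded.
  - by move=> h _; exact: measurable_supA_Qnext.
  - exact: QnextH.
  - exact: pol X k w.
  - move=> h z hH; have := (C h hH).2 z.
    have -> : Qnext M th h z = Qfun (th h) z by rewrite /Qnext -/H hH.
    by rewrite ler_norml => /andP[]; lra.
have V2 : supA (Qnext M th 0) s <= supA (Qnext M (thbar k w) 0) s.
  rewrite /Qnext -/H H0.
  have /feasibleP [hat [xi Fth]] := bellman_consistent_well_estimated LL Bnorm H0 conf kK C.
  exact: opt Fth.
suff : supA (Qnext M (thbar k w) 0) s - Vpi M (pol X k w) 0 s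
    <= state_gap M X (bonus I X beta) cap k 0 w s by lra.
have bge k' h w' z : (k' < K)%N -> (h < H)%N -> 0 <= bonus I X beta k' h w' z.
  by move=> _; exact: bonus_ge0.
have mb k' h : (k' < K)%N -> (h < H)%N -> measurable_fun setT
    ((fun x => bonus I X beta k' h x.1 x.2) : g_sigma_algebraType (filt X k' 0) * (S * A) -> R).
  by move=> kK' hH; exact: (measurable_bonus beta intX LL kK' hH).
rewrite /state_gap -/H H0.
apply: (@value_gap_le_mean_D _ _ _ _ _ M normM (Qnext M (thbar k w)) _ _ _
  (pol X k w) (fun h => bonus I X beta k h w) (fun h _ => cap h)
  (fun h => gap M X (bonus I X beta) cap k h w)) => //.
- by move=> h; exact: Qnext_bounded.
- by move=> h _; exact: measurable_supA_Qnext.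
- exact: QnextH.
- by move=> h hH; rewrite /Qnext -/H hH; exact: (measurable_Qfun LL).
- by move=> h s' hH; rewrite /Qnext -/H hH; exact: gr.
- by move=> h hH; exact: (bmeasurable_gap_section intX bge cap0 mb).
- by move=> h z hH; exact: gapE.
- move=> h z hH.
  have -> : Qnext M (thbar k w) h z = Qfun (@thbar k w h) z by rewrite /Qnext -/H hH.
  exact: (well_estimated_bellman LL Bnorm H0 conf).
(* Policy values are nonnegative, so the gap never exceeds the size of the optimistic value. *)
- move=> h z hH; apply: le_trans (capE hH).
  have := Qnext_norm_le z Bbar hH; have /andP[q0 _] := normM.2 (pol X k w) h z hH.
  by move=> /(le_trans (ler_norm _)); lra.
Qed.

Lemma regret_le w : confidence_event M 1 X beta K w ->
  regret M X K w <= K%:R * (H%:R * I)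
    + \sum_(h < H) \sum_(k < K) bonus I X beta k h w (za X k h w)
    + \sum_(k < K) \sum_(h < H) (action_noise M X (bonus I X beta) cap k h w
                                 + state_noise M X (bonus I X beta) cap k h w).
Proof.
move=> conf; rewrite exchange_big /= -[K in K%:R]card_ord mulr_natl -sumr_const.
rewrite -!big_split /=; apply: ler_sum => k _.
apply: le_trans (episode_regret_le (ltn_ord k) conf) _.
rewrite -addrA lerD2l.
exact: (state_gap_telescope M X _ cap w (ltn_ord k)).
Qed.

End PathwiseRegret.


(** * Constants and logarithmic factors *)

Section SoftO.
Context {R : realType} {dS dA : measure_display}.
Context {S : measurableType dS} {A : measurableType dA}.

Lemma sqrt_mul_le (x y z : R) : 0 <= x -> 0 <= y -> 0 <= z -> x * y <= z ^+ 2 ->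
  Num.sqrt x * Num.sqrt y <= z.
Proof.
move=> x0 y0 z0 xy; rewrite -sqrtrM //.
by rewrite -(ger0_norm z0) -sqrtr_sqr ler_wsqrtr.
Qed.

Lemma sqrt_nat_le (n : nat) : Num.sqrt (n%:R : R) <= n%:R.
Proof.
rewrite -[leLHS]mulr1 -[X in _ * X]sqrtr1; apply: sqrt_mul_le => //.
by rewrite mulr1 -natrX ler_nat; case: n => // n; rewrite expnS expn1 leq_pmulr.
Qed.

Variables (L : features R S A) (H K : nat) (delta l c : R).
Hypotheses (H0 : (0 < H)%N) (K0 : (0 < K)%N) (delta01 : 0 < delta < 1).
Hypothesis dpos : forall h, (h < H)%N -> (0 < fdim L h)%N.
Hypothesis LphiL : (Lphi L H <= l%:E)%E.
Hypothesis c0 : 0 <= c.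
Hypothesis Rc : forall h (n : 'I_(nreg L h)), (h < H)%N ->
  Rdiam n <= c * Num.sqrt (fdim L h)%:R.
Hypothesis Bnorm : forall h (n : 'I_(nreg L h)) th, (h < H)%N -> Bset L n th ->
  enorm th <= Rdiam n.

Let ell := logfac L H K delta.
Let x h : R := (nreg L h * fdim L h)%:R.
(** Complexity of the next value class, which is trivial at the horizon. *)
Let x' h : R := if (h < H)%N then x h else 0.

Lemma l_ge0 : 0 <= l.
Proof. exact: le_trans (enorm_ge0 _) (Lphi_le LphiL point H0). Qed.

Lemma nreg_gt0 h : (0 < nreg L h)%N.
Proof. exact: leq_ltn_trans (leq0n _) (ltn_ord (rho L h point)). Qed.

Lemma fdim_le_x h : ((fdim L h)%:R : R) <= x h.
Proof. by rewrite ler_nat leq_pmull // nreg_gt0. Qed.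

Lemma nreg_le_x h : (h < H)%N -> ((nreg L h)%:R : R) <= x h.
Proof. by move=> hH; rewrite ler_nat leq_pmulr // dpos. Qed.

Lemma x_ge1 h : (h < H)%N -> 1 <= x h.
Proof. by move=> hH; rewrite ler1n muln_gt0 nreg_gt0 dpos. Qed.

Lemma x_ge0 h : 0 <= x h.
Proof. exact: ler0n. Qed.

Lemma x_le_sum h : (h < H)%N -> x h <= \sum_(h < H) x h.
Proof.
move=> hH; rewrite (bigD1 (Ordinal hH)) //= lerDl sumr_ge0 // => i _; exact: x_ge0.
Qed.

Lemma sum_x_ge1 : 1 <= \sum_(h < H) x h.
Proof. exact: le_trans (x_ge1 H0) (x_le_sum H0). Qed.

(** Every summand of [logfac] is nonnegative, so each logarithm is bounded by the summands it
    involves; those of [nreg] and [fdim] are at most the logarithm of their summed products. *)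
Lemma logfac_ge :
  [/\ 1 + ln delta^-1 <= ell, ln K%:R <= ell &
      forall h, (h < H)%N -> ln (fdim L h)%:R <= ell
        /\ ln ((nreg L h * H * K)%:R / delta) <= ell].
Proof.
have /andP[d0 d1] := delta01.
have tK : 0 <= ln K%:R :> R by rewrite ln_ge0 // ler1n.
have tH : 0 <= ln H%:R :> R by rewrite ln_ge0 // ler1n.
have td : 0 <= ln delta^-1 by rewrite ln_ge0 // invf_ge1 // ltW.
have tp : 0 <= ln (1 + fine (Lphi L H)).
  rewrite ln_ge0 // lerDl fine_ge0 //.
  apply: le_trans (_ : (0 <= (enorm (phi L 0 point))%:E)%E) _; first by rewrite lee_fin enorm_ge0.
  by apply: ereal_sup_ubound; exists 0%N, point.
have ts : 0 <= ln (\sum_(h < H) x h) by rewrite ln_ge0 // sum_x_ge1.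
have lnle h (n : nat) : (h < H)%N -> (0 < n)%N -> (n%:R : R) <= x h ->
    ln n%:R <= ln (\sum_(h < H) x h).
  move=> hH n0 nx; rewrite ler_ln ?posrE ?ltr0n //.
    exact: le_trans nx (x_le_sum hH).
  exact: lt_le_trans ltr01 sum_x_ge1.
have E : ell = 1 + ln K%:R + ln H%:R + ln delta^-1 + ln (1 + fine (Lphi L H))
    + ln (\sum_(h < H) x h) by [].
split; [lra|lra|move=> h hH; split].
  have := lnle h _ hH (dpos hH) (fdim_le_x h); lra.
have N0 := nreg_gt0 h.
rewrite lnM ?posrE ?invr_gt0 ?ltr0n ?muln_gt0 ?N0 ?H0 //.
rewrite natrM lnM ?posrE ?ltr0n ?muln_gt0 ?N0 ?H0 //.
rewrite natrM lnM ?posrE ?ltr0n //.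
have := lnle h _ hH N0 (nreg_le_x hH); lra.
Qed.

Lemma ell_ge1 : 1 <= ell.
Proof.
have [h1 _ _] := logfac_ge; apply: le_trans h1; rewrite lerDl ln_ge0 //.
by have /andP[d0 d1] := delta01; rewrite invf_ge1 // ltW.
Qed.

(** Comes from [ln d + ln (1 + K * l ^+ 2) <= 2 * ell + ln (1 + l ^+ 2)] and [1 <= ell]. *)
Definition pot_const : R := (1 + l ^+ 2) * (2 + ln (1 + l ^+ 2)).

Lemma pot_const_ge0 : 0 <= pot_const.
Proof.
by rewrite mulr_ge0 ?addr_ge0 ?sqr_ge0 // ln_ge0 // lerDl sqr_ge0.
Qed.

Lemma potential_bound_le h : (h < H)%N ->
  potential_bound L l K h <= pot_const * ell * (fdim L h)%:R.
Proof.
move=> hH; rewrite /potential_bound /pot_const -!mulrA.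
rewrite ler_wpM2l ?addr_ge0 ?sqr_ge0 // [leLHS]mulrC mulrA ler_wpM2r //.
have [_ lK /(_ h hH)[ld _]] := logfac_ge.
have l2 : 0 <= ln (1 + l ^+ 2) by rewrite ln_ge0 // lerDl sqr_ge0.
have lp : 0 < 1 + l ^+ 2 by rewrite ltr_pwDl // sqr_ge0.
have : ln (1 + K%:R * l ^+ 2) <= ln K%:R + ln (1 + l ^+ 2).
  rewrite -lnM ?posrE ?ltr0n // ler_ln ?posrE ?mulr_gt0 ?ltr0n //.
    by rewrite mulrDr mulr1 lerD2r ler1n.
  by rewrite ltr_pwDl // mulr_ge0 ?sqr_ge0.
have := ell_ge1; nra.
Qed.

(** Of the 5, three bound [ln (d * d * K)] in the covering number and two are a margin for the
    dimension and confidence terms of the threshold. *)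
Definition cov_const : R := 5 + ln (1 + 2 * c * (l + 1)).

Lemma cov_const_ge5 : 5 <= cov_const.
Proof.
rewrite lerDl ln_ge0 // lerDl !mulr_ge0 // addr_ge0 ?l_ge0 //.
Qed.

Lemma ln_covering_le_softO h k : (h < H)%N -> (k < K)%N ->
  (forall h, (h < H)%N -> exists th : 'I_(nreg L h) -> 'cV[R]_(fdim L h),
     forall n, Bset L n (th n)) ->
  ln (covering_number (Num.sqrt k.+1%:R)^-1 (Vclass L H h.+1))
  <= (cov_const - 2) * ell * x' h.+1.
Proof.
move=> hH kK Bne; have l0 := l_ge0.
have e1 := ell_ge1; have k5 := cov_const_ge5.
rewrite /x'; case: ifP => hS; last first.
  rewrite mulr0; apply: ln_covering_Vclass_last; first by rewrite leqNgt hS.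
  by rewrite invr_ge0 sqrtr_ge0.
have [th Bth] := Bne _ hS.
have sd0 : 0 <= Num.sqrt ((fdim L h.+1)%:R : R) by exact: sqrtr_ge0.
have l1 : 0 < l + 1 by lra.
have sk : 0 < Num.sqrt (k.+1%:R : R) by rewrite sqrtr_gt0 ltr0n.
(* [l + 1] serves as a strictly positive feature bound, [l] being only nonnegative. *)
have := @ln_covering_Vclass _ _ _ _ _ L H h.+1 (l + 1)
  (c * Num.sqrt (fdim L h.+1)%:R) (Num.sqrt k.+1%:R)^-1 th hS (dpos hS) l1.
move=> /(_ (mulr_ge0 c0 sd0)).
rewrite invr_gt0 => /(_ sk) cov; apply: le_trans (cov _ _ Bth) _.
- by move=> z; have := Lphi_le LphiL z hS; lra.
- by move=> n t Bt; exact: le_trans (Bnorm hS Bt) (Rc _ hS).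
rewrite mulrC invrK ler_wpM2r ?x_ge0 //.
set dd : R := (fdim L h.+1)%:R.
have dd1 : 1 <= dd by rewrite ler1n dpos.
have K1 : 1 <= K%:R :> R by rewrite ler1n.
have p : 0 < 1 + 2 * c * (l + 1).
  by rewrite ltr_pwDl // !mulr_ge0 // ltW.
have [_ lK /(_ _ hS)[ld _]] := logfac_ge.
apply: (@le_trans _ _ (ln ((1 + 2 * c * (l + 1)) * (dd * dd * K%:R)))); last first.
  have dp : 0 < dd by lra.
  have Kp : 0 < K%:R :> R by lra.
  rewrite !lnM ?posrE ?mulr_gt0 //.
  have : 0 <= ln (1 + 2 * c * (l + 1)).
    by rewrite ln_ge0 // lerDl !mulr_ge0 // ltW.
  rewrite /cov_const; rewrite -/dd in ld; nra.
have sdd : Num.sqrt dd <= dd by exact: sqrt_nat_le.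
have skK : Num.sqrt (k.+1%:R : R) <= K%:R.
  by apply: le_trans (sqrt_nat_le _) _; rewrite ler_nat.
have sdd0 : 0 <= Num.sqrt dd by exact: sqrtr_ge0.
have a0 : 0 <= 2 * c * (l + 1) by rewrite !mulr_ge0 // ltW.
have le1 : Num.sqrt dd * dd * Num.sqrt k.+1%:R <= dd * dd * K%:R.
  by rewrite ler_pM // ?mulr_ge0 ?(ltW sk) // ?ler_wpM2r //; lra.
have q : 0 <= Num.sqrt dd * dd * Num.sqrt k.+1%:R.
  by rewrite !mulr_ge0 ?(ltW sk) //; lra.
have ddK : 1 <= dd * dd * K%:R by nra.
have -> : 2 * (c * Num.sqrt dd) * dd * (l + 1) * Num.sqrt k.+1%:R
  = 2 * c * (l + 1) * (Num.sqrt dd * dd * Num.sqrt k.+1%:R) by ring.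
rewrite ler_ln ?posrE; first by nra.
  by rewrite ltr_pwDl // mulr_ge0.
by rewrite mulr_gt0 //; lra.
Qed.

Variables (cb : R) (m : nat).

(** The absolute value appears because [cb] is an arbitrary real number. *)
Definition sqrt_beta_bound h : R :=
  `|cb| * ell ^+ m * Num.sqrt (cov_const * ell * (x h + x' h.+1)).

Lemma x'_ge0 h : 0 <= x' h.
Proof. by rewrite /x'; case: ifP. Qed.

Lemma sqrt_beta_le (M : mdp R S A) (beta : nat -> forall h, 'I_(nreg L h) -> R) h k
    (n : 'I_(nreg L h)) : H = horizon M ->
  (h < H)%N -> (k < K)%N -> beta_growth M beta K delta cb m ->
  (forall h, (h < H)%N -> exists th : 'I_(nreg L h) -> 'cV[R]_(fdim L h),
     forall n, Bset L n (th n)) ->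
  Num.sqrt (beta k h n) <= sqrt_beta_bound h.
Proof.
move=> HM hH kK bg Bne.
have [_] := bg k h n kK (eq_ind H (fun i => (h < i)%N) hH _ HM).
rewrite -HM -/ell => /le_trans; apply.
have e1 := ell_ge1; have e0 : 0 <= ell ^+ m by rewrite exprn_ge0 //; lra.
have k5 := cov_const_ge5; have x1 := x_ge1 hH; have x'0 := x'_ge0 h.+1.
have h1 : cb * ell ^+ m <= `|cb| * ell ^+ m by rewrite ler_wpM2r // ler_norm.
apply: le_trans (ler_wpM2r (sqrtr_ge0 _) h1) _.
rewrite /sqrt_beta_bound ler_wpM2l ?mulr_ge0 // ler_wsqrtr //.
have := ln_covering_le_softO hH kK Bne.
have [_ _ /(_ _ hH)[_ lN]] := logfac_ge.
have := fdim_le_x h; have e2 : x h <= ell * x h by rewrite ler_peMl // x_ge0.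
have e3 : ell <= ell * x h by rewrite ler_peMr //; lra.
have e4 : 2 * (ell * x h) <= cov_const * (ell * x h).
  by rewrite ler_wpM2r ?mulr_ge0 ?x_ge0 //; lra.
have e5 : 0 <= ell * x' h.+1 by rewrite mulr_ge0 //; lra.
have -> : (cov_const - 2) * ell * x' h.+1
  = cov_const * (ell * x' h.+1) - 2 * (ell * x' h.+1) by ring.
have -> : cov_const * ell * (x h + x' h.+1)
  = cov_const * (ell * x h) + cov_const * (ell * x' h.+1) by ring.
lra.
Qed.

Definition bonus_const : R :=
  2 * `|cb| * (cov_const + pot_const) + 2 * c * (1 + pot_const).

Lemma bonus_const_ge0 : 0 <= bonus_const.
Proof.
have k5 := cov_const_ge5; have g0 := pot_const_ge0.
by rewrite /bonus_const addr_ge0 // !mulr_ge0 //; lra.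
Qed.

(** The coupling of consecutive steps is absorbed here: with [y = x h + x' h.+1], the square roots
    of [y] and [x h] multiply to at most [y]. Square roots of constants are traded for the
    constants, or for one plus them, and the two roots of [ell] make the additional power of the
    logarithm. *)
Lemma bonus_bound_softO h (I : R) : (h < H)%N -> 0 <= I ->
  K%:R * I + 2 * ((sqrt_beta_bound h + c * Num.sqrt (fdim L h)%:R)
      * Num.sqrt (potential_bound L l K h * ((nreg L h)%:R * K%:R))
    + I * K%:R * Num.sqrt (potential_bound L l K h))
  <= ell ^+ m.+1 * (bonus_const * ((x h + x' h.+1) * Num.sqrt K%:R)
      + (3 + 2 * pot_const) * (Num.sqrt (fdim L h)%:R * I * K%:R)).
Proof.
move=> hH I0.
have k5 := cov_const_ge5; have x1 := x_ge1 hH; have x'0 := x'_ge0 h.+1.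
have e1 := ell_ge1; have g0 := pot_const_ge0; have l0 := l_ge0.
have G0 : 0 <= potential_bound L l K h by exact: potential_bound_ge0 (dpos hH).
have Gle := potential_bound_le hH.
have d1 : 1 <= (fdim L h)%:R :> R by rewrite ler1n dpos.
have dx := fdim_le_x h.
have Kp : 1 <= K%:R :> R by rewrite ler1n.
set y := x h + x' h.+1; set sK := Num.sqrt (K%:R : R); set d := (fdim L h)%:R in d1 dx Gle *.
set g := pot_const in g0 Gle *; set G := potential_bound L l K h in G0 Gle *.
have gE : g = pot_const by [].
clearbody g G.
have sK0 : 0 <= sK by exact: sqrtr_ge0.
have sKE : sK ^+ 2 = K%:R by rewrite sqr_sqrtr.
have sd1 : 1 <= Num.sqrt d by rewrite -[leLHS]sqrtr1 ler_wsqrtr.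
have sdE : Num.sqrt d ^+ 2 = d by rewrite sqr_sqrtr //; lra.
have em1 : ell <= ell ^+ m.+1 by rewrite exprS ler_peMr ?exprn_ege1 //; lra.
have em0 : 0 <= ell ^+ m by rewrite exprn_ge0 //; lra.
have xy : x h <= y by rewrite lerDl.
have y1 : 1 <= y by lra.
have GN : G * ((nreg L h)%:R * K%:R) <= g * ell * x h * K%:R.
  have -> : g * ell * x h * K%:R = g * ell * d * ((nreg L h)%:R * K%:R).
    by rewrite /x natrM -/d; ring.
  by rewrite ler_wpM2r.
have GN0 : 0 <= G * ((nreg L h)%:R * K%:R) by rewrite !mulr_ge0.
have b1 : sqrt_beta_bound h * Num.sqrt (G * ((nreg L h)%:R * K%:R))
    <= `|cb| * (cov_const + g) * (ell ^+ m.+1 * (y * sK)).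
  rewrite /sqrt_beta_bound -/y.
  have : Num.sqrt (cov_const * ell * y) * Num.sqrt (G * ((nreg L h)%:R * K%:R))
      <= (cov_const + g) * ell * y * sK.
    apply: sqrt_mul_le => //; first by rewrite !mulr_ge0 //; lra.
      by rewrite !mulr_ge0 //; lra.
    apply: le_trans (ler_wpM2l _ GN) _; first by rewrite !mulr_ge0 //; lra.
    rewrite !exprMn sKE.
    have -> : cov_const * ell * y * (g * ell * x h * K%:R)
      = (cov_const * g) * ell ^+ 2 * (y * x h) * K%:R by ring.
    rewrite ler_wpM2r // expr2 [X in _ <= _ * X]expr2.
    apply: ler_pM; rewrite ?mulr_ge0 //; try lra.
      by rewrite ler_wpM2r ?mulr_ge0 //; try lra; nra.
    by rewrite ler_wpM2l //; lra.
  move=> /(ler_wpM2l (mulr_ge0 (normr_ge0 cb) em0)).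
  rewrite exprS !mulrA => /le_trans; apply.
  by rewrite le_eqVlt; apply/orP; left; apply/eqP; ring.
have b2 : c * Num.sqrt d * Num.sqrt (G * ((nreg L h)%:R * K%:R))
    <= c * (1 + g) * (ell * (y * sK)).
  rewrite -!mulrA ler_wpM2l //.
  have := @sqrt_mul_le d (G * ((nreg L h)%:R * K%:R)) ((1 + g) * (ell * (y * sK))).
  apply => //; rewrite ?mulr_ge0 //; try lra.
  apply: le_trans (ler_wpM2l _ GN) _; first lra.
  rewrite !exprMn sKE.
  have -> : d * (g * ell * x h * K%:R) = g * (ell * ((d * x h) * K%:R)) by ring.
  have gg : g <= (1 + g) ^+ 2 by rewrite expr2; nra.
  have ee : ell <= ell ^+ 2 by rewrite expr2; nra.
  have dxy : d * x h <= y ^+ 2 by rewrite expr2; apply: ler_pM; lra.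
  have dx0 : 0 <= d * x h by rewrite mulr_ge0 //; lra.
  have q1 : 0 <= d * x h * K%:R by rewrite mulr_ge0.
  apply: ler_pM => //; first by rewrite mulr_ge0 //; lra.
  apply: ler_pM => //; first lra.
  by rewrite ler_wpM2r.
have b3 : Num.sqrt G <= (1 + g) * ell * Num.sqrt d.
  have := @sqrt_mul_le G 1 ((1 + g) * ell * Num.sqrt d).
  rewrite sqrtr1 !mulr1; apply => //; first by rewrite !mulr_ge0 //; lra.
  apply: le_trans Gle _; rewrite !exprMn sdE ler_wpM2r //.
  have gg : g <= (1 + g) ^+ 2 by rewrite expr2; nra.
  have ee : ell <= ell ^+ 2 by rewrite expr2; nra.
  by apply: ler_pM => //; lra.
have b4 : I * K%:R * Num.sqrt G <= (1 + g) * (ell * (Num.sqrt d * I * K%:R)).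
  have -> : (1 + g) * (ell * (Num.sqrt d * I * K%:R))
    = I * K%:R * ((1 + g) * ell * Num.sqrt d) by ring.
  by rewrite ler_wpM2l // mulr_ge0.
have b5 : K%:R * I <= ell * (Num.sqrt d * I * K%:R).
  rewrite mulrA mulrA [leLHS]mulrC ler_wpM2r // -[leLHS]mul1r ler_wpM2r //.
  by rewrite -[leLHS]mulr1; apply: ler_pM; lra.
set u := y * sK in b1 b2 *; set v := Num.sqrt d * I * K%:R in b4 b5 *.
have u0 : 0 <= u by rewrite mulr_ge0 //; lra.
have v0 : 0 <= v by rewrite !mulr_ge0 //; lra.
have b2' : c * (1 + g) * (ell * u) <= c * (1 + g) * (ell ^+ m.+1 * u).
  by rewrite ler_wpM2l ?mulr_ge0 ?ler_wpM2r //; lra.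
have b4' : (1 + g) * (ell * v) <= (1 + g) * (ell ^+ m.+1 * v).
  by rewrite ler_wpM2l ?ler_wpM2r //; lra.
have b5' : ell * v <= ell ^+ m.+1 * v by rewrite ler_wpM2r.
have -> : ell ^+ m.+1 * (bonus_const * u + (3 + 2 * g) * v)
  = 2 * (`|cb| * (cov_const + g) * (ell ^+ m.+1 * u))
    + 2 * (c * (1 + g) * (ell ^+ m.+1 * u))
    + (ell ^+ m.+1 * v) + 2 * ((1 + g) * (ell ^+ m.+1 * v)).
  by rewrite /bonus_const -gE; ring.
rewrite [(_ + c * _) * _]mulrDl; lra.
Qed.

Lemma sum_shift_le : \sum_(h < H) (x h + x' h.+1) <= 2 * \sum_(h < H) x h.
Proof.
have e1 : \sum_(h < H) x' h = \sum_(h < H) x h.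
  by apply: eq_bigr => h _; rewrite /x' ltn_ord.
have : \sum_(h < H.+1) x' h = x' 0 + \sum_(h < H) x' h.+1 by rewrite big_ord_recl.
rewrite big_ord_recr /= e1 {1}/x' ltnn addr0 big_split /=.
by have := x'_ge0 0; lra.
Qed.

End SoftO.


Lemma probability_setI_ge {R : realType} d (T : measurableType d)
    (P : probability T R) (E F : set T) (a b : R) :
  measurable E -> measurable F -> ((1 - a)%:E <= P E)%E -> ((1 - b)%:E <= P F)%E ->
  ((1 - (a + b))%:E <= P (E `&` F))%E.
Proof.
move=> mE mF Ea Fb.
have fin (U : set T) : measurable U -> P U = (fine (P U))%:E.
  by move=> mU; rewrite fineK // fin_num_measure.
have le1 : (P E <= P (E `&` F) + P (~` F))%E.
  apply: le_trans (measureU2 P (measurableI _ _ mE mF) (measurableC mF)).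
  apply: le_measure; rewrite ?inE //.
    by apply: measurableU; [exact: measurableI|exact: measurableC].
  by move=> x Ex; have [Fx|nFx] := pselect (F x); [left|right].
move: le1 Ea Fb; rewrite probability_setC // (fin E) // (fin F) // (fin (E `&` F)); last exact: measurableI.
by rewrite -EFinB -EFinD !lee_fin; lra.
Qed.

Theorem theorem2 (R : realType) (cL cR cbeta : R) (mbeta : nat) :
  exists (C : R) (m : nat),
  forall (dS dA dO : measure_display) (S : measurableType dS)
    (A : measurableType dA) (Omega : measurableType dO)
    (P : probability Omega R)
    (M : mdp R S A) (L : features R S A) (I delta : R) (K : nat)
    (X : process R S A Omega)
    (beta : nat -> forall h, 'I_(nreg L h) -> R)
    (thbar : nat -> Omega -> param L),
  let H := horizon M in
  (0 < H)%N -> (0 < K)%N -> 0 < delta < 1 ->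
  normalized M ->
  locally_linearizable M L I ->
  (Lphi L H <= cL%:E)%E ->
  (forall h (n : 'I_(nreg L h)), (h < H)%N ->
     Rdiam n <= cR * Num.sqrt (fdim L h)%:R) ->
  (forall h (n : 'I_(nreg L h)) th, (h < H)%N -> Bset L n th ->
     enorm th <= Rdiam n) ->
  mdp_interaction P M K X ->
  cinderella_run M I 1 X beta K thbar ->
  beta_growth M beta K delta cbeta mbeta ->
  with_prob P (1 - delta / 2) (confidence_event M 1 X beta K) ->
  with_prob P (1 - delta)
    [set w | regret M X K w <=
       C * logfac L H K delta ^+ m *
         (\sum_(h < H) (nreg L h * fdim L h)%:R * Num.sqrt K%:R
          + \sum_(h < H) Num.sqrt (fdim L h)%:R * I * K%:R)].
Proof.
(* The added 1 keeps the caps, and hence the scale [q], strictly positive. *)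
pose c1 := cL * cR + 1.
(* The factor 2 pays for the shifted sum over steps, [6 * c1] for the martingale, and the 4 is the 3
   of the bonus sum plus 1 for the optimism error [K * H * I]. *)
exists (2 * bonus_const cL cR cbeta + 6 * c1 + (4 + 2 * pot_const cL)), mbeta.+1.
move=> dS dA dO S A Omega P M L I delta K X beta thbar H H0 K0 d01 normM LL LphiL Rc Bnorm
  intX run bg [E1 [mE1 PE1 E1conf]].
have dpos h : (h < H)%N -> (0 < fdim L h)%N by have [dp _ _ _] := LL; exact: dp.
have l0 : 0 <= cL := l_ge0 H0 LphiL.
have I0 := I_ge0 LL H0.
have phil h z := Lphi_le LphiL z (h := h).
have c0 : 0 <= cR.
  have n0 := rho L 0 point.
  have := le_trans (Rdiam_ge0 LL Bnorm n0 H0) (Rc _ n0 H0).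
  by rewrite pmulr_lge0 // sqrtr_gt0 ltr0n dpos.
have c1p : 0 < c1 by rewrite ltr_wpDl // mulr_ge0.
have Bne h : (h < H)%N -> exists th : 'I_(nreg L h) -> 'cV[R]_(fdim L h),
    forall n, Bset L n (th n).
  by move=> hH; have [th C] := bellman_consistent_exists LL; exists (th h); exact: (C h hH).1.
pose cap h : R := c1 * Num.sqrt (fdim L h)%:R.
have cap0 h : 0 <= cap h by rewrite mulr_ge0 ?sqrtr_ge0 // ltW.
have capE h : (h < H)%N -> cL * (cR * Num.sqrt (fdim L h)%:R) <= cap h.
  by move=> _; rewrite mulrA ler_wpM2r ?sqrtr_ge0 // lerDl.
pose D : R := \sum_(h < H) (fdim L h)%:R.
have capD : \sum_(h < H) cap h ^+ 2 = c1 ^+ 2 * D.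
  by rewrite mulr_sumr; apply: eq_bigr => h _; rewrite exprMn sqr_sqrtr.
pose x h : R := (nreg L h * fdim L h)%:R.
have D1 : 1 <= D.
  apply: (@le_trans _ _ (fdim L 0)%:R); first by rewrite ler1n dpos.
  by rewrite /D (bigD1 (Ordinal H0)) //= lerDl sumr_ge0.
have Dx : D <= \sum_(h < H) x h by apply: ler_sum => h _; exact: fdim_le_x.
have K1 : 1 <= K%:R :> R by rewrite ler1n.
have DK : 0 < D * K%:R by rewrite mulr_gt0 //; lra.
(* Standard-deviation scale of the martingale; its inverse is the exponential parameter. *)
pose q := c1 * Num.sqrt (D * K%:R).
have q0 : 0 < q by rewrite mulr_gt0 // sqrtr_gt0.
have q2 : q ^+ 2 = c1 ^+ 2 * D * K%:R by rewrite exprMn sqr_sqrtr ?mulrA // ltW.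
have [dl0 dl1] := andP d01.
(* Chosen so that the exponent [4 - t / q] equals [- ln (2 / delta)]. *)
pose t := q * (4 + ln (2 / delta)).
have bge k h w z : (k < K)%N -> (h < H)%N -> 0 <= bonus I X beta k h w z.
  by move=> _; exact: (bonus_ge0 X beta H0 LL Bnorm).
have qi : 0 < q^-1 by rewrite invr_gt0.
have [mE2 PE2] := noise_tail intX bge cap0
  (fun k h kK hH => measurable_bonus beta intX LL kK hH) t qi K0.
have expE : expR (q^-1 ^+ 2 * (4 * (\sum_(h < H) cap h ^+ 2) * K%:R) - q^-1 * t) = delta / 2.
  rewrite capD.
  have -> : q^-1 ^+ 2 * (4 * (c1 ^+ 2 * D) * K%:R) - q^-1 * t = - ln (2 / delta).
    have -> : 4 * (c1 ^+ 2 * D) * K%:R = 4 * q ^+ 2 by rewrite q2; ring.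
    by rewrite /t; field; rewrite gt_eqF.
  by rewrite expRN lnK ?invf_div // posrE divr_gt0.
rewrite expE in PE2.
pose Z w : R := \sum_(k < K) \sum_(h < H)
  (action_noise M X (bonus I X beta) cap k h w
   + state_noise M X (bonus I X beta) cap k h w).
(* [E1] is a measurable event inside the confidence event; each of the two events fails with
   probability at most [delta / 2]. *)
exists (E1 `&` [set w | Z w <= t]); split.
- exact: measurableI mE1 mE2.
- rewrite [X in (1 - X)%:E](_ : delta = delta / 2 + delta / 2); last by field.
  exact: probability_setI_ge mE1 mE2 PE1 PE2.
move=> w [/E1conf conf Zt] /=.
pose ell := logfac L H K delta.
have ell1 : 1 <= ell by exact: (ell_ge1 H0 K0 d01 dpos).
have [dle _ _] := logfac_ge H0 K0 d01 dpos; rewrite -/ell in dle.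
apply: le_trans (regret_le H0 normM LL l0 phil Bnorm Rc intX run capE cap0 conf) _.
set x' := fun h : nat => if (h < H)%N then x h else 0.
have bsum h : (h < H)%N -> \sum_(k < K) bonus I X beta k h w (za X k h w)
    <= ell ^+ mbeta.+1 * (bonus_const cL cR cbeta * ((x h + x' h.+1) * Num.sqrt K%:R)
      + (3 + 2 * pot_const cL) * (Num.sqrt (fdim L h)%:R * I * K%:R)).
  move=> hH.
  apply: le_trans (bonus_bound_softO H0 K0 d01 dpos LphiL c0 cbeta mbeta hH I0).
  apply: (sum_bonus_le X I0 l0 w (dpos _ hH)).
  - by move=> z; exact: phil.
  - by move=> k n kK; exact: (sqrt_beta_le H0 K0 d01 dpos LphiL c0 Rc Bnorm n erefl hH kK bg Bne).
  - by move=> n; exact: Rc.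
  - by rewrite !mulr_ge0 ?sqrtr_ge0 ?exprn_ge0 // (le_trans ler01).
  - by rewrite mulr_ge0 ?sqrtr_ge0.
set T2 := \sum_(h < H) Num.sqrt (fdim L h)%:R * I * K%:R.
set T1 := \sum_(h < H) (nreg L h * fdim L h)%:R * Num.sqrt K%:R.
have T1E : T1 = (\sum_(h < H) x h) * Num.sqrt K%:R by rewrite /T1 mulr_suml.
have sK0 : 0 <= Num.sqrt (K%:R : R) by exact: sqrtr_ge0.
have em1 : 1 <= ell ^+ mbeta.+1 by exact: exprn_ege1.
have em2 : ell <= ell ^+ mbeta.+1 by rewrite exprS ler_peMr ?exprn_ege1 //; lra.
have T10 : 0 <= T1 by rewrite T1E mulr_ge0 // sumr_ge0.
have T20 : 0 <= T2 by apply: sumr_ge0 => h _; rewrite !mulr_ge0 ?sqrtr_ge0.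
have HT2 : K%:R * (H%:R * I) <= T2.
  have -> : K%:R * (H%:R * I) = \sum_(h < H) I * K%:R.
    by rewrite sumr_const card_ord -[RHS]mulr_natl; ring.
  apply: ler_sum => h _; rewrite -mulrA -[leLHS]mul1r ler_wpM2r ?mulr_ge0 //.
  by rewrite -[leLHS]sqrtr1 ler_wsqrtr // ler1n dpos.
have b0 : 0 <= bonus_const cL cR cbeta by exact: (bonus_const_ge0 H0 LphiL c0 cbeta).
have g0 : 0 <= pot_const cL by exact: pot_const_ge0.
have BS : \sum_(h < H) \sum_(k < K) bonus I X beta k h w (za X k h w)
    <= ell ^+ mbeta.+1 * (2 * bonus_const cL cR cbeta * T1
        + (3 + 2 * pot_const cL) * T2).
  apply: le_trans (ler_sum _ (fun (h : 'I_H) _ => bsum h (ltn_ord h))) _.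
  rewrite -mulr_sumr big_split /= -!mulr_sumr -mulr_suml.
  rewrite ler_wpM2l ?lerD2r //; first lra.
  rewrite [2 * _]mulrC -mulrA ler_wpM2l // T1E mulrA ler_wpM2r //.
  exact: sum_shift_le.
have tle : t <= 6 * c1 * (ell ^+ mbeta.+1 * T1).
  rewrite /t /q sqrtrM ?(le_trans ler01) //.
  have sD : Num.sqrt D <= \sum_(h < H) x h.
    apply: le_trans Dx; rewrite -[leRHS](ger0_norm (le_trans ler01 D1)) -sqrtr_sqr.
    by rewrite ler_wsqrtr // expr2 ler_peMr //; lra.
  have ln2 : ln (2 / delta) <= 1 + ln delta^-1.
    rewrite lnM ?posrE ?invr_gt0 // lerD2r.
    by rewrite (_ : 2 = 1 + 1 :> R) //; apply: le_ln1Dx; lra.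
  have l4 : 4 + ln (2 / delta) <= 6 * ell by lra.
  have l40 : 0 <= 4 + ln (2 / delta).
    by rewrite addr_ge0 // ln_ge0 // ler_pdivlMr //; lra.
  have -> : 6 * c1 * (ell ^+ mbeta.+1 * T1)
    = c1 * (\sum_(h < H) x h * Num.sqrt K%:R) * (6 * ell ^+ mbeta.+1).
    by rewrite -/T1; ring.
  apply: ler_pM => //; try by rewrite !mulr_ge0 ?sqrtr_ge0 // ltW.
    by rewrite ler_pM2l // -mulr_suml ler_wpM2r.
  lra.
have -> : (2 * bonus_const cL cR cbeta + 6 * c1 + (4 + 2 * pot_const cL))
    * logfac L H K delta ^+ mbeta.+1 * (T1 + T2)
  = ell ^+ mbeta.+1 * (2 * bonus_const cL cR cbeta * T1 + (3 + 2 * pot_const cL) * T2)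
    + 6 * c1 * (ell ^+ mbeta.+1 * T1) + ell ^+ mbeta.+1 * T2
    + ell ^+ mbeta.+1 * (2 * bonus_const cL cR cbeta * T2 + 6 * c1 * T2
                         + (4 + 2 * pot_const cL) * T1).
  by rewrite /ell; ring.
have r0 : 0 <= ell ^+ mbeta.+1 * (2 * bonus_const cL cR cbeta * T2 + 6 * c1 * T2
                         + (4 + 2 * pot_const cL) * T1).
  by rewrite mulr_ge0 ?addr_ge0 ?mulr_ge0 //; lra.
have HT2' : T2 <= ell ^+ mbeta.+1 * T2 by rewrite ler_peMl.
rewrite /Z /= in Zt; lra.
Qed.
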